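(* The class $\mathcal{C}$ (defined in the context) contains the following groups. 1. All $C^*$-simple groups $\pi_1(\mathcal{G},v)$ where $\mathcal{G}$ is a locally finite non-singular graph of groups satisfying conditions (i)–(iii) of the context and each $G_e$ is amenable. This includes every $C^*$-simple $\pi_1(\mathcal{G},v)$ where $\Gamma$ consists of two vertices $u,v$ joined by a single edge (directed edges $e,\bar e$), $\mathcal{G}$ is locally finite, $G_e$ is amenable and $(n_e-1)(n_{\bar e}-1)\geq 2$, with $n_f=[G_{r(f)}:\alpha_f(G_f)]$. In particular, it includes the free products $G*F$ of finite groups $G,F$ with $(|G|-1)(|F|-1)\geq 2$. 2. All ($C^*$-simple) groups $\pi_1(\mathcal{G},v)$ where $\mathcal{G}=(\Gamma,G)$ is a locally finite non-singular GBS graph of groups with $\Gamma$ finite that satisfies (i)–(iii) of the context and is not unimodular. This includes: (a) the non-degenerate Baumslag–Solitar groups $BS(k,l)$, where $(|k|-1)(|l|-1)\geq 2$; (b) the groups $\pi_1(\mathcal{G},v)$ of GBS graphs of groups over an $n$-circle, $n\ge 1$, with directed edges $e_1,\dots,e_n$ and their reversals, such that $|k_{e_i}|,|k_{\bar e_i}|\geq 2$ for all $i$ and $q=\prod_{i=1}^n k_{e_i}/k_{\bar e_i}\neq\pm1$; (c) the groups $\pi_1(\mathcal{G},v)$ of GBS graphs of groups over a wedge sum of $m$ many $n$-circles $\Gamma_1,\dots,\Gamma_m$ ($m,n\geq 1$) such that $|k_e|\geq 2$ for all directed edges $e$ and there are a set $F\subset\{1,\dots,m\}$ and a choice of signs with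 $\prod_{i\in F}q_i^{\pm1}\neq\pm1$, where $q_i=\prod_{j=1}^n k_{e_{i,j}}/k_{\bar e_{i,j}}$. In addition, the groups in (b) with $n\geq 2$, and the groups in (c) with $n\geq 2$ or $m\geq 2$, are not isomorphic to any non-degenerate Baumslag–Solitar group $BS(k,l)$, $(|k|-1)(|l|-1)\geq 2$.
   Context: All groups are countable and discrete. Class $\mathcal{C}$. For a locally finite non-singular graph of groups $\mathcal{G}=(\Gamma,G)$ with base vertex $v$ consider: (i) $v\partial X_{\mathcal{G}}$ is infinite; (ii) $\xi$ can flow to $e$ for every $\xi\in\partial X_{\mathcal{G}}$ and $e\in E$; (iii) there is a repeatable path $g_1e_1\dots g_ne_n$ with $|\Sigma_{\bar e_n}|\ge2$. $\mathcal{C}$ is the class of all groups $\pi_1(\mathcal{G},v)$ such that either (i)–(iii) hold, each $G_e$ is amenable and $\pi_1(\mathcal{G},v)$ is $C^*$-simple (i.e. its reduced $C^*$-algebra is simple), or $\mathcal{G}$ is a GBS graph of groups over a finite graph, (i)–(iii) hold and $\mathcal{G}$ is not unimodular. Graphs of groups. $E$ denotes the set of all directed edges of $\Gamma$, with source and range maps $s,r:E\to V$ and edge reversal $e\mapsto\bar e$, where $\bar e\ne e$, $\bar{\bar e}=e$, $s(\bar e)=r(e)$. A graph of groups $\mathcal{G}=(\Gamma,G)$ consists of a connected graph $\Gamma=(V,E)$, vertex groups $G_v$ ($v\in V$), edge groups $G_e=G_{\bar e}$ ($e\in E$), and monomorphisms $\alpha_e:G_e\to G_{r(e)}$. It is locally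 finite if $|r^{-1}(v)|<\infty$ for all $v\in V$ and $[G_{r(e)}:\alpha_e(G_e)]<\infty$ for all $e\in E$. It is non-singular if $[G_{r(e)}:\alpha_e(G_e)]>1$ whenever $r^{-1}(r(e))=\{e\}$. For each $e$ fix a transversal $\Sigma_e\ni 1_{r(e)}$ of $G_{r(e)}/\alpha_e(G_e)$, where $1_w$ is the identity of $G_w$. GBS graphs. $\mathcal{G}$ is a generalized Baumslag–Solitar (GBS) graph of groups if all vertex and edge groups are isomorphic to $\mathbb{Z}$; after identifying them with $\mathbb{Z}$, $\alpha_e$ is multiplication by a non-zero integer $k_e$. For a $\mathcal{G}$-word $\gamma=g_1e_1\dots g_ne_ng_{n+1}$ put $q(\gamma)=\prod_{i=1}^n k_{\bar e_i}/k_{e_i}$. $\mathcal{G}$ is unimodular if $|q(\gamma)|=1$ for every $\mathcal{G}$-word $\gamma$ with the same source and range. $BS(k,l)=\langle a,t: ta^kt^{-1}=a^l\rangle$ is the Baumslag–Solitar group; it is the fundamental group of a GBS graph of groups with one vertex and one loop $e$, with $|k|=|k_e|$, $|l|=|k_{\bar e}|$. Circles and wedges. An $n$-circle is the graph with $n$ vertices and $n$ (geometric) edges forming a cycle (for $n=1$, a vertex with a loop); its directed edges are $e_1,\dots,e_n$ and their reversals, where $e_1,\dots,e_n$ run consistently around the cycle. A wedge sum of $m$ $n$-circles is a graph that is the union of $m$ subgraphs $\Gamma_i$, each an $n$-circle, with one common vertex $v$ and otherwise pairwise disjoint; the directed edges of $\Gamma_i$ are $e_{i,1},\dots,e_{i,n}$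 and their reversals, with $r(e_{i,1})=v$, $s(e_{i,j})=r(e_{i,j+1})$ for $1\le j\le n-1$, $s(e_{i,n})=v$. Words. A $\mathcal{G}$-word is a sequence $g_1$, or $g_1e_1\dots g_ne_n$, or $g_1e_1\dots g_ne_ng_{n+1}$ with $s(e_i)=r(e_{i+1})$, $g_j\in G_{r(e_j)}$ and $g_{n+1}\in G_{s(e_n)}$ (for $n=0$, $g_1\in G_w$ for some $w\in V$); for $n\ge1$ its range is $r(e_1)$ and its source is $s(e_n)$; for $n=0$ and $g_1\in G_w$ both are $w$. It is reduced if (when $n>0$) $g_j\in\Sigma_{e_j}$ for $1\le j\le n$ and $g_{i+1}\ne 1_{r(e_{i+1})}$ whenever $e_i=\bar e_{i+1}$. A $\mathcal{G}$-path is a reduced word of the form $g_1=1$ or $g_1e_1\dots g_ne_n$. A $\mathcal{G}$-path $g_1e_1\dots g_ne_n$ is repeatable if $r(e_1)=s(e_n)$ and $g_1e_1\ne 1_{r(\bar e_n)}\bar e_n$. An infinite reduced word is an infinite sequence $g_1e_1g_2e_2\dots$ all of whose finite initial parts $g_1e_1\dots g_ne_n$ are reduced words. Fundamental group and boundary. The path group $\pi(\mathcal{G})$ is generated by $E\sqcup\bigsqcup_{w\in V}G_w$ (keeping the multiplication of each $G_w$) modulo $\bar ee=1$ and $e\alpha_{\bar e}(g)\bar e=\alpha_e(g)$ for $e\in E$, $g\in G_e$; $\pi_1(\mathcal{G},v)\subset\pi(\mathcal{G})$ is the subgroup of images of $\mathcal{G}$-words with range and source $v$. $v\partial X_{\mathcal{G}}$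 (the visual boundary of the Bass–Serre tree with base vertex $1_vG_v$) is identified with the set of infinite reduced words with range $v$, and $\partial X_{\mathcal{G}}=\bigsqcup_{w\in V}w\partial X_{\mathcal{G}}$. $Z(\mu)$ is the set of infinite reduced words with initial segment $\mu$. Flow. For $e,f\in E$, $f$ can flow to $e$ if $f$ occurs in some infinite reduced word $\xi\in Z(1_{r(e)}e)$ at a place other than as its rangemost (first) edge. A point $\xi\in\partial X_{\mathcal{G}}$ can flow to $e$ if some $f$ occurring in $\xi$ can flow to $e$.
   Formalization: In 2(a) the condition |k| ≠ |l| is added; without it the claim fails, e.g. for BS(3,3), where a^3 generates an infinite central subgroup, so the group is not C*-simple and not in the class. *)

(* Defs.v *)
From HB Require Import structures.
From mathcomp Require Import all_boot all_order all_fingroup all_algebra.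
From mathcomp Require Import finmap generic_quotient complex.
From mathcomp Require Import boolp classical_sets functions cardinality.
From mathcomp Require Import fsbigop reals ereal esum.
From mathcomp Require Import lra.

(* A discrete group is a [groupType]; countability is imposed on the vertex and
   edge groups in [graph_of_groups]. *)

Set Implicit Arguments.
Unset Strict Implicit.
Unset Printing Implicit Defensive.

Import Order.TTheory GRing.Theory Num.Theory.
Local Open Scope classical_set_scope.
Local Open Scope card_scope.
Local Open Scope quotient_scope.
Local Open Scope group_scope.

Definition group_iso (G H : groupType) : Prop :=
  exists2 f : G -> H, bijective f & {morph f : x y / x * y}.

Section Presentation.
Variable S : choiceType.

(* The letter [(x, true)] stands for x and [(x, false)] for x^-1. *)
Definition fword := seq (S * bool).

Definition fword_inv (w : fword) : fword :=
  rev [seq (p.1, ~~ p.2) | p <- w].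

Definition fgen (x : S) : fword := [:: (x, true)].

Definition fpow (x : S) (k : int) : fword := nseq `|k|%N (x, (0 <= k)%R).

Variable rels : fword -> fword -> Prop.

Inductive pres_eq : fword -> fword -> Prop :=
| pres_refl w : pres_eq w w
| pres_sym w1 w2 : pres_eq w1 w2 -> pres_eq w2 w1
| pres_trans w1 w2 w3 : pres_eq w1 w2 -> pres_eq w2 w3 -> pres_eq w1 w3
| pres_cat w1 w2 w1' w2' :
    pres_eq w1 w1' -> pres_eq w2 w2' -> pres_eq (w1 ++ w2) (w1' ++ w2')
| pres_cancel x b : pres_eq [:: (x, b); (x, ~~ b)] [::]
| pres_rel w1 w2 : rels w1 w2 -> pres_eq w1 w2.

Definition pres_eqb : rel fword := fun w1 w2 => `[< pres_eq w1 w2 >].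

Lemma pres_eqb_refl : reflexive pres_eqb.
Proof. by move=> w; apply/asboolP/pres_refl. Qed.

Lemma pres_eqb_sym : symmetric pres_eqb.
Proof. by move=> w1 w2; apply/asboolP/asboolP => /pres_sym. Qed.

Lemma pres_eqb_trans : transitive pres_eqb.
Proof.
move=> w2 w1 w3 /asboolP h1 /asboolP h2; apply/asboolP.
exact: pres_trans h1 h2.
Qed.

Canonical pres_equiv := EquivRel pres_eqb pres_eqb_refl pres_eqb_sym pres_eqb_trans.

Definition presented := {eq_quot pres_equiv}.
HB.instance Definition _ := Choice.on presented.
HB.instance Definition _ := EqQuotient.on presented.

Definition pres_class (w : fword) : presented := \pi_presented w.

Definition pres_one : presented := pres_class [::].
Definition pres_mul (x y : presented) : presented :=
  pres_class (repr x ++ repr y).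
Definition pres_inv (x : presented) : presented :=
  pres_class (fword_inv (repr x)).

Lemma pres_classP w1 w2 : pres_class w1 = pres_class w2 <-> pres_eq w1 w2.
Proof.
split=> [/eqmodP /asboolP // | h]; apply/eqmodP; exact/asboolP.
Qed.

Lemma pres_classK x : pres_class (repr x) = x.
Proof. exact: reprK. Qed.

Lemma pres_repr w : pres_eq (repr (pres_class w)) w.
Proof. by apply/pres_classP; rewrite pres_classK. Qed.

Lemma pres_mulE w1 w2 :
  pres_mul (pres_class w1) (pres_class w2) = pres_class (w1 ++ w2).
Proof. by apply/pres_classP/pres_cat; apply: pres_repr. Qed.

Lemma fword_invV w : pres_eq (fword_inv w ++ w) [::].
Proof.
rewrite /fword_inv; elim: w => [|[x b] w IH]; first exact: pres_refl.
rewrite /= rev_cons cat_rcons.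
apply: pres_trans IH; apply: pres_cat; first exact: pres_refl.
rewrite -[w in pres_eq _ w]cat0s -[_ :: _]/([:: (x, ~~ b); (x, b)] ++ w).
apply: pres_cat; last exact: pres_refl.
by have := pres_cancel x (~~ b); rewrite negbK.
Qed.

Lemma fword_invK : involutive fword_inv.
Proof.
move=> w; rewrite /fword_inv map_rev revK -map_comp.
by rewrite -[RHS]map_id; apply: eq_map => -[x b] /=; rewrite negbK.
Qed.

Lemma fword_Vinv w : pres_eq (w ++ fword_inv w) [::].
Proof. by have := fword_invV (fword_inv w); rewrite fword_invK. Qed.

Lemma pres_mulA : associative pres_mul.
Proof.
move=> x y z; rewrite -[x]pres_classK -[y]pres_classK -[z]pres_classK.
by rewrite !pres_mulE catA.
Qed.

Lemma pres_mul1 : left_id pres_one pres_mul.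
Proof. by move=> x; rewrite -[x]pres_classK pres_mulE. Qed.

Lemma pres_mulr1 : right_id pres_one pres_mul.
Proof. by move=> x; rewrite -[x]pres_classK pres_mulE cats0. Qed.

Lemma pres_mulV : left_inverse pres_one pres_inv pres_mul.
Proof.
move=> x; rewrite -[X in pres_mul _ X]pres_classK pres_mulE.
exact/pres_classP/fword_invV.
Qed.

Lemma pres_mulrV : right_inverse pres_one pres_inv pres_mul.
Proof.
move=> x; rewrite -[X in pres_mul X _]pres_classK pres_mulE.
exact/pres_classP/fword_Vinv.
Qed.

HB.instance Definition _ := isGroup.Build presented
  pres_mulA pres_mul1 pres_mulr1 pres_mulV pres_mulrV.

End Presentation.

(* BS(k, l) = < a, t : t a^k t^-1 = a^l >, with a = true and t = false. *)
Inductive bs_rel (k l : int) : fword bool -> fword bool -> Prop :=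
| BSRel : bs_rel k l
    (fgen false ++ fpow true k ++ fword_inv (fgen false)) (fpow true l).

Definition BS (k l : int) : groupType := presented (bs_rel k l).

Inductive free_prod_rel (G H : groupType) :
    fword (G + H)%type -> fword (G + H)%type -> Prop :=
| FreeProdL (x y : G) :
    free_prod_rel (fgen (inl x) ++ fgen (inl y)) (fgen (inl (x * y)))
| FreeProdR (x y : H) :
    free_prod_rel (fgen (inr x) ++ fgen (inr y)) (fgen (inr (x * y))).

Definition free_product (G H : groupType) : groupType :=
  presented (@free_prod_rel G H).

(* Directed edges are pairs of a geometric edge and an orientation; reversal
   flips the orientation.  Every graph with a fixed-point-free reversal has this
   form, and G_e and G_{bar e} become literally the same group. *)
Definition ebar (A : Type) (e : A * bool) : A * bool := (e.1, ~~ e.2).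

(* Walks are read from range to source: e_1 ... e_n with s(e_i) = r(e_{i+1}). *)
Fixpoint edge_walk (V A : Type) (rng : A * bool -> V) (u : V)
    (p : seq (A * bool)) (w : V) : Prop :=
  if p is e :: p' then rng e = u /\ edge_walk rng (rng (ebar e)) p' w
  else u = w.

Record graph := Graph {
  vert : choiceType;
  gedge : choiceType;
  rng : gedge * bool -> vert;
  graph_connected : forall u w, exists p, edge_walk rng u p w
}.

Definition edge (Gam : graph) : choiceType := (gedge Gam * bool)%type.

Definition src (Gam : graph) (e : edge Gam) : vert Gam := rng (ebar e).

Record graph_of_groups := GraphOfGroups {
  gog_graph :> graph;
  vgrp : vert gog_graph -> groupType;
  egrp : gedge gog_graph -> groupType;
  emono : forall e : edge gog_graph, egrp e.1 -> vgrp (rng e);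
  vgrp_countable : forall w, countable [set: vgrp w];
  egrp_countable : forall a, countable [set: egrp a];
  emonoM : forall e, {morph @emono e : g h / g * h};
  emono_inj : forall e, injective (@emono e);
  (* The transversals Sigma_e of the left cosets G_{r(e)} / alpha_e(G_e), fixed once
     and for all, are part of the data. *)
  transv : forall e : edge gog_graph, set (vgrp (rng e));
  transv1 : forall e, @transv e 1;
  transvP : forall e (g : vgrp (rng e)),
    exists! s, @transv e s /\ exists h, g = s * @emono e h
}.

Arguments emono [g] e _ : rename.
Arguments transv [g] e _ : rename.

Definition lcosets (GG : graph_of_groups) (e : edge GG) :
    set (set (vgrp (rng e))) :=
  [set [set g * emono e h | h in [set: egrp e.1]]
  | g in [set: vgrp (rng e)]].

Arguments lcosets [GG] e _.

(* This is [G_{r(e)} : alpha_e(G_e)] when that index is finite. *)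
Definition eindex (GG : graph_of_groups) (e : edge GG) : nat :=
  #|` fset_set (lcosets e)|.

Definition locally_finite (GG : graph_of_groups) : Prop :=
  (forall w : vert GG, finite_set [set e : edge GG | rng e = w]) /\
  (forall e : edge GG, finite_set (lcosets e)).

Definition nonsingular (GG : graph_of_groups) : Prop :=
  forall e : edge GG, [set f : edge GG | rng f = rng e] = [set e] ->
    `I_2 #<= lcosets e.

Section Words.
Variable GG : graph_of_groups.

(* A letter is a pair g_j e_j with g_j in G_{r(e_j)}. *)
Definition letter : choiceType := {e : edge GG & vgrp (rng e)}.
Definition velt : choiceType := {w : vert GG & vgrp w}.

Definition mkletter (e : edge GG) (g : vgrp (rng e)) : letter :=
  Tagged (fun e : edge GG => vgrp (rng e)) g.
Definition mkvelt (w : vert GG) (g : vgrp w) : velt :=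
  Tagged (fun w : vert GG => vgrp w) g.

(* The letters g_1 e_1 ... g_n e_n, and possibly the last element g_{n+1}. *)
Definition gword := (seq letter * option velt)%type.

Definition wedges (p : seq letter) : seq (edge GG) := [seq tag l | l <- p].

Definition gword_from_to (u : vert GG) (x : gword) (w : vert GG) : Prop :=
  edge_walk (@rng GG) u (wedges x.1) w /\
  match x.2 with None => x.1 <> [::] | Some g => tag g = w end.

Fixpoint no_backtrack (p : seq letter) : Prop :=
  match p with
  | l1 :: (l2 :: _) as p' =>
      (tag l1 = ebar (tag l2) -> tagged l2 <> 1) /\ no_backtrack p'
  | _ => True
  end.

(* Reduced words g_1 e_1 ... g_n e_n with n >= 1. *)
Definition reduced_path (p : seq letter) : Prop :=
  [/\ p <> [::],
      exists u w, edge_walk (@rng GG) u (wedges p) w,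
      forall l, l \in p -> transv (tag l) (tagged l)
    & no_backtrack p].

(* [repeatable l p]: with p = g_2 e_2 ... g_n e_n and l = g_1 e_1, the path
   g_1 e_1 ... g_n e_n is repeatable; then e_n is the tag of [last l p]. *)
Definition repeatable (l : letter) (p : seq letter) : Prop :=
  [/\ reduced_path (l :: p),
      rng (tag l) = src (tag (last l p))
    & l <> mkletter (1 : vgrp (rng (ebar (tag (last l p)))))].

Definition infinite_reduced : set (nat -> letter) :=
  [set xi | forall n, reduced_path (mkseq xi n.+1)].

Definition vboundary (v : vert GG) : set (nat -> letter) :=
  [set xi | infinite_reduced xi /\ rng (tag (xi 0%N)) = v].

Definition edge_can_flow (f e : edge GG) : Prop :=
  exists xi, [/\ infinite_reduced xi,
                 xi 0%N = mkletter (1 : vgrp (rng e))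
               & exists n, tag (xi n.+1) = f].

Definition can_flow (xi : nat -> letter) (e : edge GG) : Prop :=
  exists n, edge_can_flow (tag (xi n)) e.

Definition conditions_i_iii (v : vert GG) : Prop :=
  [/\ infinite_set (vboundary v),
      forall xi e, infinite_reduced xi -> can_flow xi e
    & exists l p, repeatable l p /\
        `I_2 #<= transv (ebar (tag (last l p)))].

End Words.

Section FundamentalGroup.
Variable GG : graph_of_groups.

Definition path_gen : choiceType := (edge GG + velt GG)%type.

Definition pge (e : edge GG) : fword path_gen := fgen (inl e).
Definition pgv (w : vert GG) (g : vgrp w) : fword path_gen :=
  fgen (inr (mkvelt g)).

Inductive path_rel : fword path_gen -> fword path_gen -> Prop :=
| PathMul w (g h : vgrp w) : path_rel (pgv g ++ pgv h) (pgv (g * h))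
| PathBar (e : edge GG) : path_rel (pge (ebar e) ++ pge e) [::]
| PathEdge (e : edge GG) (g : egrp e.1) :
    path_rel (pge e ++ pgv (emono (ebar e) g) ++ pge (ebar e))
             (pgv (emono e g)).

Definition path_group : groupType := presented path_rel.

Definition pg_edge (e : edge GG) : path_group := pres_class path_rel (pge e).
Definition pg_vert (g : velt GG) : path_group :=
  pres_class path_rel (pgv (tagged g)).

Fixpoint path_image (p : seq (letter GG)) : path_group :=
  if p is l :: p' then
    pg_vert (mkvelt (tagged l)) * pg_edge (tag l) * path_image p'
  else 1.

Definition word_image (x : gword GG) : path_group :=
  path_image x.1 * (if x.2 is Some g then pg_vert g else 1).

Definition word_images (u w : vert GG) : set path_group :=
  [set word_image x | x in [set x | gword_from_to u x w]].

Lemma pg_vertM w (g h : vgrp w) :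
  pg_vert (mkvelt (g * h)) = pg_vert (mkvelt g) * pg_vert (mkvelt h).
Proof.
apply: esym; rewrite /pg_vert; apply: (etrans (pres_mulE _ _ _)).
by apply/pres_classP/pres_rel/PathMul.
Qed.

Lemma pg_vert1 w : pg_vert (mkvelt (1 : vgrp w)) = 1.
Proof.
apply: (mulgI (pg_vert (mkvelt (1 : vgrp w)))).
by rewrite -pg_vertM !mulg1.
Qed.

Lemma pg_vertV w (g : vgrp w) :
  pg_vert (mkvelt g^-1) = (pg_vert (mkvelt g))^-1.
Proof.
by apply/eqP; rewrite -(inj_eq (mulgI (pg_vert (mkvelt g)))) -pg_vertM !mulgV
  pg_vert1.
Qed.

Lemma pg_edgeV (e : edge GG) : pg_edge (ebar e) = (pg_edge e)^-1.
Proof.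
apply/eqP; rewrite -(inj_eq (mulIg (pg_edge e))) mulVg; apply/eqP.
rewrite /pg_edge; apply: (etrans (pres_mulE _ _ _)).
by apply/pres_classP/pres_rel/PathBar.
Qed.

Lemma word_images_vert w (g : vgrp w) : word_images w w (pg_vert (mkvelt g)).
Proof. by exists ([::], Some (mkvelt g)); rewrite // /word_image /= mul1g. Qed.

Lemma word_images1 w : word_images w w 1.
Proof. by rewrite -(pg_vert1 w); apply: word_images_vert. Qed.

Lemma word_images_edge (e : edge GG) : word_images (rng e) (src e) (pg_edge e).
Proof.
exists ([:: mkletter (1 : vgrp (rng e))], None) => //.
by rewrite /word_image /= pg_vert1 !mulg1 mul1g.
Qed.

Lemma word_images_cons (l : letter GG) w x : word_images (src (tag l)) w x ->
  word_images (rng (tag l)) w (pg_vert (mkvelt (tagged l)) * pg_edge (tag l) * x).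
Proof.
case=> -[p g] [/= pw gw] <-; exists (l :: p, g); last by rewrite /word_image /= !mulgA.
by split=> //=; case: g gw.
Qed.

Lemma word_images_mull w (g : vgrp w) z x :
  word_images w z x -> word_images w z (pg_vert (mkvelt g) * x).
Proof.
case=> -[[|[e h] p] y] /= [pw yw] <-.
  case: y yw pw => [[w' h]|//] /= <- ww'; subst w'.
  by rewrite /word_image /= mul1g -pg_vertM; apply: word_images_vert.
case: pw => ew pw; rewrite /= in ew; subst w.
exists (mkletter (g * h) :: p, y); first by split=> //=; case: y yw.
by rewrite /word_image /= pg_vertM !mulgA.
Qed.

Lemma word_images_mul u w z x y :
  word_images u w x -> word_images w z y -> word_images u z (x * y).
Proof.
case=> -[p a] [/= pw aw] <- wy; rewrite /word_image /=.
elim: p u pw aw => [|[e g] p IH] u /= pw aw.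
  case: a aw => [[w' h]|//] /= ew'; rewrite mul1g; subst w' u.
  exact: word_images_mull.
case: pw => eu pw; rewrite /= in eu; subst u; rewrite -!mulgA mulgA.
apply: (@word_images_cons (mkletter g)); rewrite /= mulgA.
case: p IH pw aw => [|l p] IH pw aw; last by apply: IH; case: (a) aw.
case: a IH aw => [b|] IH aw; first exact: IH.
by rewrite /= !mul1g; rewrite /= in pw; rewrite /src pw.
Qed.

Lemma word_images_inv u w x : word_images u w x -> word_images w u x^-1.
Proof.
case=> -[p a] [/= pw aw] <-; rewrite /word_image /=.
have {aw} ha : word_images w w (if a is Some g then pg_vert g else 1)^-1.
  case: a aw => [[w' h]|] /=; last by rewrite invg1 => _; apply: word_images1.
  by move=> ew'; subst w'; rewrite -pg_vertV; apply: word_images_vert.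
rewrite invMg; apply: word_images_mul ha _.
elim: p u pw => [|[e g] p IH] u /= pw; first by subst w; rewrite invg1; apply: word_images1.
case: pw => eu pw; rewrite /= in eu; subst u.
rewrite !invMg; apply: word_images_mul (IH _ pw) _.
rewrite -pg_edgeV -pg_vertV.
apply: (word_images_mul (w := rng e)); last exact: word_images_vert.
have := word_images_edge (ebar e).
by rewrite /src; case: e {g pw} => c b; rewrite /ebar /= negbK.
Qed.

Variable v : vert GG.

Definition pi1_pred : {pred path_group} := fun x => `[< word_images v v x >].

Lemma pi1_closed : group_closed pi1_pred.
Proof.
split; first by apply/asboolP/word_images1.
move=> x y /asboolP hx /asboolP hy; apply/asboolP.
by apply: word_images_mul hx _; apply: word_images_inv.
Qed.

Record pi1 := Pi1 { pi1_val :> path_group; _ : pi1_val \in pi1_pred }.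

HB.instance Definition _ := [isSub for pi1_val].
HB.instance Definition _ := [Choice of pi1 by <:].
HB.instance Definition _ :=
  SubChoice_isSubGroup.Build path_group pi1_pred pi1 pi1_closed.

End FundamentalGroup.

Section GBS.
Variable GG : graph_of_groups.

(* The edge identification [psi] is shared by e and its reversal. *)
Definition gbs_coeffs (k : edge GG -> int) : Prop :=
  exists (phi : forall w : vert GG, int -> vgrp w)
         (psi : forall a : gedge GG, int -> egrp a),
  [/\ forall w, bijective (phi w) /\
                {morph phi w : i j / (i + j)%R >-> i * j},
      forall a, bijective (psi a) /\
                {morph psi a : i j / (i + j)%R >-> i * j},
      forall e, k e <> 0%R
    & forall e z, emono e (psi e.1 z) = phi (rng e) (k e * z)%R].

Definition word_modulus (k : edge GG -> int) (x : gword GG) : rat :=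
  (\prod_(e <- wedges x.1) ((k (ebar e))%:~R / (k e)%:~R))%R.

Definition unimodular (k : edge GG -> int) : Prop :=
  forall x u, gword_from_to u x u -> (`|word_modulus k x| = 1)%R.

Definition finite_graph : Prop :=
  finite_set [set: vert GG] /\ finite_set [set: gedge GG].

End GBS.

Section Shapes.
Variable Gam : graph.

Definition single_edge_graph (e : edge Gam) : Prop :=
  [/\ rng e <> src e,
      forall w : vert Gam, w = rng e \/ w = src e
    & forall f : edge Gam, f = e \/ f = ebar e].

(* [c 0], ..., [c (n - 1)] are the consistently oriented edges of a subgraph
   which is an n-circle ([ordS] is the cyclic successor). *)
Definition circle_in (n : nat) (c : 'I_n -> edge Gam) : Prop :=
  [/\ forall j, src (c j) = rng (c (ordS j)),
      injective (fun j => rng (c j))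
    & injective (fun p : 'I_n * bool => if p.2 then c p.1 else ebar (c p.1))].

Definition circle_graph (n : nat) (c : 'I_n -> edge Gam) : Prop :=
  [/\ circle_in c,
      forall w : vert Gam, exists j, w = rng (c j)
    & forall f : edge Gam, exists j, f = c j \/ f = ebar (c j)].

Definition wedge_graph (m n : nat) (v : vert Gam)
    (c : 'I_m -> 'I_n -> edge Gam) : Prop :=
  [/\ forall i, circle_in (c i),
      forall i j, nat_of_ord j = 0%N -> rng (c i j) = v,
      forall i1 i2 j1 j2, i1 <> i2 ->
        [/\ rng (c i1 j1) = rng (c i2 j2) -> rng (c i1 j1) = v,
            c i1 j1 <> c i2 j2 & c i1 j1 <> ebar (c i2 j2)],
      forall w : vert Gam, exists i j, w = rng (c i j)
    & forall f : edge Gam, exists i j, f = c i j \/ f = ebar (c i j)].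

Definition circle_ratio (n : nat) (k : edge Gam -> int)
    (c : 'I_n -> edge Gam) : rat :=
  (\prod_(j < n) ((k (c j))%:~R / (k (ebar (c j)))%:~R))%R.

End Shapes.

Section Amenable.
Variables (R : realType) (G : groupType).

Definition amenable : Prop :=
  exists mu : set G -> R,
  [/\ forall A, (0 <= mu A)%R,
      mu [set: G] = 1%R,
      forall A B, A `&` B = set0 -> mu (A `|` B) = (mu A + mu B)%R
    & forall g A, mu [set g * x | x in A] = mu A].

End Amenable.

Section CstarSimple.
Variables (R : realType) (G : groupType).
Local Open Scope ring_scope.

Definition l2_normsq (f : G -> R[i]^o) : \bar R :=
  (\esum_(x in [set: G]) (Normc.normc (f x) ^+ 2)%:E)%E.

Definition l2_pred : {pred G -> R[i]^o} :=
  fun f => `[< (l2_normsq f < +oo)%E >].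

Lemma l2_pred_dom (f g h : G -> R[i]^o) (c : R) : 0 <= c ->
  (forall x, Normc.normc (h x) ^+ 2 <=
             c * Normc.normc (f x) ^+ 2 + c * Normc.normc (g x) ^+ 2) ->
  f \in l2_pred -> g \in l2_pred -> h \in l2_pred.
Proof.
move=> c0 hle /asboolP hf /asboolP hg; apply/asboolP.
have sq_ge0 (u : G -> R[i]^o) x : (0 <= (Normc.normc (u x) ^+ 2)%:E)%E.
  by rewrite lee_fin sqr_ge0.
have fin_scale (u : G -> R[i]^o) : (l2_normsq u < +oo)%E ->
    ((\esum_(x in [set: G]) (c%:E * (Normc.normc (u x) ^+ 2)%:E)) < +oo)%E.
  move=> hu; apply: (@le_lt_trans _ _ (c%:E * l2_normsq u)%E).
    rewrite /esum; apply: ge_ereal_sup => _ [X [finX _] <-].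
    rewrite -ge0_mule_fsumr //; apply: lee_wpmul2l; first by rewrite lee_fin.
    by apply: ereal_sup_ubound; exists X.
  have : (0 <= l2_normsq u)%E by apply: esum_ge0.
  by case: (l2_normsq u) hu => //= r _ _; rewrite -EFinM ltry.
apply: (@le_lt_trans _ _ (\esum_(x in [set: G])
  (c%:E * (Normc.normc (f x) ^+ 2)%:E + c%:E * (Normc.normc (g x) ^+ 2)%:E))%E).
  by apply: le_esum => x _; rewrite -!EFinM -EFinD lee_fin.
have ge0 (u : G -> R[i]^o) x :
    [set: G] x -> (0 <= c%:E * (Normc.normc (u x) ^+ 2)%:E)%E.
  by move=> _; rewrite mule_ge0 // lee_fin.
rewrite (esumD (ge0 f) (ge0 g)).
exact: lte_add_pinfty (fin_scale f hf) (fin_scale g hg).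
Qed.

Lemma l2_submod_closed : submod_closed l2_pred.
Proof.
split=> [|a f g hf hg].
  apply/asboolP; rewrite /l2_normsq esum1 ?ltry // => x _.
  by rewrite [X in Normc.normc X](_ : _ = 0) // Normc.normc0 expr0n.
have n0 (z : R[i]) : 0 <= Normc.normc z by case: z => u v; apply: sqrtr_ge0.
have c0 : 0 <= 2%:R * (1 + Normc.normc a ^+ 2) :> R.
  by rewrite mulr_ge0 // addr_ge0 // sqr_ge0.
apply: (l2_pred_dom c0 _ hf hg) => x.
set p := Normc.normc (f x); set q := Normc.normc (g x).
have le1 : Normc.normc ((a *: f + g) x) <= Normc.normc a * p + q.
  by rewrite -Normc.normcM; apply: le_normcD.
apply: (@le_trans _ _ ((Normc.normc a * p + q) ^+ 2)).
  by apply: lerXn2r; rewrite ?nnegrE ?addr_ge0 ?mulr_ge0 // /p /q ?n0.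
have := sqr_ge0 (Normc.normc a * p - q); have := sqr_ge0 p.
have := sqr_ge0 (Normc.normc a * q).
nra.
Qed.

HB.instance Definition _ :=
  GRing.isSubmodClosed.Build R[i] (G -> R[i]^o) l2_pred l2_submod_closed.

Record l2 := L2 { l2_val :> G -> R[i]^o; _ : l2_val \in l2_pred }.

HB.instance Definition _ := [isSub for l2_val].
HB.instance Definition _ := [Choice of l2 by <:].
HB.instance Definition _ := [SubChoice_isSubLmodule of l2 by <:].

Definition l2_norm (f : l2) : R := Num.sqrt (fine (l2_normsq f)).

Definition l2_op := l2 -> l2.

Lemma l2_translate_subproof (g : G) (f : l2) :
  (fun x => l2_val f (g^-1 * x)%g) \in l2_pred.
Proof.
have /asboolP := valP f; move=> hf; apply/asboolP; move: hf.
rewrite /l2_normsq /=.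
rewrite (@reindex_esum _ _ _ [set: G] [set: G] (fun x => (g^-1 * x)%g)) //.
split=> //; first by move=> x y _ _; apply: mulgI.
by move=> y _; exists (g * y)%g => //; rewrite mulKg.
Qed.

Definition regular_op (g : G) : l2_op := fun f => L2 (l2_translate_subproof g f).

Definition bounded_op : set l2_op :=
  [set T | linear T /\ exists M : R, forall f, l2_norm (T f) <= M * l2_norm f].

(* Closure in operator norm. *)
Definition op_closure (A : set l2_op) : set l2_op :=
  [set T | bounded_op T /\ forall eps : R, 0 < eps ->
     exists2 U, A U & forall f, l2_norm (T f - U f) <= eps * l2_norm f].

Definition regular_span : set l2_op :=
  [set T | exists s : seq (R[i] * G),
     T = fun f => \sum_(p <- s) p.1 *: regular_op p.2 f].

Definition reduced_Cstar : set l2_op := op_closure regular_span.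

Definition closed_ideal (I : set l2_op) : Prop :=
  [/\ I `<=` reduced_Cstar,
      I (fun=> 0),
      forall (a : R[i]) T U, I T -> I U -> I (fun f => a *: T f + U f),
      forall T U, reduced_Cstar T -> I U -> I (T \o U) /\ I (U \o T)
    & op_closure I `<=` I].

Definition Cstar_simple : Prop :=
  forall I, closed_ideal I -> I = [set fun=> 0] \/ I = reduced_Cstar.

End CstarSimple.

(* Membership in the class is up to isomorphism of groups. *)
Definition class_C_amenable (R : realType) (H : groupType) : Prop :=
  exists (GG : graph_of_groups) (v : vert GG),
  [/\ locally_finite GG /\ nonsingular GG,
      conditions_i_iii v,
      forall a : gedge GG, amenable R (egrp a),
      Cstar_simple R (pi1 v)
    & group_iso H (pi1 v)].

Definition class_C_gbs (H : groupType) : Prop :=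
  exists (GG : graph_of_groups) (v : vert GG) (k : edge GG -> int),
  [/\ locally_finite GG /\ nonsingular GG,
      gbs_coeffs k /\ finite_graph GG,
      conditions_i_iii v,
      ~ unimodular k
    & group_iso H (pi1 v)].

Definition class_C (R : realType) (H : groupType) : Prop :=
  class_C_amenable R H \/ class_C_gbs H.

(* Main.v *)
(* The path group acts on normal words (van der Waerden's trick), which gives
   unique normal forms; pi_1 acts on the cylinders of words with a given prefix.
   C*-simplicity comes from Powers' averaging: if every nontrivial element moves
   some cylinder off itself, and the complement of a suitable cylinder Z(mu) has
   arbitrarily many disjoint translates, then averaging conjugates of an element
   of trace 1 in a closed ideal brings it near 1, and a Neumann series puts 1 in
   the ideal.  For a non-unimodular GBS graph a nontrivial element of a vertex
   group cannot fix a cylinder: pushing the integer z along the m-th power of a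
   closed walk of modulus a/b needs b^m | z a^m.
   For the non-isomorphism, the generator a_u of a vertex group has two distinct
   positive powers that are conjugate.  In BS(p,q) this forces an element into a
   conjugate of <a>, by comparing word lengths of cyclically reduced forms.  As
   a_u generates the only vertex group it meets, the preimage of <a> lies in a
   conjugate of every vertex group, which is impossible for two vertices, and
   for one vertex with two loops it would make the edge-counting quotient Z^2
   cyclic. *)
Require Import Defs.
From HB Require Import structures.
From mathcomp Require Import all_boot all_order all_fingroup all_algebra.
From mathcomp Require Import finmap generic_quotient complex.
From mathcomp Require Import boolp classical_sets functions cardinality.
From mathcomp Require Import fsbigop reals ereal esum.
From mathcomp Require Import zify ring lra.

Set Implicit Arguments.
Unset Strict Implicit.
Unset Printing Implicit Defensive.

Import Order.TTheory GRing.Theory Num.Theory.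
Local Open Scope classical_set_scope.
Local Open Scope card_scope.
Local Open Scope quotient_scope.
Local Open Scope group_scope.

(** * Normal forms of words *)

(** Two points carry the Powers property. First, a fixed element acts on all long normal words by
    rewriting a bounded initial part and then multiplying what follows the last rewritten edge by an
    edge group element ([stable]). Comparing the old and the new initial part settles every case
    except equality; there the edge group must act faithfully on the words that follow
    ([edge_free]). Second, the averaging elements are g_j = t_j e0 mu^-1 with mu ending in e0 and
    t_j ending in the reversal of e0, so e0 has to be reachable in both orientations; this is why
    closed walks are used together with their reversals. The l^2 estimates are done with squared
    norms and finite sums, Cauchy-Schwarz replacing inner products. Instead of a positive element
    T*T and a faithful trace, a single nonzero coefficient of T is translated to the identity. In
    the concrete examples, (i)-(iii) come from one observation: if every transversal has a
    nontrivial element, any walk becomes a reduced word once its letters are chosen nontrivial. *)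

Section Words.
Variable GG : graph_of_groups.
Implicit Types (e f : edge GG) (l : letter GG) (p q : seq (letter GG)).

Lemma ebarK e : ebar (ebar e) = e.
Proof. by case: e => c b; rewrite /ebar /= negbK. Qed.

Lemma src_ebar e : src (ebar e) = rng e.
Proof. by rewrite /src ebarK. Qed.

Lemma emono1 e : emono e 1 = 1.
Proof. by apply: (mulgI (emono e 1)); rewrite -emonoM !mulg1. Qed.

Lemma transv_dec e (g : vgrp (rng e)) :
  {sh : vgrp (rng e) * egrp e.1 | transv e sh.1 /\ g = sh.1 * emono e sh.2}.
Proof.
apply: cid; have [s [[ts [h ->]] _]] := transvP g.
by exists (s, h).
Qed.

Definition coset_rep e (g : vgrp (rng e)) := (sval (transv_dec g)).1.
Definition coset_rem e (g : vgrp (rng e)) := (sval (transv_dec g)).2.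

Lemma coset_repP e (g : vgrp (rng e)) : transv e (coset_rep g).
Proof. by rewrite /coset_rep; case: transv_dec => -[s h] []. Qed.

Lemma coset_rep_rem e (g : vgrp (rng e)) : g = coset_rep g * emono e (coset_rem g).
Proof. by rewrite /coset_rep /coset_rem; case: transv_dec => -[s h] []. Qed.

Lemma coset_rep_uniq e (g s : vgrp (rng e)) h :
  transv e s -> g = s * emono e h -> coset_rep g = s /\ coset_rem g = h.
Proof.
move=> ts gE; have [s' [_ us]] := transvP g.
have es : coset_rep g = s.
  rewrite -(us s); last by split=> //; exists h.
  by apply/esym/us; split; [exact: coset_repP | exists (coset_rem g); exact: coset_rep_rem].
split=> //; apply: (@emono_inj GG e); apply: (mulgI s).
by rewrite -gE -{1}es -coset_rep_rem.
Qed.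

Lemma coset_rep_transv e (s : vgrp (rng e)) : transv e s -> coset_rep s = s /\ coset_rem s = 1.
Proof. by move=> ts; apply: coset_rep_uniq => //; rewrite emono1 mulg1. Qed.

Lemma coset_rep_emono e h : coset_rep (emono e h) = 1 /\ coset_rem (emono e h) = h.
Proof. by apply: coset_rep_uniq; [exact: transv1 | rewrite mul1g]. Qed.

(** The default 1 makes the action below a total function on untyped words; on valid words the tags
    agree and the default is never reached. *)
Definition vat (w : vert GG) (g : velt GG) : vgrp w :=
  if tag g =P w is ReflectT E then eq_rect _ (@vgrp GG) (tagged g) _ E else 1.

Lemma vat_mk w (g : vgrp w) : vat w (mkvelt g) = g.
Proof. by rewrite /vat; case: eqP => //= E; rewrite (eq_axiomK E). Qed.

Lemma velt_mk (g : velt GG) : exists w (h : vgrp w), g = mkvelt h.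
Proof. by case: g => w h; exists w, h. Qed.

Lemma letter_mk l : exists e (h : vgrp (rng e)), l = mkletter h.
Proof. by case: l => e h; exists e, h. Qed.

Lemma mkvelt_inj w : injective (@mkvelt GG w).
Proof. by move=> g h /(congr1 (vat w)); rewrite !vat_mk. Qed.

Lemma mkletter_inj e : injective (@mkletter GG e).
Proof. by move=> g h /eqP; rewrite /mkletter eq_Tagged => /eqP. Qed.

Definition one1 e : letter GG := mkletter (1 : vgrp (rng e)).

(* The pair (p, a) stands for the word p followed by the vertex element a. *)
Definition word : Type := (seq (letter GG) * velt GG)%type.

(* Left multiplication by g: the coset representative of g * g_1 stays in the
   first letter and the remainder is carried through the edge. *)
Fixpoint vactp (g : velt GG) p (a : velt GG) : word :=
  if p is l :: p' then
    let y := vat (rng (tag l)) g * tagged l in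
    let x := vactp (mkvelt (emono (ebar (tag l)) (coset_rem y))) p' a in
    (mkletter (coset_rep y) :: x.1, x.2)
  else ([::], mkvelt (vat (tag a) g * tagged a)).

Definition vact g (x : word) : word := locked (vactp g x.1 x.2).

Lemma vact_cons e (g s : vgrp (rng e)) p a :
  vact (mkvelt g) (mkletter s :: p, a) =
  (mkletter (coset_rep (g * s)) ::
     (vact (mkvelt (emono (ebar e) (coset_rem (g * s)))) (p, a)).1,
   (vact (mkvelt (emono (ebar e) (coset_rem (g * s)))) (p, a)).2).
Proof. by rewrite /vact -!lock /= vat_mk. Qed.

Lemma vact_nil w (g h : vgrp w) :
  vact (mkvelt g) ([::], mkvelt h) = ([::], mkvelt (g * h)).
Proof. by rewrite /vact -!lock /= vat_mk. Qed.

(** With coset representatives in front of every edge, only one cancellation can occur on the left: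
    against a leading letter [one1 (ebar e)]. *)
Definition eact e (x : word) : word :=
  if x.1 is l :: p then
    if l == one1 (ebar e) then (p, x.2) else (one1 e :: x.1, x.2)
  else ([:: one1 e], x.2).

(** The condition for [l] to come right after [e] in a reduced word. Backtracking is excluded by an
    inequality of whole letters, which avoids transporting vertex elements along equalities of
    edges. *)
Definition okl e l :=
  [/\ rng (tag l) = src e, transv (tag l) (tagged l) & l <> one1 (ebar e)].

Fixpoint follow e p : Prop :=
  if p is l :: p' then okl e l /\ follow (tag l) p' else True.

Definition startok (u : vert GG) p : Prop :=
  if p is l :: p' then
    [/\ rng (tag l) = u, transv (tag l) (tagged l) & follow (tag l) p']
  else True.

Definition pend (u : vert GG) p : vert GG := last u [seq src (tag l) | l <- p].

Definition valid u (x : word) := startok u x.1 /\ tag x.2 = pend u x.1.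

Lemma follow_start e p : follow e p -> startok (src e) p.
Proof. by case: p => //= l p [[? ? _] ?]. Qed.

Lemma follow_cat e p q : follow e (p ++ q) <->
  follow e p /\ follow (last e (wedges p)) q.
Proof.
elim: p e => [|l p IH] e /=; first by split=> // -[].
by rewrite IH; tauto.
Qed.

Lemma startok_cat u l p q : startok u (l :: p ++ q) <->
  startok u (l :: p) /\ follow (last (tag l) (wedges p)) q.
Proof.
split; first by case=> rl tl /follow_cat[].
by case=> -[rl tl fp] fq; split=> //; apply/follow_cat.
Qed.

Lemma follow_startP e p : startok (src e) p ->
  (forall l p', p = l :: p' -> l <> one1 (ebar e)) -> follow e p.
Proof. by case: p => //= l p [? ? ?] /(_ l p erefl). Qed.

(** If the new representative at [ebar e] were 1, the product of the edge group element with s would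
    lie in the image of the edge group, hence so would s; its representative would be 1, and the old
    letter would already backtrack. *)
Lemma okl_act e l (h : egrp e.1) : okl e l ->
  okl e (mkletter (coset_rep (vat (rng (tag l)) (mkvelt (emono (ebar e) h))
                        * tagged l))).
Proof.
case: (letter_mk l) => f [s ->] [/= rs ts s1].
split=> //; first exact: coset_repP.
move=> E; have ef : f = ebar e by move: E => /(congr1 tag).
subst f; move: E => /mkletter_inj; rewrite vat_mk => E.
apply: s1; congr mkletter.
have [<- _] := coset_rep_transv ts.
have := coset_rep_rem (emono (ebar e) h * s); rewrite E mul1g => E2.
have -> : s = emono (ebar e) (h^-1 * coset_rem (emono (ebar e) h * s)).
  by rewrite emonoM -E2 mulgA -emonoM mulVg emono1 mul1g.
by case: (@coset_rep_emono (ebar e) (h^-1 * coset_rem (emono (ebar e) h * s))).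
Qed.

Lemma vact_wedges g x : wedges (vact g x).1 = wedges x.1.
Proof.
by case: x => p a; rewrite /vact -lock /=; elim: p g => //= l p IH g; rewrite IH.
Qed.

Lemma vact_tag g x : tag (vact g x).2 = tag x.2.
Proof.
by case: x => p a; rewrite /vact -lock /=; elim: p g => //= l p IH g; rewrite IH.
Qed.

Lemma vact_follow e (h : egrp e.1) p a : follow e p ->
  follow e (vact (mkvelt (emono (ebar e) h)) (p, a)).1.
Proof.
rewrite /vact -lock /=; elim: p e h => //= l p IH e h [ol fp].
by split; [exact: okl_act | exact: IH].
Qed.

Lemma pend_wedges u p : pend u p = last u [seq src e | e <- wedges p].
Proof. by rewrite /pend /wedges -map_comp. Qed.

Lemma vact_valid w (g : vgrp w) x : valid w x -> valid w (vact (mkvelt g) x).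
Proof.
case: x => p a [sp ea]; split; last first.
  by rewrite vact_tag pend_wedges vact_wedges -pend_wedges.
case: p sp {ea} => [|l p]; first by rewrite /vact -lock.
case: (letter_mk l) => e [s ->] /= [rl tl fp]; subst w.
rewrite vact_cons; split=> //; first exact: coset_repP.
exact: vact_follow.
Qed.

Lemma valid_nil u a : valid u ([::], a) <-> tag a = u.
Proof. by split=> [[]|]. Qed.

Lemma valid_cons u l p a : valid u (l :: p, a) <->
  [/\ rng (tag l) = u, transv (tag l) (tagged l), follow (tag l) p
    & valid (src (tag l)) (p, a)].
Proof.
split=> [[[r t f] e]|[r t f [_ e]]] //; split=> //; split=> //.
exact: follow_start.
Qed.

(** If h s = s' r' and g s' = s'' r'' with remainders r', r'' in the edge group, then g h s = s''
    (r'' r'). By uniqueness of this decomposition the remainders multiply before they are carried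
    through the edge, and induction applies. *)
Lemma vactM w (g h : vgrp w) x : valid w x ->
  vact (mkvelt g) (vact (mkvelt h) x) = vact (mkvelt (g * h)) x.
Proof.
case: x => p a; elim: p w g h => [|l p IH] w g h.
  move/valid_nil=> ea; case: (velt_mk a) ea => u [b ->] /= ea; subst u.
  by rewrite (vact_nil h) (vact_nil g) (vact_nil (g * h)) mulgA.
move/valid_cons; case: (letter_mk l) => e [s ->] /= [ew ts fp vp]; subst w.
rewrite !vact_cons.
have E : g * h * s = coset_rep (g * coset_rep (h * s)) *
    emono e (coset_rem (g * coset_rep (h * s)) * coset_rem (h * s)).
  by rewrite emonoM mulgA -coset_rep_rem -!mulgA -coset_rep_rem.
have [-> ->] := coset_rep_uniq (coset_repP _) E.
by rewrite emonoM -(IH (src e)) // -surjective_pairing.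
Qed.

Lemma vact1 w x : valid w x -> vact (mkvelt (1 : vgrp w)) x = x.
Proof.
case: x => p a; elim: p w => [|l p IH] w.
  move/valid_nil=> ea; case: (velt_mk a) ea => u [b ->] /= ea; subst u.
  by rewrite vact_nil mul1g.
move/valid_cons; case: (letter_mk l) => e [s ->] /= [ew ts fp vp]; subst w.
by rewrite vact_cons mul1g; have [-> ->] := coset_rep_transv ts; rewrite emono1 IH.
Qed.

Lemma eact_valid e x : valid (src e) x -> valid (rng e) (eact e x).
Proof.
case: x => -[|l p] a.
  move/valid_nil => ea; rewrite /eact /=; apply/valid_cons; split=> //.
  exact: transv1.
case/valid_cons => rl tl fp vp; rewrite /eact /=; case: eqP => [el|nl].
  by subst l; rewrite -src_ebar.
apply/valid_cons; split=> //; first exact: transv1.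
by apply/valid_cons; split.
Qed.

Lemma eactK e x : valid (src e) x -> eact (ebar e) (eact e x) = x.
Proof.
case: x => -[|l p] a.
  by move/valid_nil => ea; rewrite /eact /= ebarK eqxx.
case/valid_cons => rl tl fp vp; rewrite /eact /=; case: eqP => [el|nl] /=; last first.
  by rewrite ebarK eqxx.
subst l; case: p fp {vp} => //= l p [[_ _ /eqP ne] _].
by rewrite (negbTE ne).
Qed.

(** The edge relation of the path group, checked on words. An edge group element leaves the letter
    [one1 (ebar e)] unchanged and comes out behind it as its image under the other monomorphism. *)
Lemma eact_rel e (h : egrp e.1) x : valid (rng e) x ->
  eact e (vact (mkvelt (emono (ebar e) h)) (eact (ebar e) x)) =
  vact (mkvelt (emono e h)) x.
Proof.
have ff p (a : velt GG) : follow e p ->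
    eact e (p, a) = (one1 e :: p, a).
  by case: p => //= l p [[_ _ /eqP ne] _]; rewrite /eact /= (negbTE ne).
have E p a : eact e (vact (mkvelt (emono (ebar e) h)) (one1 (ebar e) :: p, a)) =
    vact (mkvelt (emono e h)) (p, a).
  rewrite /one1 vact_cons mulg1; have [-> ->] := @coset_rep_emono (ebar e) h.
  rewrite /eact /= eqxx; case: e h {ff} => c [] h /=;
    by case: vact.
case: x => -[|l p] a; first by move=> _; rewrite [eact (ebar e) _]/=; exact: E.
case/valid_cons => rl tl fp vp; rewrite [eact (ebar e) _]/eact /= ebarK.
case: eqP => [el|nl]; last exact: E.
subst l; rewrite /one1 vact_cons mulg1; have [-> ->] := coset_rep_emono h.
rewrite [vact _ _]surjective_pairing ff //; exact: vact_follow.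
Qed.

End Words.

(** * The action of the path group on normal words *)

Section NormalForm.
Variable GG : graph_of_groups.
Implicit Types (e f : edge GG) (l : letter GG) (p q : seq (letter GG)).
Implicit Types (x y z : word GG).

Definition top x : vert GG := if x.1 is l :: _ then rng (tag l) else tag x.2.

Lemma valid_top u x : valid u x -> top x = u.
Proof. by case: x => -[|l p] a [] //= []. Qed.

(* The path group has to act on all normal words at once, so e also maps words
   of range r(e) back to words of range s(e) when these vertices differ, and it
   fixes the other words. *)
Definition edge_act e x : word GG :=
  if top x == src e then eact e x
  else if top x == rng e then eact (ebar e) x else x.

Definition gact (s : path_gen GG * bool) x : word GG :=
  match s.1 with
  | inl e => edge_act (if s.2 then e else ebar e) x
  | inr g =>
    if top x == tag g
    then vact (mkvelt (if s.2 then tagged g else (tagged g)^-1)) x else x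
  end.

Definition ract (w : fword (path_gen GG)) x : word GG := foldr gact x w.

Definition validw x := valid (top x) x.

Lemma valid_validw u x : valid u x -> validw x.
Proof. by move=> vx; rewrite /validw (valid_top vx). Qed.

Lemma edge_act_valid e x : validw x -> validw (edge_act e x).
Proof.
move=> vx; rewrite /edge_act; case: eqP => [ts|_].
  by apply: (@valid_validw (rng e)); apply: eact_valid; rewrite -ts.
case: eqP => // tr; apply: (@valid_validw (src e)).
by apply: (@eact_valid _ (ebar e)); rewrite src_ebar -tr.
Qed.

Lemma gact_valid s x : validw x -> validw (gact s x).
Proof.
case: s => -[e|[w g]] b vx; rewrite /gact /=; first exact: edge_act_valid.
case: eqP => // tw; apply: (@valid_validw w); apply: vact_valid.
by rewrite -tw.
Qed.

Lemma ract_valid w x : validw x -> validw (ract w x).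
Proof. by elim: w => //= s w IH /IH; exact: gact_valid. Qed.

Lemma ract_cat w1 w2 x : ract (w1 ++ w2) x = ract w1 (ract w2 x).
Proof. exact: foldr_cat. Qed.

Lemma edge_actK e x : validw x -> edge_act (ebar e) (edge_act e x) = x.
Proof.
move=> vx; rewrite {2}/edge_act; case: eqP => [ts|nts].
  have vx' : valid (src e) x by rewrite -ts.
  have ty := valid_top (eact_valid vx').
  by rewrite /edge_act ty src_ebar eqxx eactK.
case: eqP => [tr|ntr]; last first.
  rewrite /edge_act src_ebar -/(src e); case: eqP => // _.
  by case: eqP.
have vx' : valid (src (ebar e)) x by rewrite src_ebar -tr.
have ty := valid_top (eact_valid vx').
rewrite /edge_act ty src_ebar -/(src e).
case: eqP => [er|_]; first by case: nts; rewrite tr er.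
by rewrite eqxx eactK.
Qed.

Lemma gactK s b x : validw x -> gact (s, b) (gact (s, ~~ b) x) = x.
Proof.
case: s => [e|[w g]] vx; rewrite /gact /=.
  case: b => /=; last exact: edge_actK.
  by have := edge_actK (ebar e) vx; rewrite ebarK.
have [tw|ntw] := eqVneq (top x) w; last by rewrite (negbTE ntw).
have vx' : valid w x by rewrite -tw.
rewrite (valid_top (vact_valid _ vx')) eqxx vactM //.
by case: b; rewrite /= ?mulgV ?mulVg vact1.
Qed.

Lemma ract_rel w1 w2 x : path_rel w1 w2 -> validw x -> ract w1 x = ract w2 x.
Proof.
move=> r vx; case: r => [w g h|e|e g] /=.
- rewrite /gact /=; have [tw|ntw] := eqVneq (top x) w; last first.
    by rewrite (negbTE ntw).
  have vx' : valid w x by rewrite -tw.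
  by rewrite (valid_top (vact_valid _ vx')) eqxx vactM.
- exact: edge_actK.
rewrite /gact /=; set y := edge_act (ebar e) x.
have [tr|ntr] := eqVneq (top x) (rng e).
  have vx' : valid (src (ebar e)) x by rewrite src_ebar -tr.
  have yE : y = eact (ebar e) x by rewrite /y /edge_act src_ebar tr eqxx.
  have vy : valid (src e) y by rewrite yE; exact: (eact_valid vx').
  have vz := vact_valid (emono (ebar e) g) vy; have tz := valid_top vz.
  rewrite (valid_top vy) eqxx /edge_act tz eqxx yE.
  by rewrite eact_rel // -tr.
have [ts|nts] := eqVneq (top x) (src e).
  have vx' : valid (src e) x by rewrite -ts.
  have vz := eact_valid vx'; have tz := valid_top vz.
  have nrs : (rng e == src e) = false.
    by apply/negbTE; rewrite -ts eq_sym.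
  have yE : y = eact e x.
    by rewrite /y /edge_act src_ebar (negbTE ntr) ts eqxx ebarK.
  by rewrite yE tz -/(src e) nrs /edge_act tz nrs eqxx eactK.
have yE : y = x.
  by rewrite /y /edge_act src_ebar (negbTE ntr) (negbTE nts).
by rewrite yE -/(src e) (negbTE nts) /edge_act (negbTE nts) (negbTE ntr).
Qed.

Lemma ract_eq w1 w2 : pres_eq (@path_rel GG) w1 w2 ->
  forall x, validw x -> ract w1 x = ract w2 x.
Proof.
elim=> {w1 w2} [w|w1 w2 _ IH|w1 w2 w3 _ IH1 _ IH2|w1 w2 w1' w2' _ IH1 _ IH2
    |s b|w1 w2 r] x vx //.
- by rewrite IH.
- by rewrite IH1 // IH2.
- rewrite !ract_cat IH2 // IH1 //; exact: ract_valid.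
- exact: gactK.
- exact: ract_rel.
Qed.

Definition pact (g : path_group GG) x : word GG := ract (repr g) x.

Lemma pact_class w x :
  validw x -> pact (pres_class (@path_rel GG) w) x = ract w x.
Proof. by move=> vx; apply: ract_eq => //; exact: pres_repr. Qed.

Lemma pactM (g h : path_group GG) x :
  validw x -> pact (g * h) x = pact g (pact h x).
Proof.
move=> vx; rewrite -[g]pres_classK -[h]pres_classK.
rewrite (pres_mulE _ _ _ : _ * _ = _) !pact_class // ?ract_cat //.
exact: ract_valid.
Qed.

Lemma pact_valid (g : path_group GG) x : validw x -> validw (pact g x).
Proof. exact: ract_valid. Qed.
Hint Resolve pact_valid valid_validw : core.

Lemma pact1 x : validw x -> pact 1 x = x.
Proof. by move=> vx; rewrite (pact_class [::]). Qed.

Lemma pact_vert w (g : vgrp w) x :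
  valid w x -> pact (pg_vert (mkvelt g)) x = vact (mkvelt g) x.
Proof.
move=> vx; rewrite pact_class; last exact: valid_validw vx.
by rewrite /= /gact /= (valid_top vx) eqxx.
Qed.

Lemma pact_edge e x : valid (src e) x -> pact (pg_edge e) x = eact e x.
Proof.
move=> vx; rewrite pact_class; last exact: valid_validw vx.
by rewrite /= /gact /= /edge_act (valid_top vx) eqxx.
Qed.

Definition img x : path_group GG := path_image x.1 * pg_vert x.2.

Lemma pg_edge_vert e (h : egrp e.1) :
  pg_edge e * pg_vert (mkvelt (emono (ebar e) h)) =
  pg_vert (mkvelt (emono e h)) * pg_edge e.
Proof.
apply: (mulIg (pg_edge (ebar e))).
rewrite -[in RHS]mulgA [in RHS]pg_edgeV mulgV mulg1 -mulgA.
rewrite /pg_edge /pg_vert /=.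
rewrite (pres_mulE _ _ _ : _ * pres_class _ (pge _) = _).
rewrite (pres_mulE _ _ _ : _ * _ = _).
exact/pres_classP/pres_rel/PathEdge.
Qed.

Lemma img_cons e (g : vgrp (rng e)) p a : img (mkletter g :: p, a) =
  pg_vert (mkvelt g) * pg_edge e * img (p, a).
Proof. by rewrite /img /= !mulgA. Qed.

Lemma img_vact w (g : vgrp w) x :
  valid w x -> img (vact (mkvelt g) x) = pg_vert (mkvelt g) * img x.
Proof.
case: x => p a; elim: p w g => [|l p IH] w g.
  move/valid_nil=> ea; case: (velt_mk a) ea => u [b ->] /= ea; subst u.
  by rewrite vact_nil /img /= !mul1g pg_vertM.
move/valid_cons; case: (letter_mk l) => e [s ->] /= [ew ts fp vp]; subst w.
rewrite vact_cons img_cons -surjective_pairing (IH (src e)) // img_cons.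
rewrite !mulgA -[_ * pg_edge e * pg_vert _]mulgA pg_edge_vert !mulgA.
by rewrite -!pg_vertM -coset_rep_rem.
Qed.

Lemma img_eact e x : img (eact e x) = pg_edge e * img x.
Proof.
case: x => -[|l p] a; first by rewrite /eact /= img_cons pg_vert1 mul1g.
rewrite /eact /=; case: eqP => [->|_]; last by rewrite img_cons pg_vert1 mul1g.
by rewrite img_cons pg_vert1 mul1g pg_edgeV mulVKg.
Qed.

(** On words of matching range the total action is genuine left multiplication, so [pact] computes
    normal forms of products. *)
Lemma pact_word_images u w (g : path_group GG) x :
  word_images u w g -> valid w x -> valid u (pact g x) /\ img (pact g x) = g * img x.
Proof.
case=> -[p a] [/= pw aw] <- vx; have vvx := valid_validw vx.
rewrite /word_image /=.
set c := (if a is Some _ then _ else _).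
have [vc ic] : valid w (pact c x) /\ img (pact c x) = c * img x.
  rewrite /c; case: a aw {c} => [[w' b]|] /=; last by rewrite pact1 // mul1g.
  move=> ew; subst w'; rewrite (pact_vert b) //; split; first exact: vact_valid.
  exact: img_vact.
rewrite pactM // -mulgA -ic; move: (pact c x) vc => {a c aw x vx vvx ic} x vx.
elim: p u pw => [|l p IH] u /=.
  by move=> ->; rewrite pact1 ?mul1g //; exact: valid_validw vx.
case: (letter_mk l) => e [b ->] /= [ru pw]; subst u.
have [vp ip] := IH _ pw; have vvx := valid_validw vx.
have vep := eact_valid vp; have vvp := valid_validw vp.
rewrite !pactM; try by repeat apply: pact_valid.
rewrite (pact_edge vp) (pact_vert b vep) img_vact // img_eact ip !mulgA.
by split=> //; exact: vact_valid.
Qed.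

Definition eps w : word GG := ([::], mkvelt (1 : vgrp w)).

Lemma eps_valid w : valid w (eps w). Proof. by []. Qed.
Hint Resolve eps_valid : core.

Lemma img_eps w : img (eps w) = 1.
Proof. by rewrite /img /= mul1g pg_vert1. Qed.

Lemma valid_walk u x : valid u x -> edge_walk (@rng GG) u (wedges x.1) (tag x.2).
Proof.
case: x => p a; elim: p u => [|l p IH] u; first by move/valid_nil => /= ->.
by case/valid_cons=> <- tl fp vp /=; split=> //; exact: IH.
Qed.

Lemma img_word_images u x : valid u x -> word_images u (tag x.2) (img x).
Proof.
move=> vx; exists (x.1, Some x.2); last by rewrite /word_image /img.
by split=> //=; exact: valid_walk.
Qed.

Lemma follow_eact e p (a : velt GG) : follow e p ->
  eact e (p, a) = (one1 e :: p, a).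
Proof.
by case: p => //= l p [[_ _ /eqP ne] _]; rewrite /eact /= (negbTE ne).
Qed.

Lemma pact_path u p y : startok u p -> valid (pend u p) y ->
    startok u (p ++ y.1) ->
  pact (path_image p) y = (p ++ y.1, y.2) /\ valid u (p ++ y.1, y.2).
Proof.
case: y => q a; elim: p u => [|l p IH] u /= sp vy sq.
  by rewrite pact1; [split | exact: valid_validw vy].
case: (letter_mk l) sp vy sq => e [b ->] /= [ru tb fp] vy [_ _ fq].
have [IH1 IH2] := IH _ (follow_start fp) vy (follow_start fq).
have vvy := valid_validw vy; subst u.
have vp : valid (rng e) (eact e (p ++ q, a)) by exact: eact_valid.
rewrite !pactM; try by repeat apply: pact_valid.
rewrite IH1 pact_edge // pact_vert // follow_eact // /one1 vact_cons mulg1.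
have [-> ->] := coset_rep_transv tb; rewrite emono1 (vact1 IH2) /=; split=> //.
exact/valid_cons.
Qed.

(** No letter of a normal word cancels when the word is applied to the empty word, so the word is
    rebuilt from its image. This is what makes normal forms unique. *)
Lemma pact_img u x : valid u x -> pact (img x) (eps (tag x.2)) = x.
Proof.
case: x => p a vx; rewrite pactM //.
case: (velt_mk a) vx => w [b ->] /= [/= sp aw].
rewrite pact_vert // /eps vact_nil mulg1.
have [] := @pact_path u p ([::], mkvelt b) => //=.
  by rewrite cats0.
by rewrite cats0.
Qed.

Lemma img_inj u u' x y : valid u x -> valid u' y -> tag x.2 = tag y.2 ->
  img x = img y -> x = y.
Proof. by move=> vx vy e i; rewrite -(pact_img vx) -(pact_img vy) e i. Qed.

Lemma pact_tag u w (g : path_group GG) x :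
  word_images u w g -> valid w x -> tag (pact g x).2 = tag x.2.
Proof.
have vt w' (h : vgrp w') y : tag (vact (mkvelt h) y).2 = tag y.2 by exact: vact_tag.
have et e y : tag (eact e y).2 = tag y.2.
  by rewrite /eact; case: y.1 => //= l p; case: eqP.
have gt s y : tag (gact s y).2 = tag y.2.
  rewrite /gact /edge_act; case: s.1 => [e|[w' h]] /=; last by case: eqP.
  by case: eqP => _; [|case: eqP].
by move=> _ _; rewrite /pact; elim: (repr g) => //= s r IH; rewrite gt.
Qed.

End NormalForm.
#[export] Hint Resolve eps_valid : core.

(** * Operators on l^2(G) and Powers' averaging *)

Section SquareNorm.
Variable R : realType.
Local Open Scope ring_scope.

Definition nc2 (z : R[i]) : R := Normc.normc z ^+ 2.

Lemma normc_ge0 (z : R[i]) : 0 <= Normc.normc z.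
Proof. by case: z => u v; apply: sqrtr_ge0. Qed.

Lemma nc2_ge0 z : 0 <= nc2 z. Proof. exact: sqr_ge0. Qed.

Lemma nc2M z1 z2 : nc2 (z1 * z2) = nc2 z1 * nc2 z2.
Proof. by rewrite /nc2 Normc.normcM exprMn. Qed.

Lemma nc2_0 : nc2 0 = 0. Proof. by rewrite /nc2 Normc.normc0 expr0n. Qed.
Lemma nc2_1 : nc2 1 = 1. Proof. by rewrite /nc2 Normc.normc1 expr1n. Qed.

Lemma normc_sum (I : Type) (r : seq I) (a : I -> R[i]) :
  Normc.normc (\sum_(i <- r) a i) <= \sum_(i <- r) Normc.normc (a i).
Proof.
elim: r => [|i r IH]; first by rewrite !big_nil Normc.normc0.
rewrite !big_cons; apply: le_trans (le_normcD _ _) _.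
by rewrite lerD2l.
Qed.

Lemma sqr_sum_le (I : Type) (r : seq I) (a : I -> R) :
  (\sum_(i <- r) a i) ^+ 2 <= (size r)%:R * \sum_(i <- r) a i ^+ 2.
Proof.
elim: r => [|i r IH]; first by rewrite !big_nil expr0n mulr0.
rewrite !big_cons /=.
have H : 2 * a i * \sum_(j <- r) a j <=
    \sum_(j <- r) a j ^+ 2 + (size r)%:R * a i ^+ 2.
  have -> : (size r)%:R * a i ^+ 2 = \sum_(j <- r) a i ^+ 2.
    by rewrite big_const_seq count_predT iter_addr_0 mulr_natl.
  rewrite -big_split mulr_sumr /=; apply: ler_sum => j _.
  by have := sqr_ge0 (a j - a i); nra.
rewrite -natr1; move: H IH; nra.
Qed.

Lemma nc2_sum (I : Type) (r : seq I) (a : I -> R[i]) :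
  nc2 (\sum_(i <- r) a i) <= (size r)%:R * \sum_(i <- r) nc2 (a i).
Proof.
apply: le_trans (sqr_sum_le r (fun i => Normc.normc (a i))).
apply: lerXn2r; rewrite ?nnegrE ?normc_ge0 ?sumr_ge0 //.
  by move=> i _; exact: normc_ge0.
exact: normc_sum.
Qed.

Variable G : groupType.
Implicit Types f h : l2 R G.

Definition nsq f : R := fine (l2_normsq f).

Lemma nsqE f : l2_normsq f = (nsq f)%:E.
Proof.
have /asboolP lt := valP f; rewrite /nsq fineK // ge0_fin_numE //.
by apply: esum_ge0 => x _; rewrite lee_fin sqr_ge0.
Qed.

Lemma nsq_ge0 f : 0 <= nsq f.
Proof.
by rewrite -lee_fin -nsqE; apply: esum_ge0 => x _; rewrite lee_fin sqr_ge0.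
Qed.

Lemma sum_nsq f (s : seq G) : uniq s -> \sum_(x <- s) nc2 (f x) <= nsq f.
Proof.
move=> us; rewrite -lee_fin -nsqE; apply: esum_ge.
exists [set` s]; first by split=> //; exact: finite_seq.
by rewrite -fsbig_seq // sumEFin.
Qed.

Lemma normsq_le (u : G -> R[i]^o) (c : R) :
  (forall s, uniq s -> \sum_(x <- s) nc2 (u x) <= c) ->
  (l2_normsq u <= c%:E)%E.
Proof.
move=> H; apply: ge_ereal_sup => _ [X [finX _] <-].
by rewrite fsbig_finite //= sumEFin lee_fin; apply: H; exact: fset_uniq.
Qed.

Lemma nsq_le f (c : R) :
  (forall s, uniq s -> \sum_(x <- s) nc2 (f x) <= c) -> nsq f <= c.
Proof. by move=> H; rewrite -lee_fin -nsqE; exact: normsq_le. Qed.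

Lemma normsq_lty (u : G -> R[i]^o) (c : R) :
  (forall s, uniq s -> \sum_(x <- s) nc2 (u x) <= c) -> u \in @l2_pred R G.
Proof.
move=> H; apply/asboolP; apply: le_lt_trans (ltry c); exact: normsq_le.
Qed.

Lemma nc2_nsq f x : nc2 (f x) <= nsq f.
Proof. by have := @sum_nsq f [:: x] isT; rewrite big_seq1. Qed.

Lemma nsq_dom (I : Type) (r : seq I) (F : I -> l2 R G) (w : I -> R) h :
  (forall i, 0 <= w i) ->
  (forall x, nc2 (h x) <= \sum_(i <- r) w i * nc2 (F i x)) ->
  nsq h <= \sum_(i <- r) w i * nsq (F i).
Proof.
move=> w0 H; apply: nsq_le => s us.
apply: le_trans (ler_sum _ (fun x _ => H x)) _.
rewrite exchange_big /=; apply: ler_sum => i _.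
by rewrite -mulr_sumr; apply: ler_wpM2l => //; exact: sum_nsq.
Qed.

(** All terms are nonnegative, so the finite sum may be moved inside the l^2 sum. It serves for
    restrictions of one function to disjoint sets. *)
Lemma sum_nsq_dom (I : choiceType) (r : seq I) (F : I -> l2 R G) h :
  (forall x, \sum_(i <- r) nc2 (F i x) <= nc2 (h x)) ->
  \sum_(i <- r) nsq (F i) <= nsq h.
Proof.
move=> H; rewrite -lee_fin -sumEFin -nsqE.
under eq_bigr do rewrite -nsqE.
have -> : (\sum_(i <- r) l2_normsq (F i) =
    \esum_(x in [set: G]) \sum_(i <- r) (nc2 (F i x))%:E)%E.
  by rewrite esum_sum // => *; rewrite lee_fin nc2_ge0.
by apply: le_esum => x _; rewrite sumEFin lee_fin; exact: H.
Qed.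

Lemma l2_sumE (I : Type) (r : seq I) (F : I -> l2 R G) x :
  (\sum_(i <- r) F i) x = \sum_(i <- r) F i x.
Proof.
elim: r => [|i r IH]; first by rewrite !big_nil.
by rewrite !big_cons -IH.
Qed.

Lemma l2_eq f h : (forall x, f x = h x) -> f = h.
Proof. by move=> H; apply: val_inj; apply: funext. Qed.

Lemma nsq_sum (I : Type) (r : seq I) (F : I -> l2 R G) :
  nsq (\sum_(i <- r) F i) <= (size r)%:R * \sum_(i <- r) nsq (F i).
Proof.
rewrite mulr_sumr; apply: nsq_dom => [_|x]; first exact: ler0n.
by rewrite l2_sumE -mulr_sumr; exact: nc2_sum.
Qed.

Lemma nsqZ (a : R[i]) f : nsq (a *: f) <= nc2 a * nsq f.
Proof.
have := @nsq_dom _ [:: tt] (fun=> f) (fun=> nc2 a) (a *: f).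
rewrite !big_seq1; apply=> [_|x]; first exact: nc2_ge0.
by rewrite big_seq1 -nc2M.
Qed.

Lemma nsq0 : nsq 0 = 0.
Proof.
apply/eqP; rewrite eq_le nsq_ge0 andbT; apply: nsq_le => s _.
by rewrite big1 // => x _; exact: nc2_0.
Qed.

Lemma nsqD3 f1 f2 f3 : nsq (f1 + f2 + f3) <= 3 * (nsq f1 + nsq f2 + nsq f3).
Proof.
have := nsq_sum [:: f1; f2; f3] id.
by rewrite !big_cons !big_nil !addr0 !addrA.
Qed.

Lemma nsqD f1 f2 : nsq (f1 + f2) <= 2 * (nsq f1 + nsq f2).
Proof.
by have := nsq_sum [:: f1; f2] id; rewrite !big_cons !big_nil !addr0.
Qed.

Lemma nsq_regular g f : nsq (regular_op g f) = nsq f.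
Proof.
congr fine; rewrite /l2_normsq /=.
rewrite [RHS](@reindex_esum _ _ _ [set: G] [set: G] (fun x => (g^-1 * x)%g)) //.
split=> //; first by move=> x y _ _; apply: mulgI.
by move=> y _; exists (g * y)%g => //; rewrite mulKg.
Qed.

Lemma l2_norm_le f h (M : R) : 0 <= M ->
  nsq f <= M ^+ 2 * nsq h -> l2_norm f <= M * l2_norm h.
Proof.
move=> M0 H; rewrite /l2_norm -/(nsq f) -/(nsq h).
rewrite -[M]ger0_norm // -sqrtr_sqr -sqrtrM ?sqr_ge0 //.
by rewrite ler_wsqrtr.
Qed.

Lemma l2_norm_sqr f : l2_norm f ^+ 2 = nsq f.
Proof. by rewrite /l2_norm sqr_sqrtr // -/(nsq f) nsq_ge0. Qed.

Lemma nsq_le_norm f h (M : R) :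
  l2_norm f <= M * l2_norm h -> nsq f <= M ^+ 2 * nsq h.
Proof.
have n0 (k : l2 R G) : 0 <= l2_norm k by exact: sqrtr_ge0.
move=> H; rewrite -!l2_norm_sqr -exprMn; apply: lerXn2r; rewrite ?nnegrE //.
exact: le_trans (n0 f) H.
Qed.

Lemma restrict_subproof (A : set G) f :
  (fun x => if `[< A x >] then f x else 0) \in @l2_pred R G.
Proof.
apply: (@normsq_lty _ (nsq f)) => s us.
apply: le_trans (sum_nsq f us); apply: ler_sum => x _.
by case: asboolP => _ //; rewrite nc2_0 nc2_ge0.
Qed.

Definition restrict (A : set G) f : l2 R G := L2 (restrict_subproof A f).

Lemma delta_subproof :
  (fun x : G => if x == 1%g then 1 else 0 : R[i]^o) \in @l2_pred R G.
Proof.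
apply: (@normsq_lty _ 1) => s us.
have -> : \sum_(x <- s) nc2 (if x == 1%g then 1 else 0) =
    \sum_(x <- s | x == 1%g) 1 :> R.
  rewrite [RHS]big_mkcond /=; apply: eq_bigr => x _.
  by case: ifP => _; rewrite ?nc2_1 ?nc2_0.
have [s1|ns1] := boolP (1%g \in s).
  by rewrite -big_filter filter_pred1_uniq // big_seq1.
rewrite big_seq_cond big1 // => x /andP[xs /eqP x1].
by rewrite x1 (negbTE ns1) in xs.
Qed.

Definition delta1 : l2 R G := L2 delta_subproof.

End SquareNorm.

(** * Powers' averaging estimate *)

Section PowersAveraging.
Variables (R : realType) (G : groupType).
Local Open Scope ring_scope.
Implicit Types (f h : l2 R G) (T U : l2_op R G) (s : seq (R[i] * G)).

Definition comb s : l2_op R G := fun f => \sum_(p <- s) p.1 *: regular_op p.2 f.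

Lemma combE s f x : comb s f x = \sum_(p <- s) p.1 * f (p.2^-1 * x)%g.
Proof. by rewrite /comb l2_sumE. Qed.

(** A crude bound for the squared operator norm, from Cauchy-Schwarz over the terms. Its size is
    irrelevant; what counts is that it also bounds every conjugate. *)
Definition comb_bound s : R := (size s)%:R * \sum_(p <- s) nc2 p.1.

Lemma comb_bound_ge0 s : 0 <= comb_bound s.
Proof. by rewrite mulr_ge0 ?ler0n // sumr_ge0 // => p _; exact: nc2_ge0. Qed.

Lemma nsq_comb s f : nsq (comb s f) <= comb_bound s * nsq f.
Proof.
apply: le_trans (nsq_sum _ _) _; rewrite /comb_bound -mulrA.
rewrite ler_wpM2l ?ler0n // mulr_suml; apply: ler_sum => p _.
by apply: le_trans (nsqZ _ _) _; rewrite nsq_regular.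
Qed.

Definition conjop (g : G) T : l2_op R G :=
  fun f => regular_op g (T (regular_op g^-1%g f)).

Lemma nsq_conjop g T (K : R) : (forall f, nsq (T f) <= K * nsq f) ->
  forall f, nsq (conjop g T f) <= K * nsq f.
Proof.
move=> H f; rewrite /conjop nsq_regular; apply: le_trans (H _) _.
by rewrite nsq_regular.
Qed.

Lemma conjop_combE g s f x :
  conjop g (comb s) f x = \sum_(p <- s) p.1 * f (g * (p.2^-1 * (g^-1 * x)))%g.
Proof.
rewrite [LHS]combE; apply: eq_bigr => p _; congr (_ * _).
by rewrite /= invgK.
Qed.

Lemma sum_disjoint (r : seq nat) (A : nat -> Prop) (c : R) : 0 <= c -> uniq r ->
  {in r &, forall i j, A i -> A j -> i = j} ->
  \sum_(i <- r) (if `[< A i >] then c else 0) <= c.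
Proof.
move=> c0; elim: r => [|i r IH]; first by rewrite big_nil.
move=> /= /andP[ir ur] inj; rewrite big_cons; case: asboolP => Ai; last first.
  by rewrite add0r; apply: IH => // j k jr kr; apply: inj; rewrite inE ?jr ?kr orbT.
rewrite big_seq big1 ?addr0 // => j jr; case: asboolP => // Aj.
by rewrite (inj i j) ?inE ?eqxx ?jr ?orbT // jr in ir.
Qed.

Lemma nc2_sum_disjoint (r : seq nat) (A : nat -> Prop) (a : nat -> R[i]) :
  uniq r -> {in r &, forall i j, A i -> A j -> i = j} ->
  (forall i, ~ A i -> a i = 0) ->
  nc2 (\sum_(i <- r) a i) <= \sum_(i <- r) nc2 (a i).
Proof.
move=> ur inj a0; elim: r ur inj => [|i r IH]; first by rewrite !big_nil nc2_0.
move=> /= /andP[ir ur] inj; rewrite !big_cons.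
have [Ai|/a0 ->] := pselect (A i); last first.
  rewrite nc2_0 !add0r; apply: IH => // j k jr kr.
  by apply: inj; rewrite inE ?jr ?kr orbT.
rewrite (_ : \sum_(j <- r) a j = 0).
  by rewrite addr0 lerDl sumr_ge0 // => j _; exact: nc2_ge0.
rewrite big_seq big1 // => j jr; apply: a0 => Aj.
by rewrite (inj i j) ?inE ?eqxx ?jr ?orbT // jr in ir.
Qed.

(** The partition in the definition of a Powers group: elements of F move C off itself, and N
    translates of the complement of C are pairwise disjoint. *)
Definition averaging_set (F : seq G) (N : nat) (C : set G) (g : nat -> G) :=
  (forall a x, a \in F -> C x -> ~ C (a * x)%g) /\
  (forall i j x y, (i < N)%N -> (j < N)%N -> i <> j ->
     ~ C x -> ~ C y -> (g i * x)%g <> (g j * y)%g).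

(* Powers' argument: split f along g_j(G \ C).  The sets g_j(G \ C) are disjoint,
   and the conjugate of [comb s] by g_j maps functions supported off
   g_j(G \ C) to functions supported on it. *)
Lemma powers_bound s N C g f :
  averaging_set [seq p.2 | p <- s] N C g ->
  nsq (\sum_(j <- iota 0 N) conjop (g j) (comb s) f) <=
  4 * N%:R * comb_bound s * nsq f.
Proof.
move=> [CF gD]; set K := comb_bound s; have K0 := comb_bound_ge0 s.
pose D j : set G := [set y | ~ C ((g j)^-1 * y)%g].
pose X j := conjop (g j) (comb s).
have XB j u : nsq (X j u) <= K * nsq u by apply: nsq_conjop => ?; exact: nsq_comb.
have Ddis y : {in iota 0 N &, forall i j, D i y -> D j y -> i = j}.
  move=> i j; rewrite !mem_iota !add0n /= => iN jN Di Dj.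
  apply: contrapT => nij; have := gD _ _ _ _ iN jN nij Di Dj.
  by rewrite !mulVKg.
have XD j u : X j u = X j (restrict (D j) u) + X j (restrict (~` D j) u).
  apply: l2_eq => x; rewrite /X.
  transitivity (conjop (g j) (comb s) (restrict (D j) u) x
    + conjop (g j) (comb s) (restrict (~` D j) u) x); last by [].
  rewrite !conjop_combE -big_split /=.
  apply: eq_bigr => p _; rewrite -mulrDr; congr (_ * _).
  case: asboolP => d; case: asboolP => nd; rewrite ?addr0 ?add0r //.
(* Off D_j the point g_j^-1 y lies in C. A term surviving the restriction would also have a^-1
   g_j^-1 y in C for some a among the group elements of [s], but a moves C off itself. *)
have XS j u y : ~ D j y -> X j (restrict (~` D j) u) y = 0.
  move=> /contrapT Cy; rewrite /X conjop_combE big_seq big1 // => p ps /=.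
  case: asboolP => [nd|]; last by rewrite mulr0.
  move: nd; rewrite /D /= => /contrapT; rewrite mulKg => Cx.
  have /CF := Cx; move=> /(_ p.2); rewrite mulVKg => /(_ _)/(_ Cy) [].
  exact: map_f.
under eq_bigr do rewrite -/(X _) XD; rewrite big_split /=.
(* Here the inputs have disjoint supports: Cauchy-Schwarz over the N terms costs a factor N, while
   the squared norms of the inputs add up to at most that of f. *)
have B1 : nsq (\sum_(j <- iota 0 N) X j (restrict (D j) f)) <=
    N%:R * K * nsq f.
  apply: le_trans (nsq_sum _ _) _; rewrite size_iota -mulrA.
  rewrite ler_wpM2l ?ler0n //.
  apply: le_trans (ler_sum _ (fun j _ => XB j _)) _.
  rewrite -mulr_sumr ler_wpM2l //; apply: sum_nsq_dom => x.
  rewrite (eq_bigr (fun j => if `[< D j x >] then nc2 (f x) else 0)).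
    by apply: sum_disjoint; rewrite ?nc2_ge0 ?iota_uniq.
  by move=> j _ /=; case: asboolP => //; rewrite nc2_0.
(* Here the outputs have disjoint supports, so their squared norms add without loss and N terms give
   a factor N. Both halves thus grow like N and not N^2, which is the gain over the trivial
   bound. *)
have B2 : nsq (\sum_(j <- iota 0 N) X j (restrict (~` D j) f)) <=
    N%:R * K * nsq f.
  apply: (@le_trans _ _ (\sum_(j <- iota 0 N)
      1 * nsq (X j (restrict (~` D j) f)))).
    apply: nsq_dom => // x; rewrite l2_sumE.
    under [leRHS]eq_bigr do rewrite mul1r.
    by apply: (@nc2_sum_disjoint _ (fun j => D j x)); rewrite ?iota_uniq // => i /XS.
  have -> : N%:R * K * nsq f = \sum_(j <- iota 0 N) K * nsq f.
    by rewrite big_const_seq count_predT size_iota iter_addr_0 -mulrA mulr_natl.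
  apply: ler_sum => j _; rewrite mul1r; apply: le_trans (XB _ _) _.
  rewrite ler_wpM2l //; have := @nsq_dom _ _ _ [:: tt] (fun=> f) (fun=> 1)
    (restrict (~` D j) f).
  rewrite !big_seq1 mul1r; apply => // x; rewrite big_seq1 mul1r /=.
  by case: asboolP => // _; rewrite nc2_0 nc2_ge0.
apply: le_trans (nsqD _ _) _; move: B1 B2; nra.
Qed.

End PowersAveraging.

(** * From the averaging estimate to simplicity *)

Section PowersSimple.
Variables (R : realType) (G : groupType).
Local Open Scope ring_scope.
Implicit Types (f h : l2 R G) (T U : l2_op R G) (s : seq (R[i] * G)).

Lemma l2_subE f h x : (f - h) x = f x - h x.
Proof. by []. Qed.

Definition coef s (g : G) : R[i] := \sum_(p <- s | p.2 == g) p.1.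

Lemma comb_delta1 s g : comb s (delta1 R G) g = coef s g.
Proof.
rewrite combE /coef [RHS]big_mkcond /=; apply: eq_bigr => p _.
rewrite -(inj_eq (mulgI p.2)) mulg1 mulVKg eq_sym.
by case: ifP; rewrite ?mulr1 ?mulr0.
Qed.

Lemma comb_coefE s f x :
  comb s f x = \sum_(g <- undup [seq p.2 | p <- s]) coef s g * f (g^-1 * x)%g.
Proof.
rewrite combE; under [RHS]eq_bigr do rewrite mulr_suml big_mkcond /=.
rewrite exchange_big /= !big_seq; apply: eq_bigr => p ps.
rewrite -big_mkcond /= (eq_bigl (pred1 p.2)); last by move=> g; rewrite /= eq_sym.
rewrite -big_filter filter_pred1_uniq ?undup_uniq ?mem_undup ?map_f //.
by rewrite big_seq1.
Qed.

Lemma comb_split s f :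
  comb s f = coef s 1%g *: f + comb [seq p <- s | p.2 != 1%g] f.
Proof.
apply: l2_eq => x.
transitivity (coef s 1%g * f x + comb [seq p <- s | p.2 != 1%g] f x); last by [].
rewrite !combE (bigID (fun p => p.2 == 1%g)) /= big_filter; congr (_ + _).
by rewrite mulr_suml; apply: eq_bigr => p /eqP ->; rewrite invg1 mul1g.
Qed.

Lemma nsq_delta1 : nsq (delta1 R G) <= 1.
Proof.
apply: nsq_le => s us.
rewrite (eq_bigr (fun x => if `[< x = 1%g >] then 1 else 0)); last first.
  move=> x _ /=; case: asboolP => [->|/eqP/negbTE ->]; first by rewrite eqxx nc2_1.
  exact: nc2_0.
elim: s us => [|x s IH /= /andP[xs us]]; first by rewrite big_nil.
rewrite big_cons; case: asboolP => [x1|_]; last by rewrite add0r IH.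
rewrite big_seq big1 ?addr0 // => y ys; case: asboolP => // y1.
by rewrite x1 -y1 ys in xs.
Qed.

(** The coefficients of [s] are the values of [comb s] at [delta1]. As T kills [delta1], their
    squares add up to at most eps^2, so [comb s f] is uniformly small, and T f is close to it. *)
Lemma comb_eval T s f x (eps : R) : 0 < eps ->
  (forall g, T (delta1 R G) g = 0) ->
  (forall h, nsq (T h - comb s h) <= eps ^+ 2 * nsq h) ->
  Normc.normc (T f x) <= 2 * eps * (1 + nsq f).
Proof.
move=> e0 T0 H; set t := undup [seq p.2 | p <- s].
have nf := nsq_ge0 f.
have coef_small : \sum_(g <- t) nc2 (coef s g) <= eps ^+ 2.
  have := H (delta1 R G); move: nsq_delta1 => d1 Hd.
  apply: (@le_trans _ _ (nsq (T (delta1 R G) - comb s (delta1 R G)))); last first.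
    by apply: le_trans Hd _; have := sqr_ge0 eps; nra.
  apply: le_trans (sum_nsq _ (undup_uniq [seq p.2 | p <- s])).
  apply: ler_sum => g _.
  by rewrite l2_subE T0 add0r comb_delta1 /nc2 normcN.
have combs : Normc.normc (comb s f x) <= eps * (1 + nsq f).
  rewrite comb_coefE; apply: le_trans (normc_sum _ _) _.
  have fx : \sum_(g <- t) nc2 (f (g^-1 * x)%g) <= nsq f.
    rewrite -(big_map (fun g => (g^-1 * x)%g) xpredT (fun y => nc2 (f y))).
    apply: sum_nsq; rewrite map_inj_uniq ?undup_uniq // => g1 g2.
    by move/mulIg/invg_inj.
  (* The weights of this arithmetic-geometric inequality balance the two sums: eps^-1 times eps^2
     for the coefficients and eps times [nsq f] for the values of f. *)
  apply: (@le_trans _ _ (\sum_(g <- t)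
      (eps^-1 * nc2 (coef s g) + eps * nc2 (f (g^-1 * x)%g)))).
    apply: ler_sum => g _; rewrite Normc.normcM /nc2.
    set a := Normc.normc _; set b := Normc.normc _.
    have a0 : 0 <= a by exact: normc_ge0.
    have b0 : 0 <= b by exact: normc_ge0.
    have -> : eps^-1 * a ^+ 2 + eps * b ^+ 2 =
        eps^-1 * (a ^+ 2 + (eps * b) ^+ 2) by field; apply: lt0r_neq0.
    have -> : a * b = eps^-1 * (a * (eps * b)) by field; apply: lt0r_neq0.
    rewrite ler_pM2l ?invr_gt0 //; have := sqr_ge0 (a - eps * b).
    have : 0 <= a * (eps * b) by rewrite !mulr_ge0 // ltW.
    nra.
  rewrite big_split -!mulr_sumr /=.
  have : eps^-1 * (\sum_(g <- t) nc2 (coef s g)) <= eps.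
    by rewrite mulrC ler_pdivrMr // -expr2.
  move: fx; nra.
have diff : Normc.normc (T f x - comb s f x) <= eps * (1 + nsq f).
  apply: le_trans (_ : Num.sqrt (eps ^+ 2 * nsq f) <= _).
    rewrite -[leLHS]ger0_norm ?normc_ge0 // -sqrtr_sqr ler_wsqrtr //.
    exact: le_trans (nc2_nsq _ _) (H f).
  rewrite sqrtrM ?sqr_ge0 // sqrtr_sqr gtr0_norm // ler_pM2l //.
  rewrite -{2}(sqr_sqrtr nf); have := sqr_ge0 (Num.sqrt (nsq f) - 1); nra.
rewrite -[T f x](subrK (comb s f x)).
apply: le_trans (le_normcD _ _) _; nra.
Qed.

(** This says that [delta1] is a separating vector of the reduced C*-algebra. *)
Lemma op_nonzero T : reduced_Cstar T -> T <> (fun=> 0) ->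
  exists g, T (delta1 R G) g <> 0.
Proof.
move=> [bT aT] nT; apply: contrapT => nex; apply: nT.
have T0 g : T (delta1 R G) g = 0.
  by apply: contrapT => n; apply: nex; exists g.
apply: funext => f; apply: l2_eq => x; apply: Normc.eq0_normc.
apply/eqP; rewrite eq_le normc_ge0 andbT; apply/ler_addgt0Pl => d d0.
rewrite addr0; have nf := nsq_ge0 f.
pose eps := d / (2 * (1 + nsq f)).
have e0 : 0 < eps by rewrite divr_gt0 // mulr_gt0 //; lra.
have [_ [s ->] Hs] := aT _ e0.
have := @comb_eval T s f x eps e0 T0; rewrite /eps.
have -> : 2 * (d / (2 * (1 + nsq f))) * (1 + nsq f) = d.
  by field; apply: lt0r_neq0; lra.
apply; move=> h; apply: nsq_le_norm; exact: Hs.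
Qed.

Lemma regular_linear (g : G) : linear (@regular_op R G g).
Proof. by move=> a f h; apply: l2_eq. Qed.

Lemma regular_reduced (g : G) : reduced_Cstar (@regular_op R G g).
Proof.
split.
  split; first exact: regular_linear.
  by exists 1 => f; apply: l2_norm_le => //; rewrite nsq_regular expr1n mul1r.
move=> eps e0; exists (regular_op g).
  exists [:: (1, g)]; apply: funext => f; by rewrite big_seq1 scale1r.
move=> f; rewrite subrr; apply: l2_norm_le; first exact: ltW.
by rewrite nsq0 mulr_ge0 ?sqr_ge0 ?nsq_ge0.
Qed.

Section Ideal.
Variable I : set (l2_op R G).
Hypothesis idI : closed_ideal I.

Lemma ideal_conj g T : I T -> I (conjop g T).
Proof.
case: idI => _ _ _ mulI _ IT.
have [_ I1] := mulI _ _ (regular_reduced g^-1%g) IT.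
by have [] := mulI _ _ (regular_reduced g) I1.
Qed.

Lemma ideal_sum (r : seq nat) (F : nat -> l2_op R G) :
  (forall i, I (F i)) -> I (fun f => \sum_(i <- r) F i f).
Proof.
case: idI => _ I0 lin _ _ IF; elim: r => [|i r IH].
  by rewrite (_ : (fun f => _) = fun=> 0) //; apply: funext => f; rewrite big_nil.
have := lin 1 _ _ (IF i) IH; congr (I _); apply: funext => f.
by rewrite big_cons scale1r.
Qed.

(* The Neumann series: y in I and ||1 - y|| < 1 give 1 - (1 - y)^n in I. *)
Lemma ideal_id y : I y -> (forall f, nsq (f - y f) <= 2^-1 * nsq f) -> I id.
Proof.
case: idI => redI I0 lin mulI clI Iy Hy.
have linI T : I T -> linear T by case/redI => -[].
have UnI n : exists2 U, I U & forall f, nsq (f - U f) <= 2^-1 ^+ n * nsq f.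
  elim: n => [|n IHn].
    by exists (fun=> 0) => // f; rewrite subr0 expr0 mul1r.
  (* Chosen so that 1 - U' = (1 - U)(1 - y). *)
  have [U IU HU] := IHn; exists (fun f => (U f + y f) - U (y f)).
    have I1 := lin 1 _ _ IU Iy; have [I2 _] := mulI _ _ (redI _ IU) Iy.
    have := lin (-1) _ _ I2 I1; congr (I _); apply: funext => f.
    by rewrite scaleN1r scale1r addrC.
  move=> f; have -> : f - (U f + y f - U (y f)) = (f - y f) - U (f - y f).
    have := linI _ IU (-1) (y f) f; rewrite !scaleN1r => E.
    rewrite [in U (f - _)]addrC E !opprD !opprK !addrA.
    by rewrite [RHS]addrAC; congr (_ + _); rewrite addrAC.
  apply: le_trans (HU _) _; rewrite exprSr -mulrA; apply: ler_wpM2l (Hy f).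
  by rewrite exprn_ge0 ?invr_ge0.
apply: clI; split.
  split; first by move=> a f h.
  by exists 1 => f; rewrite mul1r.
move=> eps e0.
have [n Hn] : exists n, 2^-1 ^+ n <= eps ^+ 2.
  have e20 : 0 < eps ^+ 2 by rewrite exprn_gt0.
  pose n := Num.Def.archi_bound (eps ^+ 2)^-1; exists n.
  have ub : (eps ^+ 2)^-1 < n%:R.
    by apply: archi_boundP; rewrite invr_ge0 ltW.
  rewrite exprVn -[leRHS]invrK lef_pV2 ?posrE ?invr_gt0 ?exprn_gt0 //.
  apply: ltW (lt_trans ub _); rewrite -natrX ltr_nat; exact: ltn_expl.
have [U IU HU] := UnI n; exists U => // f; apply: l2_norm_le; first exact: ltW.
apply: le_trans (HU f) _; rewrite ler_wpM2r ?nsq_ge0 //.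
Qed.

End Ideal.

(** A nonzero T in the ideal has a nonzero coefficient at some g; left translation by g^-1 and
    scaling give [T1] with coefficient 1 at the identity. Averaging conjugates keeps that
    coefficient and makes the remaining ones negligible in norm. *)
Theorem powers_Cstar_simple :
  (forall (F : seq G) N, 1%g \notin F -> exists C g, averaging_set F N C g) ->
  Cstar_simple R G.
Proof.
move=> powers I idI; have [redI I0 lin mulI clI] := idI.
have [I0'|nI] := pselect (I = [set fun=> 0]); first by left.
right.
have [T IT nT] : exists2 T, I T & T <> (fun=> 0).
  apply: contrapT => nex; apply: nI; apply/seteqP; split=> T; last by move=> ->.
  by move=> IT; apply: contrapT => n; apply: nex; exists T.
suff Iid : I id.
  apply/seteqP; split=> // S rS.
  by have [] := mulI _ _ rS Iid.
have [g Tg] := op_nonzero (redI _ IT) nT.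
pose c := T (delta1 R G) g.
pose T1 : l2_op R G := fun f => c^-1 *: regular_op g^-1%g (T f) + 0.
have IT1 : I T1.
  apply: (lin c^-1 _ _ _ I0).
  by have [] := mulI _ _ (regular_reduced g^-1%g) IT.
have T11 : T1 (delta1 R G) 1%g = 1.
  rewrite /T1 addr0.
  transitivity (c^-1 * T (delta1 R G) ((g^-1)^-1 * 1)%g); first by [].
  by rewrite invgK mulg1 mulVf //; apply/eqP.
clearbody T1.
have [_ apT1] := redI _ IT1.
(* Error budget for squared norms: the approximation error 1/4 gives 1/16 for the averaged error and
   1/16 for the coefficient at 1, and the averaged remainder gives 1/24. The three-term inequality
   then yields 3 (1/16 + 1/16 + 1/24) = 1/2, as [ideal_id] requires. *)
have e0 : 0 < (4 : R)^-1 by rewrite invr_gt0.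
have [_ [s ->] Hs0] := apT1 _ e0.
have Hs f : nsq (T1 f - comb s f) <= 16^-1 * nsq f.
  apply: le_trans (nsq_le_norm (Hs0 f)) _.
  by rewrite (_ : 4^-1 ^+ 2 = 16^-1 :> R) //; field.
set s1 := [seq p <- s | p.2 != 1%g].
have c1 : nc2 (1 - coef s 1%g) <= 16^-1.
  have -> : 1 - coef s 1%g = (T1 (delta1 R G) - comb s (delta1 R G)) 1%g.
    by rewrite l2_subE T11 comb_delta1.
  apply: le_trans (nc2_nsq _ 1%g) _.
  apply: le_trans (Hs _) _; have := nsq_delta1; lra.
(* Dividing the averaged sum by N turns the bound 4 N K of [powers_bound] into 4 K / N, which is at
   most 1/24 once N is at least 96 K. *)
have [N [N0 HN]] : exists N : nat, (0 < N)%N /\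
    96 * comb_bound s1 <= N%:R :> R.
  have K0 := comb_bound_ge0 s1.
  have K1 : 0 <= 96 * comb_bound s1 by rewrite mulr_ge0.
  exists (Num.Def.archi_bound (96 * comb_bound s1)).+1; split=> //.
  apply: ltW (lt_le_trans (archi_boundP K1) _).
  by rewrite ler_nat.
have [|C [gs Cgs]] := powers [seq p.2 | p <- s1] N.
  by apply/negP => /mapP[p]; rewrite mem_filter => /andP[/eqP n _] /esym.
have N0' : 0 < N%:R :> R by rewrite ltr0n.
have K0 := comb_bound_ge0 s1.
pose y : l2_op R G := fun f =>
  N%:R^-1 *: (\sum_(j <- iota 0 N) conjop (gs j) T1 f) + 0.
apply: (@ideal_id I idI y).
  by apply: (lin N%:R^-1 _ _ _ I0); apply: (ideal_sum idI) => j; exact: (ideal_conj idI).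
move=> f.
pose A := \sum_(j <- iota 0 N) conjop (gs j) (fun f => T1 f - comb s f) f.
pose B := \sum_(j <- iota 0 N) conjop (gs j) (comb s1) f.
have yE : f - y f = - (N%:R^-1 *: A) + (1 - coef s 1%g) *: f + - (N%:R^-1 *: B).
  have nN0 : N%:R != 0 :> R[i] by rewrite pnatr_eq0 -lt0n.
  rewrite /y addr0.
  have -> : \sum_(j <- iota 0 N) conjop (gs j) T1 f = A + N%:R *: (coef s 1%g *: f) + B.
    have -> : N%:R *: (coef s 1%g *: f) = \sum_(j <- iota 0 N) coef s 1%g *: f.
      by rewrite big_const_seq count_predT size_iota iter_addr_0 scaler_nat.
    rewrite /A /B -!big_split /=; apply: eq_bigr => j _.
    have linr := @regular_linear (gs j).
    have rD u v : regular_op (gs j) (u + v) = regular_op (gs j) u + regular_op (gs j) v :> l2 R G.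
      by have := linr 1 u v; rewrite !scale1r.
    have rZ a u : regular_op (gs j) (a *: u) = a *: regular_op (gs j) u :> l2 R G.
      by apply: l2_eq.
    rewrite /conjop; set u := regular_op _ f.
    have rK : regular_op (gs j) u = f by apply: l2_eq => x /=; rewrite invgK mulVKg.
    have E : T1 u = (T1 u - comb s u) + coef s 1%g *: u + comb s1 u.
      by rewrite -addrA -comb_split subrK.
    by rewrite [in LHS]E !rD rZ rK.
  rewrite !scalerDr !scalerA mulKf // scalerBl scale1r.
  by rewrite !opprD !addrA [f - _]addrC.
have nV : nc2 (N%:R^-1 : R[i]) = (N%:R ^+ 2)^-1.
  rewrite /nc2 Normc.normcV exprVn; congr (_ ^+ 2)^-1.
  have := @normcMn R 1 N; rewrite Normc.normc1 => ->.
  by [].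
have nN (u : l2 R G) : nsq (- u) <= nsq u.
  have := nsqZ (-1) u; rewrite scaleN1r.
  by rewrite (_ : nc2 (-1) = 1) ?mul1r // /nc2 normcN Normc.normc1 expr1n.
have nA : nsq (- (N%:R^-1 *: A)) <= 16^-1 * nsq f.
  apply: le_trans (nN _) _; apply: le_trans (nsqZ _ _) _; rewrite nV.
  rewrite mulrC ler_pdivrMr ?exprn_gt0 //.
  apply: le_trans (nsq_sum _ _) _; rewrite size_iota.
  apply: (@le_trans _ _ (N%:R * \sum_(j <- iota 0 N) 16^-1 * nsq f)).
    by rewrite ler_wpM2l ?ler0n //; apply: ler_sum => j _; exact: nsq_conjop.
  rewrite big_const_seq count_predT size_iota iter_addr_0 -mulr_natl.
  by rewrite le_eqVlt; apply/orP; left; apply/eqP; ring.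
have nB : nsq (- (N%:R^-1 *: B)) <= 24^-1 * nsq f.
  apply: le_trans (nN _) _; apply: le_trans (nsqZ _ _) _; rewrite nV.
  rewrite mulrC ler_pdivrMr ?exprn_gt0 //.
  apply: le_trans (powers_bound f Cgs) _.
  have := nsq_ge0 f; set n := nsq f => n0.
  have -> : 24^-1 * n * N%:R ^+ 2 = (24^-1 * N%:R) * N%:R * n by ring.
  rewrite ler_wpM2r //.
  have -> : 4 * N%:R * comb_bound s1 = (4 * comb_bound s1) * N%:R by ring.
  rewrite ler_pM2r //; lra.
have nC : nsq ((1 - coef s 1%g) *: f) <= 16^-1 * nsq f.
  by apply: le_trans (nsqZ _ _) _; rewrite ler_wpM2r ?nsq_ge0.
rewrite yE; apply: le_trans (nsqD3 _ _ _) _.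
have := nsq_ge0 f; lra.
Qed.

End PowersSimple.

(** * Cylinders and the Powers property of pi_1 *)

Section Cylinders.
Variable GG : graph_of_groups.
Implicit Types (e f : edge GG) (l : letter GG) (p q : seq (letter GG)).
Implicit Types (x y z : word GG) (g a : velt GG).

(* The vertex element of the word is irrelevant here: g is a dummy. *)
Definition pvact g q : seq (letter GG) := (vact g (q, g)).1.

Lemma vact_fst g q a : (vact g (q, a)).1 = pvact g q.
Proof.
rewrite /pvact /vact -!lock /=; move: {3}g => b.
by elim: q g => //= l q IH g; rewrite IH.
Qed.

Fixpoint carry g q : velt GG :=
  if q is l :: q' then
    carry (mkvelt (emono (ebar (tag l)) (coset_rem (vat (rng (tag l)) g * tagged l)))) q'
  else g.

Lemma vact_cat g p q a : vact g (p ++ q, a) =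
  (pvact g p ++ (vact (carry g p) (q, a)).1, (vact (carry g p) (q, a)).2).
Proof.
rewrite /pvact /vact -!lock /=; move: {3}g => c.
elim: p g => [|l p IH] g /=; first by rewrite -surjective_pairing.
by rewrite IH.
Qed.

Lemma size_pvact g q : size (pvact g q) = size q.
Proof.
have := congr1 size (vact_wedges g (q, g)); rewrite /wedges !size_map. by [].
Qed.

Lemma pvact_cat g p q : pvact g (p ++ q) = pvact g p ++ pvact (carry g p) q.
Proof. by rewrite -(vact_fst _ _ g) vact_cat /= vact_fst. Qed.

(** An element that has crossed an edge lies in the image of the group of that edge. *)
Lemma carry_rcons g p l :
  exists h, carry g (rcons p l) = mkvelt (emono (ebar (tag l)) h).
Proof.
elim: p g => [|l' p IH] g /=; last exact: IH.
by exists (coset_rem (vat (rng (tag l)) g * tagged l)).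
Qed.

Lemma last_wedges e p l : last e (wedges (rcons p l)) = tag l.
Proof. by rewrite /wedges map_rcons last_rcons. Qed.

Lemma pend_rcons u p l : pend u (rcons p l) = src (tag l).
Proof. by rewrite /pend map_rcons last_rcons. Qed.

Lemma startok_rcons_cat u p l q : startok u (rcons p l ++ q) <->
  startok u (rcons p l) /\ follow (tag l) q.
Proof.
case: p => [|l' p]; first exact: (@startok_cat _ u l [::] q).
by rewrite rcons_cons cat_cons startok_cat last_wedges.
Qed.

Lemma follow_valid e q a : follow e q -> tag a = pend (src e) q ->
  valid (src e) (q, a).
Proof. by move=> fq ea; split=> //; exact: follow_start. Qed.

(* Left multiplication by a fixed element acts on long paths by changing an
   initial part only; the last edge survives and what follows it is acted on
   by an element of the edge group. *)
Definition stable u' u (c : path_group GG) : Prop :=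
  exists n, forall p l, startok u (rcons p l) -> (n < size (rcons p l))%N ->
  exists p1 l1 (h : egrp (tag l1).1),
  [/\ tag l1 = tag l, startok u' (rcons p1 l1),
      (size (rcons p l) <= size (rcons p1 l1) + n)%N
    & forall q a, follow (tag l1) q -> tag a = pend (src (tag l1)) q ->
      pact c (rcons p l ++ q, a) =
      (rcons p1 l1 ++ pvact (mkvelt (emono (ebar (tag l1)) h)) q,
       (vact (mkvelt (emono (ebar (tag l1)) h)) (q, a)).2)].

Lemma stable_vert w (g : vgrp w) : stable w w (pg_vert (mkvelt g)).
Proof.
exists 0%N => p l sp _.
have [h hE] := carry_rcons (mkvelt g) p l.
have W : wedges (pvact (mkvelt g) (rcons p l)) = rcons (wedges p) (tag l).
  by rewrite vact_wedges /wedges map_rcons.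
have S := size_pvact (mkvelt g) (rcons p l).
case/lastP E : (pvact (mkvelt g) (rcons p l)) W S => [|p1 l1] W S.
  by move: S; rewrite size_rcons.
have el : tag l1 = tag l.
  by move: W; rewrite /wedges map_rcons => /rcons_inj[].
exists p1, l1; rewrite el; exists h; split=> //.
- rewrite -E -(vact_fst _ _ (mkvelt (1 : vgrp (pend w (rcons p l))))).
  by case: (@vact_valid _ w g (rcons p l, mkvelt (1 : vgrp (pend w (rcons p l))))).
- by rewrite -S addn0.
move=> q a fq ea; rewrite pact_vert; last first.
  split; first by apply/startok_rcons_cat.
  by rewrite /= ea /pend map_cat last_cat map_rcons last_rcons.
by rewrite vact_cat E hE vact_fst.
Qed.

Lemma stable_edge e : stable (rng e) (src e) (pg_edge e).
Proof.
(* With at least two letters present, the last one survives even if e cancels the first. *)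
exists 1%N => p l sp; rewrite size_rcons; case: p sp => //= l0 p sp _.
have vq q a : follow (tag l) q -> tag a = pend (src (tag l)) q ->
    valid (src e) (l0 :: rcons p l ++ q, a).
  move=> fq ea; split.
    by have := @startok_rcons_cat (src e) (l0 :: p) l q; rewrite /= => ->.
  by rewrite /= ea /pend /= map_cat last_cat map_rcons last_rcons.
have vact1' q a : follow (tag l) q -> tag a = pend (src (tag l)) q ->
    (pvact (mkvelt (emono (ebar (tag l)) 1)) q = q) *
    ((vact (mkvelt (emono (ebar (tag l)) 1)) (q, a)).2 = a).
  move=> fq ea; rewrite -(vact_fst _ _ a) emono1.
  have v := follow_valid fq ea.
  by rewrite (@vact1 _ (src (tag l))).
have [el|nl] := eqVneq l0 (one1 (ebar e)).
  exists p, l, 1; split=> //.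
  - case: (sp) => /= r0 t0 fp; have := follow_start fp.
    by rewrite el /= src_ebar.
  - by rewrite !size_rcons addn1.
  move=> q a fq ea; rewrite pact_edge; last exact: vq.
  by rewrite /eact /= el eqxx !(vact1' q a fq ea).
exists [:: one1 e, l0 & p], l, 1; split=> //=.
- split=> //; first exact: transv1.
  by case: (sp) => r0 t0 fp; split=> //; split=> //; exact/eqP.
- by rewrite !size_rcons; lia.
move=> q a fq ea; rewrite pact_edge; last exact: vq.
by rewrite /eact /= (negbTE nl) !(vact1' q a fq ea).
Qed.

(** The lost lengths add up. Since both factors preserve the last edge, their edge group elements
    live in the same group and multiply. *)
Lemma stableM (u w z : vert GG) (c d : path_group GG) : word_images u w c -> word_images w z d ->
  stable u w c -> stable w z d -> stable u z (c * d).
Proof.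
move=> wc wd [n1 H1] [n2 H2]; exists (n1 + n2)%N => p l sp szp.
have [|p1 [l1 [h1 [e1 s1 sz1 A1]]]] := H2 p l sp; first by lia.
have [|p2 [l2 [h2 [e2 s2 sz2 A2]]]] := H1 p1 l1 s1; first by lia.
have e21 : tag l2 = tag l1 by [].
exists p2, l2.
move: h1 A1; rewrite -e2 => h1 A1.
exists (h2 * h1); split=> //; first by rewrite e2.
  by lia.
move=> q a fq ea; have v := follow_valid fq ea.
have vp : valid z (rcons p l ++ q, a).
  split; first by apply/startok_rcons_cat; rewrite -e1 -e2.
  by rewrite /= ea /pend map_cat last_cat map_rcons last_rcons -e1 -e2.
rewrite pactM; last exact: valid_validw vp.
rewrite A1 // A2.
- set x1 := vact (mkvelt (emono (ebar (tag l2)) h1)) (q, a).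
  rewrite -(vact_fst _ q a) -/x1 -(vact_fst _ x1.1 x1.2) -surjective_pairing.
  by rewrite (@vactM _ (src (tag l2))) // -emonoM vact_fst.
- by rewrite -(vact_fst _ _ a); exact: vact_follow.
by rewrite vact_tag ea !pend_wedges vact_wedges.
Qed.

Lemma stable1 u : stable u u 1.
Proof. by have := stable_vert (1 : vgrp u); rewrite pg_vert1. Qed.

Lemma path_word_images (u w : vert GG) p (c : path_group GG) :
  edge_walk (@rng GG) u (wedges p) w -> word_images w w c ->
  word_images u w (path_image p * c).
Proof.
move=> pw wc; elim: p u pw => [|l p IH] u /=; first by move=> ->; rewrite mul1g.
case=> <- /IH; rewrite -!mulgA mulgA; exact: word_images_cons.
Qed.

Lemma word_images_stable u w c : word_images u w c -> stable u w c.
Proof.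
case=> -[p b] [/= pw bw] <-; rewrite /word_image /=.
have [wb sb] : word_images (tag (odflt (mkvelt (1 : vgrp w)) b)) w
      (if b is Some g then pg_vert g else 1) /\
    stable w w (if b is Some g then pg_vert g else 1).
  case: b bw => [[w' g]|] /= bw; last by split; [exact: word_images1 | exact: stable1].
  by subst w'; split; [exact: word_images_vert | exact: stable_vert].
have {}wb : word_images w w (if b is Some g then pg_vert g else 1).
  by case: b bw wb {sb} => [[w' g]|] //= <-.
elim: p u pw {bw} => [|l p IH] u /=.
  by move=> ->; rewrite mul1g.
case: (letter_mk l) => e [g ->] /= [eu pw]; subst u.
have wp : word_images (src e) w (path_image p * (if b is Some g then pg_vert g else 1)).
  exact: path_word_images.
rewrite -!mulgA; apply: stableM (stable_vert g) _.
- exact: word_images_vert.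
- exact: word_images_mul (word_images_edge e) wp.
apply: stableM (stable_edge e) (IH _ pw) => //; exact: word_images_edge.
Qed.

End Cylinders.

(** * The Powers property from reachability, branching and faithfulness *)

Section PowersProperty.
Variable GG : graph_of_groups.
Implicit Types (e f : edge GG) (l : letter GG) (p q : seq (letter GG)).
Implicit Types (x y z : word GG).

Definition reach e f :=
  exists q l, follow e (rcons q l) /\ tag l = f.

Definition branching := forall e, exists q l1 l2,
  [/\ follow e (rcons q l1), follow e (rcons q l2) & l1 <> l2].

(** Faithfulness of the edge group on the finite words that may follow the edge. *)
Definition edge_free := forall e (h : egrp e.1), h <> 1 ->
  exists2 q, follow e q & pvact (mkvelt (emono (ebar e) h)) q <> q.

Lemma prefix_size_eq p q s t : size p = size q -> p ++ s = q ++ t -> p = q.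
Proof. by move=> sz /eqP; rewrite eqseq_cat // => /andP[/eqP]. Qed.

Section Incomparable.
Hypothesis Br : branching.
Variables (u : vert GG) (l0 : letter GG).
Hypothesis sl0 : startok u [:: l0].

(** A comb: the words [M j] form an increasing chain that always takes the first branch, and
    [side j] leaves it at stage j along the second. Two side words disagree where the earlier one
    leaves. *)
Lemma incomparable_family : exists s : nat -> seq (letter GG),
  (forall j, exists p l, s j = rcons p l /\ startok u (s j)) /\
  forall i j (x : seq (letter GG)), prefix (s i) x -> prefix (s j) x -> i = j.
Proof.
have [b bP] : exists b : edge GG -> seq (letter GG) * (letter GG * letter GG),
    forall e, [/\ follow e (rcons (b e).1 (b e).2.1),
      follow e (rcons (b e).1 (b e).2.2) & (b e).2.1 <> (b e).2.2].
  have H e : exists c : seq (letter GG) * (letter GG * letter GG),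
    [/\ follow e (rcons c.1 c.2.1),
      follow e (rcons c.1 c.2.2) & c.2.1 <> c.2.2].
    by have [q [l1 [l2 ?]]] := Br e; exists (q, (l1, l2)).
  by exists (fun e => sval (cid (H e))) => e; case: cid.
pose nxt (c : seq (letter GG) * letter GG) :=
  (rcons c.1 c.2 ++ (b (tag c.2)).1, (b (tag c.2)).2.1).
pose m j := iter j nxt ([::], l0).
pose M j := rcons (m j).1 (m j).2.
have MS j : M j.+1 = M j ++ rcons (b (tag (m j).2)).1 (b (tag (m j).2)).2.1.
  by rewrite /M /m iterS -/(m j) /= rcons_cat.
pose side j := M j ++ rcons (b (tag (m j).2)).1 (b (tag (m j).2)).2.2.
have ms j : startok u (M j).
  elim: j => [|j IH]; first exact: sl0.
  rewrite MS; apply/startok_rcons_cat; split=> //.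
  by have [] := bP (tag (m j).2).
have ext i j : (i <= j)%N -> exists t, M j = M i ++ t.
  move=> /subnK <-; elim: (j - i)%N => [|k [t IH]]; first by exists [::]; rewrite cats0.
  by rewrite addSn MS IH -catA; eexists; reflexivity.
have lt_inc i j (x : seq (letter GG)) :
    (i < j)%N -> prefix (side i) x -> prefix (side j) x -> False.
  move=> ij /prefixP[t ->] /prefixP[t' E].
  have [t2 Et] := ext _ _ ij.
  move: E; rewrite /side Et MS -!catA => /eqP; rewrite eqseq_cat // eqxx /= => /eqP.
  move/prefix_size_eq; rewrite !size_rcons => /(_ erefl) /rcons_inj [E].
  by case: (bP (tag (m i).2)) => _ _; rewrite E.
exists side; split=> [j|i j x pi pj].
  exists (M j ++ (b (tag (m j).2)).1), (b (tag (m j).2)).2.2.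
  split; rewrite /side ?rcons_cat //; apply/startok_rcons_cat.
  by split; [exact: ms | have [] := bP (tag (m j).2)].
by case: (ltngtP i j) => // ij; [case: (lt_inc i j x)|case: (lt_inc j i x)].
Qed.

End Incomparable.

Lemma reach_extend e f : (forall e, reach e f) ->
  forall n, exists q l, [/\ follow e (rcons q l), tag l = f & (n < size (rcons q l))%N].
Proof.
move=> R; elim=> [|n [q [l [fq el sz]]]].
  by have [q [l [fq el]]] := R e; exists q, l; rewrite size_rcons.
have [q' [l' [fq' el']]] := R (tag l).
exists (rcons q l ++ q'), l'; rewrite rcons_cat; split=> //.
  by apply/follow_cat; rewrite last_wedges.
by rewrite size_cat !size_rcons in sz *; lia.
Qed.

Lemma prefix_cat2l r p q : prefix (r ++ p) (r ++ q) = prefix p q.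
Proof. by rewrite prefix_catr // eqxx. Qed.

Lemma prefix_comparable p q r : prefix p (q ++ r) -> prefix p q \/ prefix q p.
Proof.
move=> /prefixP[t E]; have [sz|/ltnW sz] := leqP (size p) (size q).
  left; apply/prefixP; exists (drop (size p) q).
  rewrite -{1}(cat_take_drop (size p) q); congr (_ ++ _).
  transitivity (take (size p) (q ++ r)); first by rewrite takel_cat.
  by rewrite E take_size_cat.
right; apply/prefixP; exists (drop (size q) p).
rewrite -{1}(cat_take_drop (size q) p); congr (_ ++ _).
transitivity (take (size q) (p ++ t)); first by rewrite takel_cat.
by rewrite -E take_size_cat.
Qed.

Lemma valid_cat_pend u p l q a :
  valid u (rcons p l ++ q, a) -> follow (tag l) q /\ tag a = pend (src (tag l)) q.
Proof.
case=> /= /startok_rcons_cat[_ fq] ->; split=> //.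
by rewrite /pend map_cat last_cat map_rcons last_rcons.
Qed.

Section Free.
Variable e0 : edge GG.
Hypotheses (R1 : forall e, reach e e0) (Br : branching) (EF : edge_free).
Variable v : vert GG.

(** First extend the path beyond the stability bound, so that c replaces the prefix by [rcons p1 l1]
    and acts on the tail by an edge group element h. Then compare the two prefixes. *)
Lemma cylinder_moved (c : path_group GG) p l : word_images v v c -> c <> 1 ->
  startok v (rcons p l) ->
  exists q, follow (tag l) q /\ forall x, valid v x ->
    prefix (rcons p l ++ q) x.1 -> ~ prefix (rcons p l ++ q) (pact c x).1.
Proof.
move=> wc c1 sp0.
have [n H] := word_images_stable wc.
have [q0 [l2 [fq0 _ szq]]] := reach_extend (tag l) R1 n.
set p2 := rcons p l ++ q0.
have sp2 : startok v (rcons p2 l2).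
  by rewrite /p2 rcons_cat; apply/startok_rcons_cat.
suff [q [fq Hq]] : exists q, follow (tag l2) q /\ forall x, valid v x ->
    prefix (rcons p2 l2 ++ q) x.1 -> ~ prefix (rcons p2 l2 ++ q) (pact c x).1.
  exists (rcons q0 l2 ++ q); split.
    by apply/follow_cat; rewrite last_wedges.
  by move=> x vx; rewrite !catA -!rcons_cat; exact: Hq.
have szp : (n < size (rcons p2 l2))%N.
  by rewrite /p2 rcons_cat size_cat; lia.
have [p1 [l1 [h [e1 s1 _ A0]]]] := H _ _ sp2 szp.
have A q a : valid v (rcons p2 l2 ++ q, a) ->
    (pact c (rcons p2 l2 ++ q, a)).1 =
    rcons p1 l1 ++ pvact (mkvelt (emono (ebar (tag l1)) h)) q /\ follow (tag l1) q.
  by move=> /valid_cat_pend; rewrite -e1 => -[fq ea]; rewrite A0.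
have [q [l3 [l4 [f3 f4 n34]]]] := Br (tag l1).
have pick t : exists l', [/\ follow (tag l1) (rcons q l') & t <> rcons q l'].
  have [E|] := pselect (t = rcons q l3); last by exists l3.
  by exists l4; split=> //; rewrite E => /rcons_inj[].
have [/prefixP[r E]|n1] := pselect (prefix (rcons p2 l2) (rcons p1 l1)).
  (* The new prefix is longer by r. The first [(size q).+1] letters after the old prefix are then
     determined by r and h q alone, so a last letter l' can be chosen to disagree with them. *)
  have [r0|rn0] := pselect (r = [::]); last first.
    have [l' [fl' nl']] := pick (take (size q).+1
      (r ++ pvact (mkvelt (emono (ebar (tag l1)) h)) q)).
    exists (rcons q l'); rewrite -e1; split=> // -[x1 a] vx /prefixP[t /= xE].
    subst x1; rewrite -!catA in vx *; have [-> _] := A _ _ vx.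
    rewrite E -!catA prefix_cat2l pvact_cat -cats1 pvact_cat -!catA catA.
    move/prefixP=> [t' Et]; apply: nl'.
    rewrite -cats1 -(@take_size_cat _ (size q).+1 (q ++ [:: l']) t').
      by rewrite -Et [RHS]takel_cat // size_cat size_pvact; case: (r) rn0 => //= *; lia.
    by rewrite size_cat addn1.
  (* Equal prefixes: if h = 1 then c fixes a normal word and is trivial; otherwise [edge_free]
     provides a tail that h changes. *)
  move: E; rewrite r0 cats0 => E.
  have [h1|nh1] := pselect (h = 1).
    exfalso; apply: c1; pose a : velt GG := mkvelt (1 : vgrp (src (tag l1))).
    have vx : valid v (rcons p2 l2, a) by split; rewrite // pend_rcons -e1.
    have [_ i2] := pact_word_images wc vx.
    have va : valid (src (tag l1)) ([::], a) by [].
    have := A0 [::] a I erefl; rewrite h1 emono1 -(vact_fst _ _ a) (vact1 va) cats0.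
    rewrite /= cats0 E => E2; move: i2; rewrite E2 => /esym.
    by rewrite -{2}[img _]mul1g => /mulIg.
  have [q' fq' nq'] := EF nh1.
  exists q'; rewrite -e1; split=> // -[x1 a] vx /prefixP[t /= xE].
  subst x1; rewrite -!catA in vx *; have [-> _] := A _ _ vx.
  rewrite -E prefix_cat2l pvact_cat => /prefixP[t']; move/prefix_size_eq.
  by rewrite size_pvact => /(_ erefl).
have [/prefixP[r E]|n2] := pselect (prefix (rcons p1 l1) (rcons p2 l2)).
  have rn0 : r <> [::].
    by move=> r0; apply: n1; rewrite E r0 cats0 prefix_refl.
  (* The old prefix is longer. This mirrors the earlier case with h^-1: the tail Q is the preimage
     of [rcons q l'] under h, and its part before the image of l' does not depend on l'. *)
  have [l' [fl' nl']] := pick (take (size q).+1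
    (r ++ pvact (mkvelt (emono (ebar (tag l1)) h^-1)) q)).
  set Q := pvact (mkvelt (emono (ebar (tag l1)) h^-1)) (rcons q l').
  have QK : pvact (mkvelt (emono (ebar (tag l1)) h)) Q = rcons q l'.
    pose a : velt GG := mkvelt (1 : vgrp (pend (src (tag l1)) (rcons q l'))).
    have va : valid (src (tag l1)) (rcons q l', a) by exact: follow_valid.
    rewrite /Q -(vact_fst _ (rcons q l') a).
    rewrite -(vact_fst _ _ (vact (mkvelt (emono (ebar (tag l1)) h^-1)) (rcons q l', a)).2).
    by rewrite -surjective_pairing (vactM _ _ va) -emonoM mulgV emono1 (vact1 va).
  exists Q; rewrite -e1; split.
    by rewrite /Q -(vact_fst _ _ (mkvelt (1 : vgrp v))); exact: vact_follow.
  move=> -[x1 a] vx /prefixP[t /= xE].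
  subst x1; rewrite -!catA in vx *; have [-> _] := A _ _ vx.
  rewrite E -!catA prefix_cat2l pvact_cat QK => /prefixP[t' Et]; apply: nl'.
  transitivity (take (size q).+1 ((r ++ Q) ++ t')); last first.
    by rewrite -Et take_size_cat // size_rcons.
  rewrite /Q -cats1 pvact_cat -!catA [r ++ pvact _ _ ++ _]catA [RHS]takel_cat //.
  by rewrite size_cat size_pvact; case: (r) rn0 => //= *; lia.
(* Incomparable prefixes already define disjoint cylinders. *)
exists [::]; split=> // -[x1 a] vx /prefixP[t /= xE].
subst x1; rewrite cats0 in vx *; have [-> _] := A _ _ vx.
by move/prefix_comparable=> [].
Qed.

(** C consists of the elements whose normal form starts with a path mu. This path is refined once
    for each element of F, and each time prolonged to end again in [e0]; refinement keeps earlier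
    elements moving the cylinder off itself. *)
Lemma powers_pi1 (l0 : letter GG) (F : seq (pi1 v)) (N : nat) :
  (forall e, reach e (ebar e0)) -> startok v [:: l0] ->
  1 \notin F -> exists C g, averaging_set F N C g.
Proof.
move=> R2 sl0 nF.
have [mu [l [sm el Hm]]] : exists p l, [/\ startok v (rcons p l), tag l = e0 &
    forall c, c \in F -> forall x, valid v x ->
    prefix (rcons p l) x.1 -> ~ prefix (rcons p l) (pact (pi1_val c) x).1].
  elim: F nF => [|c F IH].
    move=> _; have [q [l [fq el]]] := R1 (tag l0).
    exists (l0 :: q), l; split=> //.
    have := @startok_rcons_cat _ v [::] l0 (rcons q l).
    by rewrite rcons_cons /= => ->.
  rewrite inE negb_or eq_sym => /andP[c1 /IH[p [l [sp el Hp]]]].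
  have wc : word_images v v (pi1_val c) by case: (c) => ? /= /asboolP.
  have [q fq Hq] : exists2 q, follow (tag l) q & forall x, valid v x ->
    prefix (rcons p l ++ q) x.1 -> ~ prefix (rcons p l ++ q) (pact (pi1_val c) x).1.
    have [|q [fq Hq]] := cylinder_moved wc _ sp; last by exists q.
    by move=> E; case/eqP: c1; apply: val_inj.
  have [q1 [l1 [fq1 el1]]] := R1 (last (tag l) (wedges q)).
  exists (rcons p l ++ q ++ q1), l1; rewrite !rcons_cat; split=> //.
    apply/startok_rcons_cat; split=> //; exact/follow_cat.
  have pre r (x : seq (letter GG)) : prefix (r ++ rcons q1 l1) x -> prefix r x.
    by move=> /prefixP[t ->]; rewrite -catA prefix_prefix.
  move=> d; rewrite inE catA => /orP[/eqP -> | dF] x vx px py.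
    exact: Hq (pre _ _ px) (pre _ _ py).
  apply: (Hp d dF x vx).
    by move: (pre _ _ px) => /prefixP[t ->]; rewrite -catA prefix_prefix.
  by move: (pre _ _ py) => /prefixP[t ->]; rewrite -catA prefix_prefix.
have [s [sP sI]] := incomparable_family Br sl0.
have tP j : exists c : seq (letter GG) * letter GG,
    [/\ startok v (rcons c.1 c.2), tag c.2 = ebar e0 & prefix (s j) (rcons c.1 c.2)].
  have [p [l1 [sE ss]]] := sP j; have [q [l2 [fq el2]]] := R2 (tag l1).
  exists (rcons p l1 ++ q, l2) => /=; rewrite rcons_cat sE prefix_prefix.
  by split=> //; apply/startok_rcons_cat; rewrite -sE.
pose t j := sval (cid (tP j)).
have tQ j : [/\ startok v (rcons (t j).1 (t j).2), tag (t j).2 = ebar e0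
    & prefix (s j) (rcons (t j).1 (t j).2)] by rewrite /t; case: cid.
have pw u p : startok u p -> word_images u (pend u p) (path_image p).
  move=> sp; have := @img_word_images _ u (p, mkvelt (1 : vgrp (pend u p))).
  by rewrite /img /= pg_vert1 mulg1; apply.
(* The path t_j ends in the reversal of [e0], so the middle factor cancels its last edge: g_j undoes
   mu and then follows t_j without that edge. *)
pose g0 j := path_image (rcons (t j).1 (t j).2) * pg_edge e0 *
  (path_image (rcons mu l))^-1.
have mw := pw _ _ sm; rewrite pend_rcons el in mw.
have wg j : word_images v v (g0 j).
  have [st et _] := tQ j; have tw := pw _ _ st.
  rewrite pend_rcons et src_ebar in tw.
  apply: word_images_mul (word_images_inv mw).
  exact: word_images_mul tw (word_images_edge e0).
have gP j : g0 j \in @pi1_pred GG v by apply/asboolP.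
pose g j : pi1 v := Pi1 (gP j).
pose C : set (pi1 v) := [set c | prefix (rcons mu l) (pact (pi1_val c) (eps v)).1].
have wp (c : pi1 v) : word_images v v (pi1_val c) by case: (c) => ? /= /asboolP.
have gC j (c : pi1 v) : ~ C c ->
    prefix (rcons (t j).1 (t j).2) (pact (pi1_val (g j * c)) (eps v)).1.
  move=> nC; set x := pact (pi1_val c) (eps v).
  have vx : valid v x by case: (pact_word_images (wp c) (eps_valid v)).
  rewrite (_ : pi1_val (g j * c) = g0 j * pi1_val c) // pactM //.
  have vvx := valid_validw vx.
  rewrite -/x !pactM; try by repeat apply: pact_valid.
  set y := pact _^-1 x.
  have [vy _] := pact_word_images (word_images_inv mw) vx.
  rewrite -/y in vy.
  have [st et _] := tQ j.
  (* Otherwise y could be appended to mu without cancellation and x = mu y would lie in C. Hence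
     [e0] cancels against y, the rest may follow the last edge of t_j, and the complement of C is
     mapped into the cylinder of t_j. *)
  have hy : exists y' : seq (letter GG), y.1 = one1 (ebar e0) :: y'.
    apply: contrapT => ny; apply: nC; rewrite /C /= -/x.
    have fy : follow e0 y.1.
      apply: follow_startP; first by case: vy.
      by move=> l1 p' E El; apply: ny; exists p'; rewrite E El.
    have sy : startok v (rcons mu l ++ y.1).
      by apply/startok_rcons_cat; rewrite el.
    have vy' : valid (pend v (rcons mu l)) y by rewrite pend_rcons el.
    have [E _] := pact_path sm vy' sy.
    have : pact (path_image (rcons mu l)) y = x.
      by rewrite /y -pactM ?mulgV ?pact1 //; exact: valid_validw vx.
    by rewrite E => <- /=; rewrite prefix_prefix.
  have [y' yE] := hy.
  have fy : follow (ebar e0) y'.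
    by case: vy => + _; rewrite yE /= => -[].
  rewrite (pact_edge vy) /eact yE eqxx.
  have vy' : valid (rng e0) (y', y.2).
    by have := eact_valid vy; rewrite /eact yE eqxx.
  have sy : startok v (rcons (t j).1 (t j).2 ++ (y', y.2).1).
    by apply/startok_rcons_cat; rewrite et.
  have [|-> _] := pact_path st _ sy; first by rewrite pend_rcons et src_ebar.
  by rewrite prefix_prefix.
exists C, g; split.
  move=> c x cF Cx.
  suff: ~ prefix (rcons mu l) (pact (pi1_val (c * x)) (eps v)).1 by [].
   rewrite (_ : pi1_val (c * x) = pi1_val c * pi1_val x) // pactM //.
  apply: Hm => //; by case: (pact_word_images (wp x) (eps_valid v)).
move=> i j x y _ _ ij nx ny E; apply: ij.
have px := gC i _ nx; have py := gC j _ ny; rewrite E in px.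
have pt k (z : seq (letter GG)) : prefix (rcons (t k).1 (t k).2) z -> prefix (s k) z.
  by have [_ _ pk] := tQ k; apply: prefix_trans.
exact: sI (pt _ _ px) (pt _ _ py).
Qed.

End Free.

End PowersProperty.

(** * Generalized Baumslag-Solitar graphs *)

Section Flow.
Variable GG : graph_of_groups.
Implicit Types (e f : edge GG) (l : letter GG) (p q : seq (letter GG)).
Implicit Types (w s t : seq (edge GG)).

Definition okstep e f := (rng f == src e) && (f != ebar e).

Definition ones w : seq (letter GG) := [seq one1 e | e <- w].

Lemma wedges_ones w : wedges (ones w) = w.
Proof. by rewrite /wedges /ones -map_comp map_id. Qed.

Lemma okstep_okl e f (g : vgrp (rng f)) :
  okstep e f -> transv f g -> okl e (mkletter g).
Proof.
move=> /andP[/eqP r /eqP n] tg; split=> //.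
by move/(congr1 tag).
Qed.

Lemma ones_follow e w : path okstep e w -> follow e (ones w).
Proof.
elim: w e => //= f w IH e /andP[ef pw]; split; last exact: IH.
by apply: okstep_okl => //; exact: transv1.
Qed.

Lemma reduced_path_startok l p : reduced_path (l :: p) <-> startok (rng (tag l)) (l :: p).
Proof.
split=> [[_ [u [w ew]] tr nb]|[_ tl fp]].
  split=> //; first by apply: tr; rewrite mem_head.
  elim: p l u ew tr nb => //= l' p IH l u [ru ew] tr [nb1 nb]; split.
    case: (letter_mk l') nb1 ew tr => e [g ->] /= nb1 [re _] tr.
    split=> //; first by apply: (tr (mkletter g)); rewrite !inE eqxx orbT.
    move=> E; have ee : e = ebar (tag l) by move/(congr1 tag): E.
    subst e; move/mkletter_inj: E => E; apply: nb1 => //.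
    by rewrite ebarK.
  apply: (IH l' _ ew) => // l2 l2p; apply: tr; rewrite inE l2p orbT //.
split=> //.
- exists (rng (tag l)), (pend (rng (tag l)) (l :: p)).
  apply: (@valid_walk _ _ (l :: p, mkvelt (1 : vgrp (pend (rng (tag l)) (l :: p))))).
  by split.
- elim: p l tl fp => [|l' p IH] l tl fp l2; first by rewrite inE => /eqP ->.
  rewrite inE => /orP[/eqP -> //|].
  by case: fp => -[_ tl' _] fp; exact: IH.
elim: p l tl fp => //= l' p IH l tl [[rl tl' nl] fp]; split; last exact: IH.
case: (letter_mk l') nl => e [g ->] /= nl E g1; apply: nl.
by rewrite g1 E ebarK.
Qed.

Lemma map_iota1 (T : Type) (xi : nat -> T) n :
  [seq xi i | i <- iota 1 n] = mkseq (fun i => xi i.+1) n.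
Proof. by rewrite (iotaDl 1 0) -map_comp. Qed.

Lemma infinite_follow (xi : nat -> letter GG) n : infinite_reduced xi ->
  follow (tag (xi 0%N)) (mkseq (fun i => xi i.+1) n).
Proof.
move=> /(_ n); rewrite /mkseq /= => /reduced_path_startok[_ _].
by rewrite map_iota1.
Qed.

Lemma can_flow_reach f e : edge_can_flow f e -> reach e f.
Proof.
case=> xi [ir x0 [n xn]].
have := infinite_follow n.+1 ir; rewrite x0 mkseqS => fx.
by exists (mkseq (fun i => xi i.+1) n), (xi n.+1).
Qed.

Lemma reach_trans e f g : reach e f -> reach f g -> reach e g.
Proof.
move=> [q [l [fq el]]] [q' [l' [fq' el']]].
exists (rcons q l ++ q'), l'; split=> //; rewrite rcons_cat.
by apply/follow_cat; rewrite last_wedges el.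
Qed.

Lemma path_reach e w f : path okstep e (rcons w f) -> reach e f.
Proof.
move=> /ones_follow; rewrite /ones map_rcons => fw.
by exists (ones w), (one1 f).
Qed.

Lemma cycle_nth w f n : path.cycle okstep w -> (n < size w)%N ->
  okstep (nth f w n) (nth f w (n.+1 %% size w)).
Proof.
case: w => // e w /(pathP f); rewrite size_rcons => H nw.
have := H n nw; rewrite -rcons_cons !nth_rcons nw.
case: (ltngtP n (size w)) nw => /= [nw _|gt nw|-> _].
- by rewrite modn_small.
- by move: nw; rewrite ltnS leqNgt gt.
- by rewrite modnn.
Qed.

Lemma follow_infinite (xi : nat -> letter GG) :
  transv (tag (xi 0%N)) (tagged (xi 0%N)) ->
  (forall n, okl (tag (xi n)) (xi n.+1)) -> infinite_reduced xi.
Proof.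
move=> t0 H n; rewrite /mkseq /= map_iota1.
apply/reduced_path_startok; split=> //.
elim: n xi {t0} H => //= n IH xi H; rewrite /mkseq /=; split; first exact: H.
by rewrite map_iota1; apply: (IH (fun i => xi i.+1)) => i; exact: H.
Qed.

Lemma cycle_connect w f g : path.cycle okstep w -> f \in w -> g \in w -> reach g f.
Proof.
move=> cw fw gw; have [i t E] := rot_to gw.
move: fw; rewrite -(mem_rot i) E -mem_rcons.
move: cw; rewrite -(rot_cycle i) E /= => pt ft.
case/path.splitP: ft pt => p1 p2; rewrite cat_path => /andP[pt _].
exact: path_reach pt.
Qed.

(** The infinite repetition of the cycle is a boundary point. By the flow condition one of its edges
    is reached from e, and the cycle leads on to f. *)
Lemma cycle_reach w f : path.cycle okstep w -> f \in w ->
  (forall xi e, infinite_reduced xi -> can_flow xi e) -> forall e, reach e f.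
Proof.
move=> cw fw flow e.
have w0 : (0 < size w)%N by case: (w) fw.
pose xi n := one1 (nth f w (n %% size w)).
have xw n : (n %% size w < size w)%N by rewrite ltn_mod.
have [|n Hn] := flow xi e.
  apply: follow_infinite => [|n]; first exact: transv1.
  apply: okstep_okl; last exact: transv1.
  have := cycle_nth f cw (xw n).
  by rewrite -addn1 modnDml addn1.
apply: reach_trans (can_flow_reach Hn) _; apply: cycle_connect cw fw _.
exact: mem_nth.
Qed.

Lemma edge_walk_cat u s t z : edge_walk (@rng GG) u (s ++ t) z <->
  exists2 m, edge_walk (@rng GG) u s m & edge_walk (@rng GG) m t z.
Proof.
elim: s u => [|e s IH] u /=; first by split=> [|[m <-]] //; exists u.
split=> [[ru /IH[m ? ?]]|[m [ru ?] ?]]; first by exists m.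
by split=> //; apply/IH; exists m.
Qed.

Lemma backtrack_split e s : ~~ path (fun e f => f != ebar e) e s ->
  exists a g b, e :: s = a ++ g :: ebar g :: b.
Proof.
elim: s e => //= f s IH e; rewrite negb_and negbK => /orP[/eqP ->|/IH].
  by exists [::], e, s.
by case=> a [g [b ->]]; exists (e :: a), g, b.
Qed.

(** Numerator and denominator of the absolute modulus are kept apart as naturals, so that
    divisibility can be used. *)
Definition kprod (k : edge GG -> int) w : nat := \prod_(e <- w) `|k e|%N.
Definition kprod' (k : edge GG -> int) w : nat := kprod (k \o @ebar (gedge GG)) w.

Lemma kprod_cat k s t : kprod k (s ++ t) = (kprod k s * kprod k t)%N.
Proof. by rewrite /kprod big_cat. Qed.

Lemma kprod_cons k e t : kprod k (e :: t) = (`|k e| * kprod k t)%N.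
Proof. by rewrite /kprod big_cons. Qed.

(** A pair of mutually reversed edges contributes the same factor to both products, so deleting it
    preserves their inequality. Pairs are removed inside the walk or, after cyclic rotation, at its
    two ends. *)
Lemma cyclic_reduction k u w : (forall e, k e <> 0%R) ->
  edge_walk (@rng GG) u w u -> kprod k w <> kprod' k w ->
  exists2 w', path.cycle okstep w' & kprod k w' <> kprod' k w'.
Proof.
have shuffle (x1 x2 x3 x4 c d : nat) : (x1 * x2 = x3 * x4 ->
    x1 * (c * (d * x2)) = x3 * (d * (c * x4)))%N.
  by move=> E; rewrite mulnCA (mulnCA x1) E (mulnCA x3 d) (mulnCA x3 c) (mulnCA d c).
move=> k0; have [n] := ubnP (size w); elim: n u w => // n IH u w szw ew neq.
have kn0 e : (0 < `|k e|)%N by rewrite absz_gt0; apply/eqP; exact: k0.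
have [//|ncw] := boolP (path.cycle okstep w); first by exists w.
case: w szw ew neq ncw => // e t szw ew neq ncw.
have [pt|npt] := boolP (path (fun e f => f != ebar e) e t); last first.
  have [a [g [b E]]] := backtrack_split npt.
  move: ew neq szw; rewrite {}E => /edge_walk_cat[m ea [gm [eb bt]]] neq szw.
  apply: (IH u (a ++ b)).
  - by move: szw; rewrite !size_cat /=; lia.
  - apply/edge_walk_cat; exists m => //.
    by rewrite -gm; move: bt; rewrite ebarK.
  move=> E; apply: neq; move: E; rewrite /kprod' !kprod_cat !kprod_cons /= ebarK.
  exact: shuffle.
have wt : path okstep e t /\ src (last e t) = u.
  case: ew => _; elim: t e pt {szw neq ncw} => [|f t IHt] e //=.
  move=> /andP[fe pt] [rf ft].
  by rewrite /okstep rf fe eqxx /=; exact: IHt.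
(* The walk closes up and has no inner backtracking, so the cycle condition can fail only where the
   last edge meets the first. *)
have el : e = ebar (last e t).
  apply/eqP; apply: contraNT ncw => nel.
  rewrite /= rcons_path; case: wt => -> /= sl.
  by rewrite /okstep nel sl; case: ew => -> _; rewrite eqxx.
case/lastP: t el szw ew neq {ncw pt wt} => [|t g].
  by move=> /=; case: (e) => c [].
rewrite last_rcons => -> szw ew neq.
move: ew => /= [rg]; rewrite -cats1 => /edge_walk_cat[m tm [gm _]].
apply: (IH _ t); first by move: szw; rewrite /= size_rcons; lia.
  by rewrite ebarK -gm in tm; exact: tm.
move=> E; apply: neq; rewrite -cats1 /kprod' !kprod_cons !kprod_cat !kprod_cons /= ebarK.
rewrite -/(kprod' k t) -E /kprod !big_nil !muln1 mulnC -mulnA.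
by rewrite [RHS]mulnCA.
Qed.

Lemma word_modulus_kprod k (x : gword GG) : (forall e, k e <> 0%R) ->
  (`|word_modulus k x| * (kprod k (wedges x.1))%:R = (kprod' k (wedges x.1))%:R)%R.
Proof.
move=> k0; rewrite /word_modulus; elim: (wedges x.1) => [|e w IH].
  by rewrite /kprod' /kprod !big_nil normr1 mulr1.
rewrite big_cons /kprod' !kprod_cons !natrM normrM mulrACA IH; congr (_ * _)%R.
rewrite normrM normfV -!intr_norm -!abszE /= divfK //.
by rewrite pnatr_eq0 absz_eq0; apply/eqP.
Qed.

Lemma non_unimodular_walk k : (forall e, k e <> 0%R) -> ~ unimodular k ->
  exists u w, edge_walk (@rng GG) u w u /\ kprod k w <> kprod' k w.
Proof.
move=> k0 nu; apply: contrapT => nex; apply: nu => x u [xw _].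
have [E|neq] := pselect (kprod k (wedges x.1) = kprod' k (wedges x.1)); last first.
  by case: nex; exists u, (wedges x.1).
have := word_modulus_kprod x k0; rewrite -E => /(congr1 (fun z => z / (kprod k (wedges x.1))%:R)%R).
have n0 : ((kprod k (wedges x.1))%:R != 0 :> rat)%R.
  rewrite pnatr_eq0 -lt0n prodn_gt0 // => e; rewrite absz_gt0; apply/eqP; exact: k0.
by rewrite mulfK // divff.
Qed.

Lemma non_unimodular_cycle k : (forall e, k e <> 0%R) -> ~ unimodular k ->
  exists2 w, path.cycle okstep w & kprod k w <> kprod' k w.
Proof.
move=> k0 nu; have [u [w [uw neq]]] := non_unimodular_walk k0 nu.
exact: cyclic_reduction uw neq.
Qed.

End Flow.

Section PowerDivisibility.

Lemma dvdn_exp_limit (N D A : nat) : (0 < N)%N -> (0 < D)%N -> (0 < A)%N ->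
  (forall m, D ^ m %| N * A ^ m)%N -> (D %| A)%N.
Proof.
move=> N0 D0 A0 H; apply/dvdn_partP => // p; rewrite mem_primes => /andP[pp _].
rewrite p_part pfactor_dvdn // leqNgt; apply/negP => lt.
(* If the valuation of D at p exceeded that of A, the surplus on the left would be at least m;
   taking m one more than the valuation of N is enough for a contradiction. *)
have := dvdn_leq_log p _ (H (logn p N).+1).
rewrite muln_gt0 N0 expn_gt0 A0 => /(_ isT).
by rewrite lognM // ?expn_gt0 ?A0 // !lognX; nia.
Qed.

End PowerDivisibility.

(** * Integers carried along words of a GBS graph *)

Section GBSWords.
Variables (GG : graph_of_groups) (k : edge GG -> int).
Variables (phi : forall w : vert GG, int -> vgrp w)
          (psi : forall a : gedge GG, int -> egrp a).
Arguments phi : clear implicits.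
Arguments psi : clear implicits.
Hypotheses (phi_bij : forall w, bijective (phi w) /\
              {morph phi w : i j / (i + j)%R >-> i * j})
  (psi_bij : forall a, bijective (psi a) /\
              {morph psi a : i j / (i + j)%R >-> i * j})
  (k0 : forall e, k e <> 0%R)
  (emono_phi : forall e z, emono e (psi e.1 z) = phi (rng e) (k e * z)%R).
Implicit Types (e f : edge GG) (l : letter GG) (p q : seq (letter GG)).
Implicit Types (w s t : seq (edge GG)) (u : vert GG) (a : gedge GG).

Lemma phiD u i j : phi u (i + j)%R = phi u i * phi u j.
Proof. exact: (phi_bij u).2. Qed.

Lemma phi_inj u : injective (phi u).
Proof. by case: (phi_bij u) => /bij_inj. Qed.

Lemma phi_surj u (g : vgrp u) : exists z, g = phi u z.
Proof. by case: (phi_bij u) => -[h _ hK] _; exists (h g); rewrite hK. Qed.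

Lemma psi_surj a (g : egrp a) : exists z, g = psi a z.
Proof. by case: (psi_bij a) => -[h _ hK] _; exists (h g); rewrite hK. Qed.

Lemma phi0 u : phi u 0%R = 1.
Proof. by apply: (mulgI (phi u 0%R)); rewrite -phiD mulg1 addr0. Qed.

Lemma gbs_comm u (g h : vgrp u) : g * h = h * g.
Proof.
have [i ->] := phi_surj g; have [j ->] := phi_surj h.
by rewrite -!phiD addrC.
Qed.

Lemma pvact_cons (g : velt GG) l q : pvact g (l :: q) =
  mkletter (coset_rep (vat (rng (tag l)) g * tagged l)) ::
  pvact (mkvelt (emono (ebar (tag l)) (coset_rem (vat (rng (tag l)) g * tagged l)))) q.
Proof. by rewrite -(vact_fst _ _ g) /vact -lock /= -(vact_fst _ _ g) /vact -lock. Qed.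

(** Since vertex groups are abelian, fixing a letter over f means z = k_f y, whatever the
    representative, and then k_{ebar f} y is carried on. *)
Lemma carry_gbs u z q : startok u q -> pvact (mkvelt (phi u z)) q = q ->
  exists z', carry (mkvelt (phi u z)) q = mkvelt (phi (pend u q) z') /\
    (`|z'| * kprod k (wedges q) = `|z| * kprod' k (wedges q))%N.
Proof.
elim: q u z => [|l q IH] u z.
  by move=> _ _; exists z; rewrite /kprod' /kprod !big_nil.
case: (letter_mk l) => f [s ->] /= [ru ts fq]; subst u.
rewrite pvact_cons //= vat_mk => -[/mkletter_inj rs].
have E := coset_rep_rem (phi (rng f) z * s); rewrite rs in E.
have [y yE] := psi_surj (coset_rem (phi (rng f) z * s)).
have zE : z = (k f * y)%R.
  apply: (@phi_inj (rng f)); rewrite -emono_phi -yE.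
  by apply: (mulIg s); exact: etrans E (gbs_comm _ _).
rewrite yE (emono_phi (ebar f) y) => fixq.
have [z' [-> Hz]] := IH (src f) (k (ebar f) * y)%R (follow_start fq) fixq.
exists z'; split=> //.
rewrite /kprod' !kprod_cons /= -/(kprod' k _) mulnCA Hz zE !abszM.
by rewrite -!mulnA; congr (_ * _)%N; rewrite mulnCA.
Qed.

Lemma kprod_gt0 w : (0 < kprod k w)%N.
Proof.
by rewrite prodn_gt0 // => e; rewrite absz_gt0; apply/eqP; exact: k0.
Qed.

Lemma kprod'_gt0 w : (0 < kprod' k w)%N.
Proof.
by rewrite prodn_gt0 // => e /=; rewrite absz_gt0; apply/eqP; exact: k0.
Qed.

Lemma cycle_rev_ebar w :
  path.cycle (@okstep GG) w -> path.cycle (@okstep GG) (rev [seq ebar e | e <- w]).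
Proof.
rewrite rev_cycle cycle_map; apply: sub_cycle => e f.
rewrite /okstep => /andP[/eqP rf nf].
change (okstep (ebar f) (ebar e)); rewrite /okstep src_ebar rf eqxx /= ebarK.
by apply: contra nf => /eqP <-.
Qed.

Lemma kprod_rev_ebar w : kprod k (rev [seq ebar e | e <- w]) = kprod' k w.
Proof. by rewrite /kprod' /kprod big_rev big_map. Qed.

Lemma kprod'_rev_ebar w : kprod' k (rev [seq ebar e | e <- w]) = kprod k w.
Proof.
rewrite /kprod' /kprod big_rev big_map; apply: eq_bigr => e _ /=.
by rewrite ebarK.
Qed.

Lemma big_transv f : (1 < `|k f|)%N -> exists2 s, transv f s & s <> 1.
Proof.
move=> kf; exists (coset_rep (phi (rng f) 1%R)); first exact: coset_repP.
move=> E; have := coset_rep_rem (phi (rng f) 1%R); rewrite E mul1g.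
have [y ->] := psi_surj (coset_rem (phi (rng f) 1%R)).
rewrite emono_phi => /phi_inj /(congr1 absz); rewrite abszM.
by case: `|y|%N => [|n]; nia.
Qed.

Hypothesis flow : forall (xi : nat -> letter GG) e, infinite_reduced xi -> can_flow xi e.
Variable w : seq (edge GG).
Hypotheses (cw : path.cycle (@okstep GG) w) (nw : kprod k w <> kprod' k w).

(** If all coefficients on the cycle and on its reversal were units, both products would be 1. So
    some edge f on one of them has a nontrivial transversal. *)
Lemma gbs_branching : branching GG.
Proof.
have [w1 [f [cw1 fw1 kf]]] : exists w1 f,
    [/\ path.cycle (@okstep GG) w1, f \in w1 & (1 < `|k f|)%N].
  apply: contrapT => nex; apply: nw.
  have le1 w1 f : path.cycle (@okstep GG) w1 -> f \in w1 -> `|k f|%N = 1%N.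
    move=> cw1 fw1; apply/eqP; rewrite eqn_leq leqNgt.
    have -> : (0 < `|k f|)%N by rewrite absz_gt0; apply/eqP; exact: k0.
    by rewrite andbT; apply/negP => kf; apply: nex; exists w1, f.
  have kp1 w1 : path.cycle (@okstep GG) w1 -> kprod k w1 = 1%N.
    by move=> cw1; rewrite /kprod big_seq big1 // => f; exact: le1.
  by rewrite kp1 // -kprod_rev_ebar kp1 //; exact: cycle_rev_ebar.
move=> e; have [i t E] := rot_to fw1.
(* The predecessor of f on the cycle is not the reversal of f, so after it both the trivial and the
   nontrivial letter over f are allowed. *)
have gw : last f t \in w1 by rewrite -(mem_rot i) E mem_last.
have [q [l [fq el]]] := cycle_reach cw1 gw flow e.
have okf : okstep (last f t) f.
  by move: cw1; rewrite -(rot_cycle i) E /= rcons_path => /andP[].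
have [s ts s1] := big_transv kf.
exists (rcons q l), (one1 f), (mkletter s); split.
- rewrite -cats1; apply/follow_cat; rewrite last_wedges el; split=> //.
  by split=> //; apply: okstep_okl => //; exact: transv1.
- rewrite -cats1; apply/follow_cat; rewrite last_wedges el; split=> //.
  by split=> //; exact: okstep_okl.
by move/mkletter_inj/esym.
Qed.

Lemma gbs_edge_free : edge_free GG.
Proof.
move=> e h h1; apply: contrapT => nex.
have fixq q : follow e q -> pvact (mkvelt (emono (ebar e) h)) q = q.
  by move=> fq; apply: contrapT => n; apply: nex; exists q.
have [z zE] := phi_surj (emono (ebar e) h).
have z0 : (0 < `|z|)%N.
  rewrite absz_gt0; apply/eqP => z0; apply: h1; apply: (@emono_inj GG (ebar e)).
  by rewrite zE z0 phi0 emono1.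
(* Two distinct positive numbers cannot divide each other, so one orientation of the cycle works. *)
have [w1 cw1 nd] : exists2 w1, path.cycle (@okstep GG) w1 &
    ~ (kprod k w1 %| kprod' k w1)%N.
  have [d1|nd] := pselect (kprod k w %| kprod' k w)%N; last by exists w.
  exists (rev [seq ebar e | e <- w]); first exact: cycle_rev_ebar.
  rewrite kprod_rev_ebar kprod'_rev_ebar => d2; apply: nw.
  by apply/eqP; rewrite eqn_dvd d1 d2.
case: w1 cw1 nd => [|f t] cw1 nd; first by apply: nd; rewrite /kprod' /kprod !big_nil.
have [q [l [fq el]]] := cycle_reach cw1 (mem_head f t) flow e.
(* The constant also absorbs the path leading from e to the cycle. *)
apply: nd; apply: (@dvdn_exp_limit (`|z| * kprod' k (wedges (rcons q l)))).
- by rewrite muln_gt0 z0 kprod'_gt0.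
- exact: kprod_gt0.
- exact: kprod'_gt0.
move=> m; pose S m := flatten (nseq m (rcons t f)).
have [Sp Sl] : path (@okstep GG) f (S m) /\ last f (S m) = f.
  rewrite /S; elim: m => //= m [IH1 IH2].
  by rewrite cat_path last_cat last_rcons IH1 IH2 andbT; split.
have SK (j : edge GG -> int) : kprod j (S m) = (kprod j (f :: t) ^ m)%N.
  rewrite /S; elim: m {Sp Sl} => [|m IH]; first by rewrite /kprod big_nil.
  rewrite /= kprod_cat IH expnS; congr (_ * _)%N.
  by rewrite /kprod big_rcons big_cons /= mulnC.
have fol : follow e (rcons q l ++ ones (S m)).
  by apply/follow_cat; rewrite last_wedges el; split=> //; exact: ones_follow.
have := fixq _ fol; rewrite zE => fx.
have [z' [_]] := carry_gbs (follow_start fol) fx.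
rewrite (_ : wedges (_ ++ _) = wedges (rcons q l) ++ S m); last first.
  by rewrite -[in RHS](wedges_ones (S m)) /wedges map_cat.
rewrite /kprod' !kprod_cat !SK -!/(kprod' _ _) => Hz.
by rewrite -mulnA -Hz mulnA dvdn_mull.
Qed.

End GBSWords.

Lemma start_letter (GG : graph_of_groups) (v : vert GG) (e : edge GG) :
  exists l, startok v [:: l].
Proof.
have [[|f p] /=] := graph_connected v (rng e).
  by move=> ->; exists (one1 e); split=> //; exact: transv1.
by move=> [rf _]; exists (one1 f); split=> //; exact: transv1.
Qed.

Lemma cycle_mem_ebar (GG : graph_of_groups) (e0 : edge GG) w :
  e0 \in w -> ebar e0 \in rev [seq ebar e | e <- w].
Proof. by move=> ew; rewrite mem_rev map_f. Qed.

(** The first edge [e0] of the cycle is reached along the cycle, its reversal along the reversed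
    cycle. The cycle is nonempty because the empty one has equal products. *)
Theorem gbs_Cstar_simple (R : realType) (GG : graph_of_groups) (v : vert GG)
    (k : edge GG -> int) :
  gbs_coeffs k -> (forall (xi : nat -> letter GG) e, infinite_reduced xi -> can_flow xi e) ->
  ~ unimodular k -> Cstar_simple R (pi1 v).
Proof.
move=> [phi [psi [phiP psiP k0 kE]]] flow nu.
have [w cw nw] := non_unimodular_cycle k0 nu.
case: w cw nw => [|e0 w] cw nw; first by case: nw; rewrite /kprod' /kprod !big_nil.
have [l0 sl0] := start_letter v e0.
apply: powers_Cstar_simple => F N nF; apply: (@powers_pi1 GG e0) sl0 nF.
- exact: (cycle_reach cw (mem_head _ _) flow).
- exact: (gbs_branching phiP psiP k0 kE flow cw nw).
- exact: (gbs_edge_free phiP psiP k0 kE flow cw nw).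
exact: (cycle_reach (cycle_rev_ebar cw) (cycle_mem_ebar (mem_head _ _)) flow).
Qed.

(** * Graphs with nontrivial transversals *)

Lemma card_ge2 (T : Type) (A : set T) a b : A a -> A b -> a <> b -> `I_2 #<= A.
Proof.
move=> Aa Ab ab; pose g x := if `[< x = a >] then 0%N else 1%N.
apply: card_le_trans (card_image_le g A).
apply: subset_card_le => -[_|[_|//]] /=.
  by exists a => //; rewrite /g; case: asboolP.
by exists b => //; rewrite /g; case: asboolP => // /esym.
Qed.

Section Thick.
Variable GG : graph_of_groups.
Implicit Types (e f : edge GG) (l : letter GG) (p q : seq (letter GG)).

Definition nontriv l := transv (tag l) (tagged l) /\ tagged l <> 1.

Lemma nontriv_okl e l : rng (tag l) = src e -> nontriv l -> okl e l.
Proof.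
case: (letter_mk l) => f [s ->] r [ts s1]; split=> // E.
move: (congr1 tag E) => /= ef; subst f.
by move/mkletter_inj: E.
Qed.

Lemma follow_nth l p n : follow (tag l) p -> (n < size p)%N ->
  okl (tag (nth l (l :: p) n)) (nth l p n).
Proof.
elim: p l n => // l' p IH l [|n] /= [o f]; first by [].
rewrite ltnS => np; have := IH l' n f np.
rewrite (@set_nth_default _ (l' :: p) l l') /=; last by rewrite ltnS ltnW.
by rewrite (@set_nth_default _ p l l').
Qed.

Section Extend.
Hypothesis next : forall e, exists l, okl e l.

Lemma extend_infinite u p l : startok u (l :: p) -> exists xi,
  [/\ infinite_reduced xi, rng (tag (xi 0%N)) = u & mkseq xi (size (l :: p)) = l :: p].
Proof.
move=> [rl tl fp].
pose nx l' := sval (cid (next (tag l'))).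
have nxP l' : okl (tag l') (nx l') by rewrite /nx; case: cid.
pose xi n := if (n <= size p)%N then nth l (l :: p) n
  else iter (n - size p) nx (last l p).
exists xi; split=> //; last first.
  apply: (@eq_from_nth _ l); rewrite size_mkseq // => i lt.
  by rewrite nth_mkseq // /xi -ltnS lt.
apply: follow_infinite => // n; rewrite /xi.
have [lt|gt|eq] := ltngtP n (size p).
- exact: follow_nth.
- by rewrite subSn ?iterS ?(ltnW gt) //; exact: nxP.
by rewrite {}eq subSnn -last_nth /=; exact: nxP.
Qed.

(** Infinite extensions of pairwise incomparable words are pairwise distinct. *)
Lemma infinite_boundary u l0 : branching GG -> startok u [:: l0] ->
  infinite_set (vboundary u).
Proof.
move=> Br sl0; have [s [sP sI]] := incomparable_family Br sl0.
have H j : exists xi, vboundary u xi /\ mkseq xi (size (s j)) = s j.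
  have [[|l' p] [l [-> st]]] := sP j.
    by have [xi [? ? ?]] := @extend_infinite u [::] l st; exists xi.
  by have [xi [? ? ?]] := @extend_infinite u (rcons p l) l' st; exists xi.
pose xi j := sval (cid (H j)).
have xiP j : vboundary u (xi j) /\ mkseq (xi j) (size (s j)) = s j.
  by rewrite /xi; case: cid.
have pre j N : (size (s j) <= N)%N -> prefix (s j) (mkseq (xi j) N).
  move=> le; rewrite prefixE -{2}(xiP j).2; apply/eqP.
  by rewrite /mkseq -map_take take_iota (minn_idPl le).
apply/infiniteP.
have inj : {in [set: nat] &, injective xi}.
  move=> i j _ _ E; apply: (sI i j (mkseq (xi i) (size (s i) + size (s j)))).
    by apply: pre; rewrite leq_addr.
  by rewrite E; apply: pre; rewrite leq_addl.
have /card_eqPle[_ le] := inj_card_eq inj.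
apply: card_le_trans le _.
by apply: subset_card_le => _ [j _ <-]; exact: (xiP j).1.
Qed.

End Extend.

(** All edge indices are at least 2. A nontrivial letter may follow any edge with matching source,
    so every walk lifts to a reduced word. *)
Definition thick := forall e, exists2 s, transv e s & s <> 1.

(** With the trivial letter over the edge of l1 these are three letters of the same range, so some
    vertex of the tree has valence at least 3; this rules out a line. *)
Definition three_letters := exists l1 l2 : letter GG,
  [/\ nontriv l1, nontriv l2, rng (tag l1) = rng (tag l2) & l1 <> l2].

Hypothesis (T : thick).

Lemma thick_letter e : exists2 l, tag l = e & nontriv l.
Proof. by have [s ts s1] := T e; exists (mkletter s). Qed.

Lemma thick_reach e f : reach e f.
Proof.
have [p] := graph_connected (src e) (rng f).
elim: p e => [|g p IH] e /=.
  move=> sf; have [l lf nl] := thick_letter f; exists [::], l; split=> //=.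
  by split=> //; apply: nontriv_okl => //; rewrite lf.
move=> [rg pf]; have [l lg nl] := thick_letter g.
apply: reach_trans (IH g pf); exists [::], l; split=> //=; split=> //.
by apply: nontriv_okl => //; rewrite lg.
Qed.

Lemma thick_branching : three_letters -> branching GG.
Proof.
move=> [l1 [l2 [n1 n2 r12 l12]]] e.
have [q [l [fq el]]] := thick_reach e (ebar (tag l1)).
exists (rcons q l), l1, l2; split=> //.
  rewrite -cats1; apply/follow_cat; rewrite last_wedges el; split=> //.
  by split=> //; apply: nontriv_okl; rewrite ?src_ebar.
rewrite -cats1; apply/follow_cat; rewrite last_wedges el; split=> //.
by split=> //; apply: nontriv_okl; rewrite ?src_ebar.
Qed.

Lemma thick_next e : exists l, okl e l.
Proof.
have [q [l [fq _]]] := thick_reach e e.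
by case: q fq => [|l' q] /= [ok _]; [exists l|exists l'].
Qed.

Lemma thick_conditions (v : vert GG) : three_letters -> conditions_i_iii v.
Proof.
move=> L; have Br := thick_branching L.
have [l1 [l2 [n1 n2 r12 l12]]] := L.
have [l0 sl0] := start_letter v (tag l1).
split.
- exact: infinite_boundary thick_next _ _ Br sl0.
- move=> xi e ir; exists 0%N.
  have [q [l [fq el]]] := thick_reach e (tag (xi 0%N)).
  have st : startok (rng e) (one1 e :: rcons q l).
    by split=> //; exact: transv1.
  have [xi' [ir' r' E]] := extend_infinite thick_next st.
  exists xi'; split=> //; first by move: E => [-> _].
  exists (size q); rewrite -el.
  have := congr1 (fun s => nth l s (size q).+1) E.
  rewrite nth_mkseq /= ?size_rcons // => ->.
  by rewrite nth_rcons ltnn eqxx.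
(* The repeatable path goes along the edge of l1 and straight back; nontrivial letters keep it, and
   its repetition, reduced. *)
have [l le nl] := thick_letter (ebar (tag l1)).
exists l1, [:: l]; split; last first.
  have [s ts s1] := T (ebar (tag l)).
  by rewrite /=; apply: (@card_ge2 _ _ s 1) => //; exact: transv1.
split.
- apply/reduced_path_startok; split=> //; first by case: n1.
  by split=> //; apply: nontriv_okl => //; rewrite le.
- by rewrite /= le src_ebar.
rewrite /= le => E.
have E2 : l1 = one1 (tag l1) by rewrite {1}E /one1 ebarK.
by case: n1 => _; apply; rewrite E2.
Qed.

Lemma thick_nonsingular : nonsingular GG.
Proof.
move=> e _; have [s ts s1] := T e.
pose co (g : vgrp (rng e)) := [set g * emono e h | h in [set: egrp e.1]].
apply: (@card_ge2 _ _ (co s) (co 1)); first by exists s.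
  by exists 1.
move=> E; have : co s s by exists 1 => //; rewrite emono1 mulg1.
rewrite E => -[h _]; rewrite mul1g => sE.
by apply: s1; have [<- _] := coset_rep_transv ts; rewrite -sE; case: (coset_rep_emono h).
Qed.

End Thick.

(** * Presentations and free products *)

Section PresentationLift.
Variables (S : choiceType) (rels : fword S -> fword S -> Prop).
Variables (H : groupType) (f : S -> H).

Definition weval (w : fword S) : H :=
  foldr (fun p x => (if p.2 then f p.1 else (f p.1)^-1) * x) 1 w.

Lemma weval_cat w1 w2 : weval (w1 ++ w2) = weval w1 * weval w2.
Proof. by elim: w1 => [|p w IH] /=; rewrite ?mul1g // IH mulgA. Qed.

Lemma weval_inv w : weval (fword_inv w) = (weval w)^-1.
Proof.
rewrite /fword_inv; elim: w => [|p w IH] /=; first by rewrite invg1.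
rewrite rev_cons -cats1 weval_cat IH /= mulg1 invMg.
by case: p.2; rewrite ?invgK.
Qed.

Hypothesis f_rels : forall w1 w2, rels w1 w2 -> weval w1 = weval w2.

Lemma weval_eq w1 w2 : pres_eq rels w1 w2 -> weval w1 = weval w2.
Proof.
elim=> {w1 w2} [w|w1 w2 _ IH|w1 w2 w3 _ IH1 _ IH2|w1 w2 w1' w2' _ IH1 _ IH2
    |s b|w1 w2 r] //.
- by rewrite IH1.
- by rewrite !weval_cat IH1 IH2.
- by case: b; rewrite /= mulg1 ?mulgV ?mulVg.
exact: f_rels.
Qed.

Definition pres_lift (x : presented rels) : H := weval (repr x).

Lemma pres_lift_class w : pres_lift (pres_class rels w) = weval w.
Proof. exact/weval_eq/pres_repr. Qed.

Lemma pres_liftM : {morph pres_lift : x y / x * y}.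
Proof.
move=> x y; rewrite -[x]pres_classK -[y]pres_classK.
by rewrite (pres_mulE _ _ _ : _ * _ = _) !pres_lift_class weval_cat.
Qed.

End PresentationLift.

Lemma morph1 (G H : groupType) (f : G -> H) : {morph f : x y / x * y} -> f 1 = 1.
Proof. by move=> fM; apply: (mulgI (f 1)); rewrite -fM !mulg1. Qed.

Lemma morphV (G H : groupType) (f : G -> H) : {morph f : x y / x * y} ->
  {morph f : x / x^-1}.
Proof. by move=> fM x; apply: (mulgI (f x)); rewrite -fM !mulgV morph1. Qed.

Lemma pres_class1 (S : choiceType) (rels : fword S -> fword S -> Prop) :
  pres_class rels [::] = 1.
Proof. by []. Qed.

Lemma pres_class_cat (S : choiceType) (rels : fword S -> fword S -> Prop) w1 w2 :
  pres_class rels (w1 ++ w2) = pres_class rels w1 * pres_class rels w2.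
Proof. by rewrite (pres_mulE _ _ _ : _ * _ = _). Qed.

Lemma pres_class_gen (S : choiceType) (rels : fword S -> fword S -> Prop) x b :
  pres_class rels [:: (x, b)] =
  if b then pres_class rels (fgen x) else (pres_class rels (fgen x))^-1.
Proof.
case: b => //; apply: (mulgI (pres_class rels (fgen x))); rewrite mulgV.
by rewrite -pres_class_cat -pres_class1; apply/pres_classP; exact: (pres_cancel _ x true).
Qed.

Lemma pres_ind (S : choiceType) (rels : fword S -> fword S -> Prop)
    (P : presented rels -> Prop) :
  P 1 -> (forall x y, P x -> P y -> P (x * y)) -> (forall x, P x -> P x^-1) ->
  (forall s, P (pres_class rels (fgen s))) -> forall x, P x.
Proof.
move=> P1 PM PV Pg x; rewrite -[x]pres_classK; elim: (repr x) => [|[s b] w IH] //.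
rewrite -[_ :: _]/([:: (s, b)] ++ w) pres_class_cat; apply: PM => //.
by rewrite pres_class_gen; case: b => //; exact: PV.
Qed.

Lemma morph_gen_eq (S : choiceType) (rels : fword S -> fword S -> Prop) (H : groupType)
    (f g : presented rels -> H) :
  {morph f : x y / x * y} -> {morph g : x y / x * y} ->
  (forall s, f (pres_class rels (fgen s)) = g (pres_class rels (fgen s))) -> f =1 g.
Proof.
move=> fM gM E; apply: pres_ind => //; first by rewrite !morph1.
  by move=> x y Ex Ey; rewrite fM gM Ex Ey.
by move=> x Ex; rewrite !morphV // Ex.
Qed.

(* Any choice of paths tau from the base vertex gives a retraction
   x |-> tau_u x tau_w^-1 of the path groupoid onto pi_1. *)
Lemma pi1_iso_criterion (GG : graph_of_groups) (v : vert GG) (H : groupType)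
    (f : H -> path_group GG) (g : path_group GG -> H) (tau : vert GG -> path_group GG) :
  {morph f : x y / x * y} -> {morph g : x y / x * y} ->
  tau v = 1 -> (forall x, word_images v v (f x)) -> cancel f g ->
  (forall w (x : vgrp w), f (g (pg_vert (mkvelt x))) = tau w * pg_vert (mkvelt x) * (tau w)^-1) ->
  (forall e, f (g (pg_edge e)) = tau (rng e) * pg_edge e * (tau (src e))^-1) ->
  exists F : H -> pi1 v,
    [/\ bijective F, {morph F : x y / x * y} & forall x, pi1_val (F x) = f x].
Proof.
move=> fM gM tv fw fK fv fe.
have fgP u w x : word_images u w x -> f (g x) = tau u * x * (tau w)^-1.
  case=> -[p a] [/= pw aw] <-; rewrite /word_image /=.
  set c := (if a is Some _ then _ else _).
  have cE : f (g c) = tau w * c * (tau w)^-1.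
    rewrite /c; case: a aw {c} => [[w' b]|] /=; first by move=> <-; exact: fv.
    by rewrite (morph1 gM) (morph1 fM) mulg1 mulgV.
  elim: p u pw {aw} => [|l p IH] u /=; first by move=> ->; rewrite mul1g cE.
  case: (letter_mk l) => e [b ->] /= [<- pw].
  rewrite -!mulgA mulgA gM fM (IH _ pw) gM fM fv fe -/(src e).
  by rewrite !mulgA !mulgVK.
have fP x : f x \in @pi1_pred GG v by apply/asboolP.
exists (fun x => Pi1 (fP x)); split=> //; last by move=> x y; apply: val_inj; exact: fM.
exists (fun x => g (pi1_val x)) => x; first exact: fK.
apply: val_inj; rewrite /=.
have wx : word_images v v (pi1_val x) by case: (x) => ? /= /asboolP.
by rewrite (fgP _ _ _ wx) tv invg1 mulg1 mul1g.
Qed.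

Lemma group_iso_refl (G : groupType) : group_iso G G.
Proof. by exists id => //; exists id. Qed.

Section TrivialGroup.
Definition trivgrp : Type := unit.
HB.instance Definition _ := Choice.on trivgrp.
Definition trivgrp_mul (x y : trivgrp) : trivgrp := tt.
Definition trivgrp_inv (x : trivgrp) : trivgrp := tt.
Lemma trivgrp_mulA : associative trivgrp_mul. Proof. by []. Qed.
Lemma trivgrp_mul1 : left_id (tt : trivgrp) trivgrp_mul. Proof. by case. Qed.
Lemma trivgrp_mulr1 : right_id (tt : trivgrp) trivgrp_mul. Proof. by case. Qed.
Lemma trivgrp_mulV : left_inverse (tt : trivgrp) trivgrp_inv trivgrp_mul. Proof. by []. Qed.
Lemma trivgrp_mulrV : right_inverse (tt : trivgrp) trivgrp_inv trivgrp_mul. Proof. by []. Qed.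
HB.instance Definition _ := isGroup.Build trivgrp
  trivgrp_mulA trivgrp_mul1 trivgrp_mulr1 trivgrp_mulV trivgrp_mulrV.

Lemma amenable_trivgrp (R : realType) : amenable R trivgrp.
Proof.
exists (fun A : set trivgrp => if `[< A tt >] then 1%R else 0%R); split.
- by move=> A; case: asboolP.
- by case: asboolP => // n; case: n.
- move=> A B AB; have nAB : ~ (A tt /\ B tt).
    by move=> H; have : (A `&` B) tt by []; rewrite AB.
  case: (asboolP (A tt)) => a; case: (asboolP (B tt)) => b; case: asboolP => u;
    rewrite ?addr0 ?add0r //; exfalso; move: u; rewrite /setU /=; tauto.
move=> [] A; congr (if _ then _ else _); apply: asbool_equiv_eq.
by split=> [[[] ? //]|a]; exists tt.
Qed.
End TrivialGroup.

Section FreeProduct.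
Variables G F : finGroupType.

Definition seg_rng (e : unit * bool) : bool := e.2.

Lemma seg_connected (u w : bool) : exists p, edge_walk seg_rng u p w.
Proof.
have [->|n] := eqVneq u w; first by exists [::].
by exists [:: (tt, u)]; split=> //; case: u w n => [] [].
Qed.

Definition seg_graph : graph := @Graph bool unit seg_rng seg_connected.

Definition seg_vgrp (w : vert seg_graph) : groupType := if w then G else F.

Definition seg_mono (e : edge seg_graph) (x : trivgrp) : seg_vgrp (rng e) := 1.

Lemma seg_finite (w : vert seg_graph) : finite_set [set: seg_vgrp w].
Proof. by case: w; exact: finite_finset. Qed.

Lemma seg_countable (w : vert seg_graph) : countable [set: seg_vgrp w].
Proof. exact/finite_set_countable/seg_finite. Qed.

Lemma triv_countable (a : gedge seg_graph) : countable [set: trivgrp].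
Proof. exact: (@countableP unit). Qed.

Lemma seg_monoM e : {morph @seg_mono e : g h / g * h}.
Proof. by move=> g h; rewrite /seg_mono mulg1. Qed.

Lemma seg_mono_inj e : injective (@seg_mono e).
Proof. by move=> [] []. Qed.

Lemma seg_transvP (e : edge seg_graph) (g : seg_vgrp (rng e)) :
  exists! s, [set: seg_vgrp (rng e)] s /\ exists h, g = s * @seg_mono e h.
Proof.
exists g; split; first by split=> //; exists 1; rewrite /seg_mono mulg1.
by move=> s [_ [h ->]]; rewrite /seg_mono mulg1.
Qed.

(** Vertex [true] carries G and vertex [false] carries F. The edge group is trivial, so the
    transversals are the whole vertex groups. *)
Definition segment : graph_of_groups := @GraphOfGroups seg_graph seg_vgrp
  (fun=> trivgrp) seg_mono seg_countable triv_countable seg_monoM seg_mono_inj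
  (fun e => [set: seg_vgrp (rng e)]) (fun=> I) seg_transvP.

Definition segment_e : edge segment := (tt, true).

Definition seg_f (s : (G + F)%type) : path_group segment :=
  match s with
  | inl x => pg_vert (@mkvelt segment true x)
  | inr y => pg_edge segment_e * pg_vert (@mkvelt segment false y) * (pg_edge segment_e)^-1
  end.

Definition seg_fv (w : bool) : seg_vgrp w -> free_product G F :=
  match w with
  | true => fun g => pres_class _ (fgen (inl g : (G + F)%type))
  | false => fun g => pres_class _ (fgen (inr g : (G + F)%type))
  end.

Definition seg_g (s : path_gen segment) : free_product G F :=
  match s with
  | inl e => 1
  | inr x => @seg_fv (tag x) (tagged x)
  end.

Lemma seg_fvM w : {morph @seg_fv w : x y / x * y}.
Proof.
case: w => x y; rewrite /= -pres_class_cat; apply/pres_classP/pres_sym/pres_rel.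
  exact: FreeProdL.
exact: FreeProdR.
Qed.

Lemma seg_f_rels w1 w2 : @free_prod_rel G F w1 w2 -> weval seg_f w1 = weval seg_f w2.
Proof.
case=> x y; rewrite /= !mulg1.
  by rewrite -(@pg_vertM segment true).
by rewrite (@pg_vertM segment false) !mulgA mulgVK.
Qed.

Lemma seg_g_rels w1 w2 : @path_rel segment w1 w2 -> weval seg_g w1 = weval seg_g w2.
Proof.
case=> [w x y|e|e x]; rewrite /= ?mulg1 ?mul1g //.
  by rewrite -seg_fvM.
have E w : @seg_fv w 1 = 1 by exact: morph1 (@seg_fvM w).
by rewrite /= /seg_mono !E.
Qed.

Lemma free_product_iso : group_iso (free_product G F) (pi1 (true : vert segment)).
Proof.
pose f := pres_lift (rels := @free_prod_rel G F) seg_f.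
pose g := pres_lift (rels := @path_rel segment) seg_g.
have fg s : f (pres_class _ (fgen s)) = seg_f s.
  by rewrite /f (pres_lift_class seg_f_rels) /= mulg1.
have ge e : g (pg_edge e) = 1.
  by rewrite /g /pg_edge (pres_lift_class seg_g_rels) /= mulg1.
have gv w (x : seg_vgrp w) : g (@pg_vert segment (@mkvelt segment w x)) = seg_fv x.
  by rewrite /g /pg_vert (pres_lift_class seg_g_rels) /= mulg1.
have fM : {morph f : x y / x * y} by exact: pres_liftM seg_f_rels.
have gM : {morph g : x y / x * y} by exact: pres_liftM seg_g_rels.
pose tau (w : vert segment) : path_group segment := if w then 1 else pg_edge segment_e.
have [|||||F' [bF FM _]] := @pi1_iso_criterion segment true _ f g tau fM gM.
- by [].
- apply: pres_ind => [|x y|x|s].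
  + rewrite (morph1 fM); exact: word_images1.
  + by rewrite fM; exact: word_images_mul.
  + by rewrite (morphV fM); exact: word_images_inv.
  rewrite fg; case: s => [x|y] /=; first exact: (@word_images_vert segment true).
  apply: word_images_mul (word_images_inv (word_images_edge segment_e)).
  apply: word_images_mul (word_images_edge segment_e) _.
  exact: (@word_images_vert segment false).
- apply: (@morph_gen_eq _ _ _ (g \o f) id) => // [x y|s].
    by rewrite /= fM gM.
  rewrite /= fg; case: s => [x|y] /=; first exact: (gv true).
  by rewrite !gM (morphV gM) ge invg1 mulg1 mul1g (gv false).
- by case=> x; rewrite gv /= fg /= ?invg1 ?mulg1 ?mul1g.
- case=> -[] [] /=; rewrite ge (morph1 fM) /tau /=.
    by rewrite mul1g mulgV.
  by rewrite invg1 mulg1 (pg_edgeV segment_e) mulgV.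
by exists F'.
Qed.

Hypothesis big : (2 <= (#|{: G}| - 1) * (#|{: F}| - 1))%N.

Lemma card_nontriv (K : finGroupType) : (1 < #|{: K}|)%N -> exists x : K, x <> 1.
Proof.
move=> K1; have /existsP[x /eqP] : [exists x : K, x != 1]; last by exists x.
apply: contraLR K1; rewrite negb_exists => /forallP H; rewrite -leqNgt.
have -> : #|{: K}| = #|pred1 (1 : K)|.
  by apply: eq_card => x; rewrite !inE; have := H x; rewrite negbK => ->.
by rewrite card1.
Qed.

Lemma card_nontriv2 (K : finGroupType) : (2 < #|{: K}|)%N ->
  exists x y : K, [/\ x <> 1, y <> 1 & x <> y].
Proof.
move=> K2; have [x x1] := card_nontriv (ltnW K2).
have /existsP[y] : [exists y : K, y \notin [:: 1; x]]; last first.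
  by rewrite !inE negb_or => /andP[/eqP y1 /eqP yx]; exists x, y; split=> // /esym.
apply: contraLR K2; rewrite negb_exists => /forallP H; rewrite -leqNgt.
apply: leq_trans (card_size [:: 1; x]); apply: subset_leq_card.
by apply/fintype.subsetP => y _; have := H y; rewrite negbK.
Qed.

Lemma segment_thick : thick segment.
Proof.
have [G1 F1] : (1 < #|{: G}|)%N /\ (1 < #|{: F}|)%N by lia.
have [x x1] := card_nontriv G1; have [y y1] := card_nontriv F1.
by case=> -[] []; [exists (x : seg_vgrp true)|exists (y : seg_vgrp false)].
Qed.

Lemma segment_three : three_letters segment.
Proof.
have H b (x y : seg_vgrp b) : x <> 1 -> y <> 1 -> x <> y -> three_letters segment.
  move=> x1 y1 xy; exists (@mkletter segment (tt, b) x), (@mkletter segment (tt, b) y).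
  by split=> //; move/mkletter_inj.
have [/card_nontriv2[x [y [x1 y1 xy]]]|/card_nontriv2[x [y [x1 y1 xy]]]] :
    (2 < #|{: G}|)%N \/ (2 < #|{: F}|)%N by nia.
  exact: (H true x y).
exact: (H false x y).
Qed.

(** C*-simplicity is proved here, not assumed: the edge group being trivial, [edge_free] holds
    vacuously. *)
Theorem free_product_class_C (R : realType) : class_C_amenable R (free_product G F).
Proof.
exists segment, true; split.
- split; last exact: thick_nonsingular segment_thick.
  split=> [w|e]; last exact/finite_image/seg_finite.
  exact: (@finite_finset (unit * bool)%type).
- exact: thick_conditions segment_thick _ segment_three.
- by move=> a; exact: amenable_trivgrp.
- have [l0 sl0] := @start_letter segment true segment_e.
  apply: powers_Cstar_simple => K N nK.
  apply: (@powers_pi1 segment segment_e) sl0 nK => [e|||e].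
  + exact: thick_reach segment_thick _ _.
  + exact: thick_branching segment_thick segment_three.
  + by move=> e [].
  exact: thick_reach segment_thick _ _.
exact: free_product_iso.
Qed.

End FreeProduct.

(** * Membership in the class *)

Lemma eindex_fset_set (GG : graph_of_groups) (e : edge GG) (s : seq (set (vgrp (rng e)))) :
  finite_set (Defs.lcosets e) -> (forall A, Defs.lcosets e A -> A \in s) -> (eindex e <= size s)%N.
Proof.
move=> fin H; rewrite /eindex; apply: (@leq_trans #|` [fset x in s]%fset|).
  apply: fsubset_leq_card; apply/fsubsetP => A; rewrite in_fset_set // inE => LA.
  by rewrite inE; exact: H.
rewrite card_fseq; exact: size_undup.
Qed.

Section Cosets.
Variables (GG : graph_of_groups) (e : edge GG).

Definition ecoset (g : vgrp (rng e)) : set (vgrp (rng e)) :=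
  [set g * emono e h | h in [set: egrp e.1]].

Lemma ecoset_rep g : ecoset g = ecoset (coset_rep g).
Proof.
rewrite {1}(coset_rep_rem g); apply/seteqP; split=> x [h _ <-].
  by exists (coset_rem g * h) => //; rewrite emonoM mulgA.
by exists ((coset_rem g)^-1 * h) => //; rewrite -mulgA -emonoM mulVKg.
Qed.

Lemma lcosetsP A : Defs.lcosets e A -> exists2 s, transv e s & A = ecoset s.
Proof. by case=> g _ <-; exists (coset_rep g); [exact: coset_repP | exact: ecoset_rep]. Qed.

Hypothesis fin : finite_set (Defs.lcosets e).

Lemma eindex_nontriv : (1 < eindex e)%N -> exists2 s, transv e s & s <> 1.
Proof.
move=> e1; apply: contrapT => nex.
have : (eindex e <= size [:: ecoset 1])%N.
  apply: eindex_fset_set => // A /lcosetsP[s ts ->]; rewrite inE.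
  have [->//|s1] := pselect (s = 1).
  by case: nex; exists s.
by rewrite leqNgt e1.
Qed.

Lemma eindex_nontriv2 : (2 < eindex e)%N ->
  exists s t, [/\ transv e s, transv e t, s <> 1, t <> 1 & s <> t].
Proof.
move=> e2; have [s ts s1] := eindex_nontriv (ltnW e2).
apply: contrapT => nex.
have : (eindex e <= size [:: ecoset 1; ecoset s])%N.
  apply: eindex_fset_set => // A /lcosetsP[t tt ->]; rewrite !inE.
  have [->|t1] := pselect (t = 1); first by rewrite eqxx.
  have [->|st] := pselect (s = t); first by rewrite eqxx orbT.
  by case: nex; exists s, t.
by rewrite leqNgt e2.
Qed.

End Cosets.

Theorem single_edge_class_C (R : realType) (GG : graph_of_groups) (v : vert GG)
    (e : edge GG) :
  single_edge_graph e -> locally_finite GG -> amenable R (egrp e.1) ->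
  (2 <= (eindex e - 1) * (eindex (ebar e) - 1))%N ->
  Cstar_simple R (pi1 v) -> class_C_amenable R (pi1 v).
Proof.
move=> [_ _ ef] lf am big cs.
have [_ fin] := lf.
have T : thick GG.
  by move=> f; apply: eindex_nontriv => //; case: (ef f) => ->; lia.
have L : three_letters GG.
  have H (f : edge GG) : (2 < eindex f)%N -> three_letters GG.
    move=> /(eindex_nontriv2 (fin f))[s [t [ts tt s1 t1 st]]].
    by exists (mkletter s), (mkletter t); split=> //; move/mkletter_inj.
  (* A product of at least 2 has a factor of at least 2, hence one index is at least 3. *)
  have [|] : (2 < eindex e)%N \/ (2 < eindex (ebar e))%N by nia.
    exact: H.
  exact: H.
exists GG, v; split=> //.
- by split=> //; exact: thick_nonsingular.
- exact: thick_conditions.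
- move=> a; have : (a, true).1 = e.1 by case: (ef (a, true)) => ->.
  by move=> /= ->.
exact: group_iso_refl.
Qed.

(** Letters over different edges are distinct, so index 2 suffices when two directed edges share a
    range. *)
Lemma three_letters_edges (GG : graph_of_groups) (e f : edge GG) :
  thick GG -> rng e = rng f -> e <> f -> three_letters GG.
Proof.
move=> T r n; have [l1 e1 n1] := thick_letter T e; have [l2 e2 n2] := thick_letter T f.
by exists l1, l2; split=> //; rewrite ?e1 ?e2 // => E; apply: n; rewrite -e1 -e2 E.
Qed.

Section GBSClass.
Variables (GG : graph_of_groups) (k : edge GG -> int).
Hypotheses (gbs : gbs_coeffs k) (big : forall e, (2 <= `|k e|)%R).

Lemma big_absz e : (1 < `|k e|)%N.
Proof. by have := big e; lia. Qed.

Lemma gbs_thick : thick GG.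
Proof.
case: gbs => phi [psi [phiP psiP k0 kE]] e.
exact: (big_transv phiP psiP kE (big_absz e)).
Qed.

(** The residues modulo k_e represent all cosets. *)
Lemma gbs_finite_lcosets (e : edge GG) : finite_set (Defs.lcosets e).
Proof.
case: gbs => phi [psi [phiP psiP k0 kE]].
pose co (i : nat) : set (vgrp (rng e)) := ecoset (phi (rng e) (Posz i)).
apply: (@sub_finite_set _ _ (co @` `I_(`|k e|%N))); last first.
  exact/finite_image/finite_II.
move=> _ [g _ <-]; rewrite -/(ecoset g).
have [z ->] := phi_surj phiP g.
have ke0 : k e != 0%R by apply/eqP; exact: k0.
have m0 := modz_ge0 z ke0.
exists (`|(z %% k e)%Z|%N); first by rewrite /= -ltz_nat gez0_abs // abszE ltz_mod.
rewrite /co gez0_abs //.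
have -> : phi (rng e) z = phi (rng e) (z %% k e)%Z * emono e (psi e.1 (z %/ k e)%Z).
  by rewrite kE -(phiD phiP) mulrC addrC -divz_eq.
apply/seteqP; split=> x [h _ <-].
  by exists ((psi e.1 (z %/ k e)%Z)^-1 * h) => //; rewrite -mulgA -emonoM mulVKg.
by exists (psi e.1 (z %/ k e)%Z * h) => //; rewrite emonoM mulgA.
Qed.

Lemma gbs_class_C (v : vert GG) (H : groupType) : finite_graph GG ->
  three_letters GG -> ~ unimodular k -> group_iso H (pi1 v) -> class_C_gbs H.
Proof.
move=> fin L nu iso; exists GG, v, k; split=> //.
- split; last exact: thick_nonsingular gbs_thick.
  split=> [w|e]; last exact: gbs_finite_lcosets.
  case: fin => _ fe; apply: (@sub_finite_set _ _ [set: edge GG]) => //.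
  have -> : [set: edge GG] = [set: gedge GG] `*` [set: bool].
    by apply/seteqP; split.
  by apply: finite_setX => //; exact: finite_finset.
- exact: thick_conditions gbs_thick _ L.
Qed.

Lemma not_unimodular_walk (u : vert GG) w : edge_walk (@rng GG) u w u ->
  (`|\prod_(e <- w) ((k (ebar e))%:~R / (k e)%:~R)| != 1 :> rat)%R ->
  ~ unimodular k.
Proof.
move=> uw /eqP n um; apply: n; have := um (ones w, Some (mkvelt (1 : vgrp u))) u.
rewrite /word_modulus /= wedges_ones; apply; split=> //=.
by rewrite wedges_ones.
Qed.

End GBSClass.

Section IntGroup.
Definition intgrp : Type := int.
HB.instance Definition _ := Choice.on intgrp.
Definition intgrp_mul (x y : intgrp) : intgrp := (x + y : int)%R.
Definition intgrp_inv (x : intgrp) : intgrp := (- x : int)%R.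
Lemma intgrp_mulA : associative intgrp_mul. Proof. exact: (@addrA int). Qed.
Lemma intgrp_mul1 : left_id (0%R : intgrp) intgrp_mul. Proof. exact: (@add0r int). Qed.
Lemma intgrp_mulr1 : right_id (0%R : intgrp) intgrp_mul. Proof. exact: (@addr0 int). Qed.
Lemma intgrp_mulV : left_inverse (0%R : intgrp) intgrp_inv intgrp_mul.
Proof. exact: (@addNr int). Qed.
Lemma intgrp_mulrV : right_inverse (0%R : intgrp) intgrp_inv intgrp_mul.
Proof. exact: (@addrN int). Qed.
HB.instance Definition _ := isGroup.Build intgrp
  intgrp_mulA intgrp_mul1 intgrp_mulr1 intgrp_mulV intgrp_mulrV.
End IntGroup.

Section IntMorphisms.
Variable H : groupType.

Definition int_morph (u : int -> H) := forall i j, u (i + j)%R = u i * u j.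

Lemma int_morph_eq u1 u2 : int_morph u1 -> int_morph u2 -> u1 1%R = u2 1%R -> u1 =1 u2.
Proof.
move=> M1 M2 E1.
have Z u : int_morph u -> u 0%R = 1.
  by move=> M; apply: (mulgI (u 0%R)); rewrite -M mulg1 addr0.
have V u i : int_morph u -> u (- i)%R = (u i)^-1.
  by move=> M; apply: (mulgI (u i)); rewrite -M mulgV subrr Z.
have P (n : nat) : u1 n = u2 n.
  by elim: n => [|n IH]; rewrite ?Z // intS M1 M2 E1 IH.
case=> n; first exact: P.
by rewrite NegzE !V // P.
Qed.

Lemma int_morph_scale (u : int -> H) d : int_morph u -> int_morph (fun z => u (d * z)%R).
Proof. by move=> M i j; rewrite mulrDr M. Qed.

Lemma int_morph_conj (u : int -> H) t : int_morph u -> int_morph (fun z => t * u z * t^-1).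
Proof. by move=> M i j; rewrite M !mulgA mulgVK. Qed.

Lemma weval_fpow (S : choiceType) (f : S -> H) x u z :
  int_morph u -> u 1%R = f x -> weval f (fpow x z) = u z.
Proof.
move=> M u1; pose u' z := weval f (fpow x z).
have Z : u 0%R = 1 by apply: (mulgI (u 0%R)); rewrite -M mulg1 addr0.
case: z => n.
  rewrite /fpow /=; elim: n => [|n IH] /=; first by rewrite Z.
  by rewrite IH intS M u1.
have uV : u (- 1%R)%R = (f x)^-1.
  by apply: (mulgI (f x)); rewrite -u1 -M mulgV subrr Z.
rewrite /fpow /=; elim: n => [|n IH] /=; first by rewrite mulg1 -uV.
by rewrite IH -uV -M; congr u; lia.
Qed.

End IntMorphisms.

(** * Baumslag-Solitar groups as loops of groups *)

Section BSGroup.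
Variables k l : int.
Hypotheses (k0 : k != 0%R) (l0 : l != 0%R).

Definition loop_rng (e : unit * bool) : unit := tt.

Lemma loop_connected (u w : unit) : exists p, edge_walk loop_rng u p w.
Proof. by exists [::]; case: u w => [] []. Qed.

Definition loop_graph : graph := @Graph unit unit loop_rng loop_connected.

(** With t the edge [(tt, true)], the edge relation conjugates the image at the reversed edge to the
    image at the edge; it reads t a^k t^-1 = a^l for this placement of k and l. *)
Definition loop_k (e : edge loop_graph) : int := if e.2 then l else k.

Definition loop_mono (e : edge loop_graph) (z : intgrp) : intgrp := (loop_k e * z : int)%R.

Lemma intgrp_countable (a : unit) : countable [set: intgrp].
Proof. exact: (@countableP int). Qed.

Lemma loop_k0 e : loop_k e != 0%R.
Proof. by case: e => -[] []. Qed.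

Lemma loop_monoM e : {morph @loop_mono e : g h / g * h}.
Proof. by move=> x y; exact: mulrDr. Qed.

Lemma loop_mono_inj e : injective (@loop_mono e).
Proof. exact: (mulfI (loop_k0 e)). Qed.

Definition loop_transv (e : edge loop_graph) : set intgrp :=
  [set s | ((s : int) %% loop_k e)%Z = s].

Lemma loop_transv1 e : loop_transv e 1.
Proof. exact: mod0z. Qed.

Lemma loop_transvP (e : edge loop_graph) (g : intgrp) :
  exists! s, loop_transv e s /\ exists h, g = s * @loop_mono e h.
Proof.
have mulE (x y : intgrp) : x * y = (x + y : int)%R by [].
exists (((g : int) %% loop_k e)%Z : intgrp); split.
  split; first exact: modz_mod.
  exists (((g : int) %/ loop_k e)%Z : intgrp).
  by rewrite mulE /loop_mono mulrC addrC -divz_eq.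
move=> s [ts [h ->]]; rewrite mulE /loop_mono mulrC addrC modzMDl.
exact: ts.
Qed.

Definition loop_gog : graph_of_groups := @GraphOfGroups loop_graph (fun=> intgrp)
  (fun=> intgrp) loop_mono intgrp_countable intgrp_countable loop_monoM
  loop_mono_inj loop_transv loop_transv1 loop_transvP.

Definition loop_e : edge loop_gog := (tt, true).
Definition loop_v : vert loop_gog := tt.

Definition loop_a (z : int) : path_group loop_gog := pg_vert (@mkvelt loop_gog loop_v z).

Lemma loop_aM : int_morph loop_a.
Proof. by move=> i j; rewrite /loop_a -pg_vertM. Qed.

Lemma loop_gbs : gbs_coeffs (GG := loop_gog) loop_k.
Proof.
exists (fun _ z => z), (fun _ z => z); split=> //.
- by move=> w; split=> //; exists id.
- by move=> a; split=> //; exists id.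
- by move=> e; apply/eqP; exact: loop_k0.
Qed.

Lemma loop_finite : finite_graph loop_gog.
Proof. by split; exact: (@finite_finset unit). Qed.

Definition bs_f (s : bool) : path_group loop_gog :=
  if s then loop_a 1 else pg_edge loop_e.

Definition bs_u (z : int) : BS k l := pres_class _ (fpow true z).

Lemma bs_uM : int_morph bs_u.
Proof.
pose A := pres_class (bs_rel k l) (fgen true).
have nE b n : pres_class (bs_rel k l) (nseq n (true, b)) = (if b then A else A^-1) ^+ n.
  elim: n => [|n IH] //.
  rewrite -[nseq n.+1 _]/([:: (true, b)] ++ nseq n (true, b)) pres_class_cat IH expgS.
  by rewrite pres_class_gen.
have uS (z : int) : bs_u (z + 1)%R = bs_u z * A.
  case: z => n; first by rewrite -PoszD /bs_u /fpow /= !nE addn1 expgSr.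
  have uN m : bs_u (Negz m) = A^-1 ^+ m.+1 by rewrite /bs_u /fpow (nE false).
  case: n => [|n]; first by rewrite uN expg1 mulVg.
  rewrite (_ : Negz n.+1 + 1 = Negz n)%R; last by rewrite !NegzE; lia.
  by rewrite !uN [in RHS]expgSr mulgVK.
have u0 : bs_u 0%R = 1 by [].
move=> i j; elim/int_ind: j => [|n IH|n IH].
- by rewrite addr0 u0 mulg1.
- by rewrite -addn1 PoszD addrA !uS IH mulgA.
apply: (mulIg A); rewrite -mulgA -!uS.
have E : (- (n.+1)%:Z + 1 = - n%:Z)%R by lia.
by rewrite E -addrA E.
Qed.

Lemma bs_f_rels w1 w2 : bs_rel k l w1 w2 -> weval bs_f w1 = weval bs_f w2.
Proof.
case; rewrite !weval_cat weval_inv /fgen /= !mulg1.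
rewrite !(weval_fpow _ loop_aM) //.
have := @pg_edge_vert loop_gog loop_e (1%R : int).
rewrite /= /loop_mono /loop_k /= !mulr1 => E.
by rewrite mulgA; apply: (mulIg (pg_edge loop_e)); rewrite mulgVK.
Qed.

Definition bs_t : BS k l := pres_class _ (fgen false).

Definition bs_g (s : path_gen loop_gog) : BS k l :=
  match s with
  | inl e => if e.2 then bs_t else bs_t^-1
  | inr x => bs_u (tagged x)
  end.

Lemma bs_tP z : bs_t * bs_u (k * z)%R * bs_t^-1 = bs_u (l * z)%R.
Proof.
apply: (@int_morph_eq _ (fun z => bs_t * bs_u (k * z)%R * bs_t^-1)
  (fun z => bs_u (l * z)%R)).
- exact/int_morph_conj/int_morph_scale/bs_uM.
- exact/int_morph_scale/bs_uM.
rewrite !mulr1 /bs_u.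
have <- : pres_class (bs_rel k l) (fword_inv (fgen false)) = bs_t^-1.
  exact: (pres_class_gen _ false false).
transitivity (pres_class (bs_rel k l)
    ((fgen false ++ fpow true k) ++ fword_inv (fgen false))).
  by rewrite !pres_class_cat.
by rewrite -catA; apply/pres_classP/pres_rel; exact: BSRel.
Qed.

Lemma bs_g_rels w1 w2 : @path_rel loop_gog w1 w2 -> weval bs_g w1 = weval bs_g w2.
Proof.
case=> [w x y|e|e x]; rewrite /= ?mulg1.
- exact/esym/bs_uM.
- by case: e => -[] []; rewrite /= ?mulgV ?mulVg.
case: e x => -[] [] x; rewrite /= /loop_mono /= mulgA; first exact: bs_tP.
by rewrite -bs_tP !mulgA mulVg mul1g mulgVK.
Qed.

(** The value at a is recorded because the non-isomorphism proof must recognise the preimage of the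
    vertex group. *)
Lemma bs_iso : exists F : BS k l -> pi1 loop_v,
  [/\ bijective F, {morph F : x y / x * y}
    & pi1_val (F (pres_class _ (fgen true))) = loop_a 1].
Proof.
pose f := pres_lift (rels := bs_rel k l) bs_f.
pose g := pres_lift (rels := @path_rel loop_gog) bs_g.
have fg s : f (pres_class _ (fgen s)) = bs_f s.
  by rewrite /f (pres_lift_class bs_f_rels) /= mulg1.
have fu z : f (bs_u z) = loop_a z.
  by rewrite /f (pres_lift_class bs_f_rels) (weval_fpow _ loop_aM).
have ge e : g (pg_edge e) = bs_g (inl e).
  by rewrite /g /pg_edge (pres_lift_class bs_g_rels) /= mulg1.
have gv z : g (loop_a z) = bs_u z.
  by rewrite /g /loop_a /pg_vert (pres_lift_class bs_g_rels) /= mulg1.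
have fM : {morph f : x y / x * y} by exact: pres_liftM bs_f_rels.
have gM : {morph g : x y / x * y} by exact: pres_liftM bs_g_rels.
have [|||||F [bF FM Fv]] := @pi1_iso_criterion loop_gog loop_v _ f g (fun=> 1) fM gM.
- by [].
- apply: pres_ind => [|x y|x|s].
  + rewrite (morph1 fM); exact: word_images1.
  + by rewrite fM; exact: word_images_mul.
  + by rewrite (morphV fM); exact: word_images_inv.
  rewrite fg; case: s; first exact: word_images_vert.
  exact: word_images_edge.
- apply: (@morph_gen_eq _ _ _ (g \o f) id) => // [x y|s].
    by rewrite /= fM gM.
  rewrite /= fg; case: s => /=; first by rewrite gv.
  by rewrite ge.
- case=> z; rewrite -/(loop_a z) gv fu.
  by rewrite invg1 mulg1 mul1g.
- case=> -[] b; rewrite ge invg1 mulg1 mul1g /=; case: b; first exact: fg.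
  by rewrite (morphV fM) fg /= -(pg_edgeV loop_e).
by exists F; split=> //; rewrite Fv fg.
Qed.

Lemma loop_not_unimodular : (`|k| <> `|l|)%R -> ~ unimodular (GG := loop_gog) loop_k.
Proof.
move=> kl; apply: (@not_unimodular_walk _ _ loop_v [:: loop_e]); first by split.
rewrite big_seq1 /loop_k /= normrM normfV -!intr_norm.
apply/eqP => /(congr1 (fun z => z * (`|l|)%:~R)%R).
rewrite divfK ?mul1r; last by rewrite intr_eq0 normr_eq0.
by move=> /intr_inj.
Qed.

End BSGroup.

Lemma nondegenerate_bounds (k l : int) : (2 <= (`|k| - 1) * (`|l| - 1))%R ->
  (2 <= `|k|)%R /\ (2 <= `|l|)%R.
Proof.
move=> H; have := normr_ge0 k; have := normr_ge0 l.
by move: (`|k|)%R (`|l|)%R H => x y H y0 x0; split; nia.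
Qed.

(** The modulus of the loop is k/l, so the condition on absolute values is exactly
    non-unimodularity. *)
Theorem BS_class_C (k l : int) : (2 <= (`|k| - 1) * (`|l| - 1))%R ->
  (`|k| <> `|l|)%R -> class_C_gbs (BS k l).
Proof.
move=> /nondegenerate_bounds[k2 l2] kl.
have k0 : k != 0%R by rewrite -normr_eq0; apply/eqP => E; rewrite E in k2.
have l0 : l != 0%R by rewrite -normr_eq0; apply/eqP => E; rewrite E in l2.
have big e : (2 <= `|@loop_k k l e|)%R by case: e => -[] [].
have T := gbs_thick (loop_gbs k0 l0) big.
have [F [bF FM _]] := bs_iso k0 l0.
apply: (gbs_class_C (loop_gbs k0 l0) big (@loop_finite _ _ k0 l0) _ _ (v := tt)).
- by apply: (@three_letters_edges (loop_gog k0 l0) (tt, true) (tt, false) T).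
- exact: loop_not_unimodular.
by exists F.
Qed.

(** * Non-isomorphism with Baumslag-Solitar groups *)

Section CyclicReduction.
Variable GG : graph_of_groups.
Implicit Types (e f : edge GG) (l : letter GG) (p q : seq (letter GG)).

Lemma ebar_neq e : e <> ebar e.
Proof. by case: e => x []. Qed.

Lemma wedges_rcons p l : wedges (rcons p l) = rcons (wedges p) (tag l).
Proof. exact: map_rcons. Qed.

Lemma size_eact e x : (size (eact e x).1 <= (size x.1).+1)%N.
Proof.
rewrite /eact; case: x => -[|l p] a //=; case: eqP => _ //=.
by rewrite -addn2 leq_addr.
Qed.

Lemma size_vact g (x : word GG) : size (vact g x).1 = size x.1.
Proof. by have := congr1 size (vact_wedges g x); rewrite /wedges !size_map. Qed.

(* Elements of the path group that move tree vertices by a bounded amount. *)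
Definition shift_le (u w : vert GG) (c : path_group GG) n :=
  word_images u w c /\
  forall z, valid w z -> (size (pact c z).1 <= n + size z.1)%N.

Lemma shift_le_vert w (g : vgrp w) : shift_le w w (pg_vert (mkvelt g)) 0.
Proof.
split; first exact: word_images_vert.
by move=> z vz; rewrite (pact_vert g vz) size_vact.
Qed.

Lemma shift_le_edge e : shift_le (rng e) (src e) (pg_edge e) 1.
Proof.
split; first exact: word_images_edge.
by move=> z vz; rewrite (pact_edge vz) add1n size_eact.
Qed.

Lemma shift_leM u w t c d m n :
  shift_le u w c m -> shift_le w t d n -> shift_le u t (c * d) (m + n).
Proof.
move=> [wc Hc] [wd Hd]; split; first exact: word_images_mul wc wd.
move=> z vz; rewrite pactM; last exact: valid_validw vz.
have [vd _] := pact_word_images wd vz.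
by apply: leq_trans (Hc _ vd) _; rewrite -addnA leq_add2l; exact: Hd.
Qed.

Lemma shift_le_path u w p b : edge_walk (@rng GG) u (wedges p) w ->
  shift_le u w (path_image p * pg_vert (@mkvelt GG w b)) (size p).
Proof.
elim: p u => [|l p IH] u /=.
  by move=> ->; rewrite mul1g; exact: shift_le_vert.
case: (letter_mk l) => e [g ->] /= [<- /IH H].
rewrite -!mulgA -[(size p).+1]add0n.
apply: (shift_leM (shift_le_vert g)); rewrite -add1n.
exact: shift_leM (shift_le_edge e) H.
Qed.

Lemma shift_le_size u w c :
  word_images u w c -> shift_le u w c (size (pact c (eps w)).1).
Proof.
move=> wd; have [vd id] := pact_word_images wd (eps_valid w).
have td := pact_tag wd (eps_valid w).
move: id vd td; case: (pact c _) => p a; rewrite img_eps mulg1.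
case: (velt_mk a) => w2 [b ->] /= <- vd td; subst w2.
by apply: shift_le_path; exact: (valid_walk vd).
Qed.

(** A hyperbolic element whose axis passes through the base vertex; L is its translation length. *)
Definition translation (u : vert GG) (c : path_group GG) :=
  exists2 L, (0 < L)%N & forall n, size (pact (c ^+ n) (eps u)).1 = (n * L)%N.

(** Either the end of the normal form cancels against its beginning, and conjugation by the first
    letter shortens it by two edges, or consecutive copies concatenate without cancellation and the
    lengths of powers are exact multiples. *)
Lemma cyclic_reduction_word u c : word_images u u c -> exists u' d c',
  [/\ word_images u u' d, word_images u' u' c', c = d * c' * d^-1
    & (exists b, c' = pg_vert (@mkvelt GG u' b)) \/ translation u' c'].
Proof.
have [n] := ubnP (size (pact c (eps u)).1); elim: n u c => // n IH u c lt wc.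
have [vc ic] := pact_word_images wc (eps_valid u).
have tc := pact_tag wc (eps_valid u).
move: lt vc ic tc; case E : (pact c _) => [p a]; rewrite img_eps mulg1 /=.
case: (velt_mk a) E => w2 [b ->] E lt vc ic /= tc; subst w2.
case: p E lt vc ic => [|l p] E lt vc ic.
  exists u, 1, c; split=> //; [exact: word_images1 | by rewrite invg1 mulg1 mul1g | left].
  by exists b; rewrite -ic /img /= mul1g.
have [rl tl fp vp] := (valid_cons u l p _).1 vc.
move: (letter_mk l) => [e [g el]]; subst l; rewrite /= in rl; subst u.
pose f := last e (wedges p).
have sf : src f = rng e.
  by case: vc => _ /=; rewrite pend_wedges /= last_map.
have cE : c = path_image (mkletter g :: p) * pg_vert (mkvelt b) by rewrite -ic.
(* In c c the final element b meets the first letter g e; the junction cancels precisely when this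
   product becomes the trivial letter over the reversal of the last edge f. *)
have [bad|ok] := pselect (mkletter (coset_rep (b * g)) = one1 (ebar f)).
  have ef : e = ebar f by move/(congr1 tag): bad.
  case/lastP: p @f E lt vc ic fp vp sf cE ef bad => [|q l] f.
    by rewrite /f /= => _ _ _ _ _ _ _ _ /ebar_neq.
  rewrite {}/f last_wedges; move: (letter_mk l) => [f [h el]]; subst l.
  rewrite [tag _]/= => E lt vc ic fp vp sf cE ef; subst e.
  rewrite /one1 => /mkletter_inj r1.
  have bgE := coset_rep_rem (b * g); rewrite r1 mul1g in bgE.
  set r : egrp f.1 := coset_rem (b * g) in bgE.
  pose d1 := pg_vert (mkvelt g) * pg_edge (ebar f).
  pose c1 := path_image q * pg_vert (mkvelt (h * emono f r)).
  have rc : path_image (rcons q (mkletter h)) =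
      path_image q * (pg_vert (mkvelt h) * pg_edge f).
    by elim: (q) => [|l' q' IHq] /=; rewrite ?mulg1 ?mul1g // IHq !mulgA.
  have c1E : c = d1 * c1 * d1^-1.
    apply: (mulIg d1); rewrite mulgVK cE /= rc /d1 /c1 pg_vertM -!mulgA.
    congr (_ * (_ * (_ * (_ * _)))); rewrite !mulgA.
    rewrite -[_ * pg_vert (mkvelt g)]mulgA -pg_vertM bgE.
    have -> : pg_edge f * pg_vert (mkvelt (emono (ebar f) r)) =
      pg_vert (mkvelt (emono f r)) * pg_edge f by exact: pg_edge_vert.
    by rewrite pg_edgeV mulgK.
  have wq : edge_walk (@rng GG) (rng f) (wedges q) (rng f).
    have [_ W] : rng (ebar f) = rng (ebar f) /\ edge_walk (@rng GG) (src (ebar f))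
      (wedges (rcons q (mkletter h))) (rng (ebar f)) := valid_walk vc.
    move: W; rewrite wedges_rcons -cats1 src_ebar => /edge_walk_cat[m wq [/= em _]].
    by subst m.
  have [wc1 szc1] := shift_le_path (h * emono f r) wq.
  have wd1 : word_images (rng (ebar f)) (rng f) d1.
    have W := word_images_edge (ebar f); rewrite src_ebar in W.
    exact: word_images_mul (word_images_vert g) W.
  have [|u' [d [c' [wd wc' c1E' alt]]]] := IH (rng f) c1 _ wc1.
    apply: leq_ltn_trans (szc1 _ (eps_valid _)) _.
    by move: lt; rewrite /= size_rcons addn0 !ltnS; lia.
  exists u', (d1 * d), c'; split=> //; first exact: word_images_mul wd1 wd.
  by rewrite c1E c1E' (invMg d1 d) !mulgA.
exists (rng e), 1, c; split=> //; [exact: word_images1 | by rewrite invg1 mulg1 mul1g | right].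
exists (size p).+1 => // m.
suff H m' : exists r a', pact (c ^+ m'.+1) (eps (rng e)) = (mkletter g :: r, a') /\
    size (mkletter g :: r) = (m'.+1 * (size p).+1)%N.
  case: m => [|m]; first by rewrite expg0 pact1.
  by have [r [a' [-> ->]]] := H m.
elim: m' => [|m' [r [a' [Er szr]]]]; first by exists p, (mkvelt b); rewrite expg1 mul1n.
have vz : valid (rng e) (mkletter g :: r, a').
  have wcm : word_images (rng e) (rng e) (c ^+ m'.+1).
    elim: (m'.+1) => [|j IHj]; first exact: word_images1.
    by rewrite expgS; exact: word_images_mul wc IHj.
  by rewrite -Er; case: (pact_word_images wcm (eps_valid _)).
rewrite expgS pactM // Er cE pactM ?(pact_vert b vz); last exact: valid_validw vz.
have vz' := vact_valid b vz.
set z' := vact _ _ in vz' *.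
have hz' : exists r', z'.1 = mkletter (coset_rep (b * g)) :: r'.
  by rewrite /z' vact_cons /=; eexists; reflexivity.
have [r' z'E] := hz'.
have fz' : follow f z'.1.
  apply: follow_startP; first by rewrite sf; case: vz'.
  by move=> l p'; rewrite z'E => -[<- _] ?; apply: ok.
have sz' : startok (rng e) ((mkletter g :: p) ++ z'.1).
  by apply/startok_cat; split; first by case: vc.
have vz'' : valid (pend (rng e) (mkletter g :: p)) z'.
  by case: vc => _ /= <-.
have [-> _] := pact_path (proj1 vc) vz'' sz'.
exists (p ++ z'.1), z'.2; split=> //.
by rewrite /= size_cat [size z'.1]size_vact szr /= [in RHS]mulSn addSn.
Qed.

Implicit Types (u : vert GG) (c d : path_group GG).

Lemma word_imagesX u c n : word_images u u c -> word_images u u (c ^+ n).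
Proof.
move=> wc; elim: n => [|n IH]; first exact: word_images1.
by rewrite expgS; exact: word_images_mul wc IH.
Qed.

(** Conjugation by d changes lengths by a bounded amount, whereas the lengths of c^(mt) and c^(nt)
    differ by (n - m) t L. *)
Lemma translation_not_conj u c d m n : word_images u u c -> word_images u u d ->
  translation u c -> (m < n)%N -> d * c ^+ m <> c ^+ n * d.
Proof.
move=> wc wd [L L0 HL] mn E.
have Et t : d * c ^+ (m * t) = c ^+ (n * t) * d.
  rewrite !expgnA; elim: t => [|t IH]; first by rewrite mulg1 mul1g.
  by rewrite !expgS mulgA E -mulgA IH mulgA.
have Hd := shift_le_size wd; have Hd' := shift_le_size (word_images_inv wd).
set n1 := size _ in Hd; set n2 := size _ in Hd'.
(* One more than the total length that d and its inverse can contribute. *)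
pose t := (n1 + n2).+1.
have Hc := shift_le_size (word_imagesX (m * t) wc); rewrite HL in Hc.
have [_ H] := shift_leM (shift_leM Hd Hc) Hd'.
have := H _ (eps_valid u); rewrite Et mulgK HL /= addn0.
have h1 : (m.+1 * t * L <= n * t * L)%N by rewrite leq_mul // leq_mul.
have h2 : (t <= t * L)%N by rewrite leq_pmulr.
by move: h1; rewrite mulSn mulnDl /t in h2 *; lia.
Qed.

(* An element whose distinct powers are conjugate fixes a vertex of the tree. *)
Lemma conj_powers_elliptic u c d m n : word_images u u c -> word_images u u d ->
  m <> n -> d * c ^+ m = c ^+ n * d ->
  exists u' d' b, word_images u u' d' /\ c = d' * pg_vert (@mkvelt GG u' b) * d'^-1.
Proof.
move=> wc wd mn E.
have [u' [d' [c' [wd' wc' cE [[b bE]|tr]]]]] := cyclic_reduction_word wc.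
  by exists u', d', b; rewrite -bE.
exfalso; pose k := d'^-1 * d * d'.
have wk : word_images u' u' k.
  exact: word_images_mul (word_images_mul (word_images_inv wd') wd) wd'.
have cX j : c ^+ j = d' * c' ^+ j * d'^-1.
  elim: j => [|j IH]; first by rewrite mulg1 mulgV.
  by rewrite expgS IH cE expgS !mulgA mulgVK.
have Ek : k * c' ^+ m = c' ^+ n * k.
  move: E; rewrite !cX => E; rewrite /k.
  apply: (mulgI d'); apply: (mulIg d'^-1); rewrite !mulgA in E *.
  by rewrite mulgV mul1g E mulgK.
clearbody k.
have [lt|gt|//] := ltngtP m n; first exact: (translation_not_conj wc' wk tr lt Ek).
apply: (translation_not_conj wc' (word_images_inv wk) tr gt).
have -> : c' ^+ m = k^-1 * (c' ^+ n * k) by rewrite -Ek mulKg.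
by rewrite !mulgA mulgK.
Qed.

End CyclicReduction.

(** * Centralizers and moduli in GBS groups *)

Section GBSCentralizer.
Variables (GG : graph_of_groups) (k : edge GG -> int).
Variables (phi : forall w : vert GG, int -> vgrp w)
          (psi : forall a : gedge GG, int -> egrp a).
Arguments phi : clear implicits.
Arguments psi : clear implicits.
Hypotheses (phi_bij : forall w, bijective (phi w) /\
              {morph phi w : i j / (i + j)%R >-> i * j})
  (psi_bij : forall a, bijective (psi a) /\
              {morph psi a : i j / (i + j)%R >-> i * j})
  (k0 : forall e, k e <> 0%R)
  (emono_phi : forall e z, emono e (psi e.1 z) = phi (rng e) (k e * z)%R).
Implicit Types (u w : vert GG) (s : seq (edge GG)).

Definition vgen w z : path_group GG := pg_vert (mkvelt (phi w z)).

Lemma vgenM w : int_morph (vgen w).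
Proof. by move=> i j; rewrite /vgen (phiD phi_bij) pg_vertM. Qed.

Lemma vgenX w (n : nat) : vgen w n = vgen w 1%R ^+ n.
Proof.
elim: n => [|n IH]; last by rewrite intS vgenM IH expgS.
by apply: (mulgI (vgen w 0%R)); rewrite -vgenM mulg1 addr0.
Qed.

(** If the normal form of y had a last edge l, comparing the final elements of the two sides would
    put the generator of G_w into the image of the group of l, which has index greater than 1. *)
Lemma vert_centralizer u w y h : (forall e, (1 < `|k e|)%N) ->
  word_images u w y -> y * vgen w 1%R = pg_vert (@mkvelt GG u h) * y ->
  u = w /\ exists b, y = pg_vert (@mkvelt GG w b).
Proof.
move=> big wy E.
have [vy iy] := pact_word_images wy (eps_valid w).
have ty := pact_tag wy (eps_valid w).
move: vy iy ty; case: (pact y _) => p a; rewrite img_eps mulg1.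
case: (velt_mk a) => w2 [b ->] /= vy iy ty; subst w2.
case/lastP: p vy iy => [|p l] vy iy.
  split; first by case/valid_nil: vy.
  by exists b; rewrite -iy /img /= mul1g.
exfalso.
have vyg : valid u (rcons p l, mkvelt (b * phi w 1%R)) by [].
have E2 : (rcons p l, mkvelt (b * phi w 1%R)) = vact (mkvelt h) (rcons p l, mkvelt b).
  apply: (img_inj vyg (vact_valid h vy)); first by rewrite vact_tag.
  by rewrite (img_vact h vy) iy -E -iy /img /= pg_vertM mulgA.
have [r rE] := carry_rcons (mkvelt h) p l.
move: E2; rewrite -[in vact _ _](cats0 (rcons p l)) vact_cat rE => -[_].
have wl : w = rng (ebar (tag l)).
  by case: vy => _; rewrite pend_rcons.
subst w; rewrite vact_nil => /mkvelt_inj.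
rewrite (gbs_comm phi_bij b) => /mulIg.
have [z ->] := psi_surj psi_bij r; rewrite (emono_phi (ebar (tag l)) z).
move/(phi_inj phi_bij)/(congr1 absz); rewrite abszM.
by have := big (ebar (tag l)); case: `|z|%N => [|n]; nia.
Qed.

Definition iprod (j : edge GG -> int) s : int := (\prod_(e <- s) j e)%R.

Lemma iprod_abs j s : `|iprod j s|%N = kprod j s.
Proof.
rewrite /iprod /kprod; elim: s => [|e s IH]; first by rewrite !big_nil.
by rewrite !big_cons abszM IH.
Qed.

Lemma walk_word_images u s w : edge_walk (@rng GG) u s w ->
  word_images u w (path_image (ones s)).
Proof.
move=> us; rewrite -[path_image _]mulg1.
by apply: path_word_images (word_images1 w); rewrite wedges_ones.
Qed.

Lemma walk_modulus u s w t : edge_walk (@rng GG) u s w ->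
  path_image (ones s) * vgen w (iprod (k \o @ebar _) s * t)%R =
  vgen u (iprod k s * t)%R * path_image (ones s).
Proof.
elim: s u t => [|e s IH] u t /=.
  by move=> ->; rewrite /iprod !big_nil mul1g mulg1.
move=> [<- us]; rewrite /iprod !big_cons pg_vert1 mul1g /=.
rewrite -!/(iprod _ _) (_ : _ * _ * t = iprod (k \o @ebar _) s * (k (ebar e) * t))%R; last first.
  by ring.
rewrite -[in LHS]mulgA (IH _ _ us) !mulgA; congr (_ * _).
rewrite (_ : iprod k s * _ = k (ebar e) * (iprod k s * t))%R; last by ring.
rewrite -[in RHS]mulrA.
have := @pg_edge_vert GG e (psi e.1 (iprod k s * t)%R).
by rewrite (emono_phi (ebar e) (_ * _)%R) emono_phi.
Qed.

Lemma gbs_modulus u : ~ unimodular k -> exists h m n,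
  [/\ word_images u u h, m <> n & h * vgen u 1%R ^+ m = vgen u 1%R ^+ n * h].
Proof.
move=> nu; have [u0 [s [s0 neq]]] := non_unimodular_walk k0 nu.
have [r ur] := graph_connected u u0.
pose X := path_image (ones s); pose Y := path_image (ones r).
have wX := walk_word_images s0; have wY := walk_word_images ur.
pose A := iprod (k \o @ebar _) s; pose D := iprod k s.
pose A' := iprod (k \o @ebar _) r; pose D' := iprod k r.
pose h := Y * X * Y^-1.
have wh : word_images u u h.
  exact: word_images_mul (word_images_mul wY wX) (word_images_inv wY).
have hP t : h * vgen u (D' * A * t)%R = vgen u (D' * D * t)%R * h.
  have YV z : Y^-1 * vgen u (D' * z)%R = vgen u0 (A' * z)%R * Y^-1.
    apply: (mulgI Y); apply: (mulIg Y).
    by rewrite !mulgA mulgV mul1g mulgVK -(walk_modulus z ur).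
  rewrite /h -[(D' * A * t)%R]mulrA -!mulgA YV !mulgA.
  rewrite mulrCA -[Y * X * _]mulgA (walk_modulus (A' * t)%R s0) !mulgA.
  rewrite mulrCA (walk_modulus (D * t)%R ur) -!mulrA -!mulgA; congr (_ * _).
(* Squaring h makes both exponents squares, hence naturals. The factor D' comes from the path
   joining u to the closed walk and makes the exponents divisible enough to be carried along it. *)
exists (h * h), (absz ((D' * A) * (D' * A))%R), (absz ((D' * D) * (D' * D))%R); split.
- exact: (word_images_mul wh wh).
- rewrite !abszM !iprod_abs => E; apply: neq; rewrite -/(kprod' k s) in E.
  move/eqP: E; rewrite !mulnn eqn_exp2r // eqn_pmul2l ?(kprod_gt0 k0) //.
  by move=> /eqP ->.
have ab (z : int) : Posz (absz (z * z)%R) = (z * z)%R.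
  by rewrite abszE ger0_norm // -expr2 sqr_ge0.
rewrite -!vgenX !ab -mulgA hP mulrC.
by rewrite mulgA hP -mulgA.
Qed.

End GBSCentralizer.

Lemma pi1_word_images (GG : graph_of_groups) (v : vert GG) (x : pi1 v) :
  word_images v v (pi1_val x).
Proof. by case: x => x /= /asboolP. Qed.

Lemma pi1_of_word (GG : graph_of_groups) (v : vert GG) c :
  word_images v v c -> exists x : pi1 v, pi1_val x = c.
Proof.
by move=> wc; have cP : c \in @pi1_pred GG v by [apply/asboolP]; exists (Pi1 cP).
Qed.

Lemma pi1_valX (GG : graph_of_groups) (v : vert GG) (x : pi1 v) n :
  pi1_val (x ^+ n) = pi1_val x ^+ n.
Proof.
elim: n => [|n IH] //; rewrite !expgS -IH; reflexivity.
Qed.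

Lemma morphX (G H : groupType) (f : G -> H) n : {morph f : x y / x * y} ->
  {morph f : x / x ^+ n}.
Proof.
move=> fM x; elim: n => [|n IH]; first by rewrite !expg0 morph1.
by rewrite !expgS fM IH.
Qed.

(** * Vertex generators under an isomorphism with BS(p,q) *)

Section NotBS.
Variables (GG : graph_of_groups) (k : edge GG -> int).
Variables (phi : forall w : vert GG, int -> vgrp w)
          (psi : forall a : gedge GG, int -> egrp a).
Arguments phi : clear implicits.
Arguments psi : clear implicits.
Hypotheses (phi_bij : forall w, bijective (phi w) /\
              {morph phi w : i j / (i + j)%R >-> i * j})
  (psi_bij : forall a, bijective (psi a) /\
              {morph psi a : i j / (i + j)%R >-> i * j})
  (k0 : forall e, k e <> 0%R)
  (emono_phi : forall e z, emono e (psi e.1 z) = phi (rng e) (k e * z)%R)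
  (big : forall e, (1 < `|k e|)%N) (nu : ~ unimodular k).
Variables (p q : int) (p0 : p != 0%R) (q0 : q != 0%R).
Variables (w : vert GG) (f : pi1 w -> pi1 (loop_v p0 q0)).
Hypotheses (f_bij : bijective f) (fM : {morph f : x y / x * y}).
Implicit Types (u : vert GG) (x y : pi1 w).

(** The image of the generator of G_u has two distinct conjugate powers, so it is elliptic in the
    loop group, where the only vertex group is the one of a. The conjugator is pulled back through f
    and absorbed in D. *)
Lemma vgen_to_loop u : exists x D z, [/\ word_images w u D,
  pi1_val x = D * vgen phi u 1%R * D^-1 & pi1_val (f x) = loop_a p0 q0 z].
Proof.
have [r wr] := graph_connected w u; have wP := walk_word_images wr.
set P := path_image _ in wP.
have [h [m [n [wh mn E]]]] := gbs_modulus phi_bij k0 emono_phi u nu.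
set a := vgen phi u 1%R in E *.
have wa : word_images u u a by exact: word_images_vert.
have conj d : word_images u u d -> exists x, pi1_val x = P * d * P^-1.
  move=> wd; apply: pi1_of_word.
  exact: word_images_mul (word_images_mul wP wd) (word_images_inv wP).
have [X XE] := conj _ wa; have [H HE] := conj _ wh.
have PX d j : (P * d * P^-1) ^+ j = P * d ^+ j * P^-1.
  elim: j => [|j IH]; first by rewrite mulg1 mulgV.
  by rewrite !expgS IH !mulgA mulgVK.
have EX : H * X ^+ m = X ^+ n * H.
  apply: val_inj.
  transitivity (pi1_val H * pi1_val (X ^+ m)); first by [].
  transitivity (pi1_val (X ^+ n) * pi1_val H); last by [].
  rewrite !pi1_valX XE HE !PX !mulgA !mulgVK.
  by rewrite -[P * h * _]mulgA E !mulgA.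
have EfX : pi1_val (f H) * pi1_val (f X) ^+ m = pi1_val (f X) ^+ n * pi1_val (f H).
  rewrite -!pi1_valX -!(morphX _ fM).
  transitivity (pi1_val (f H * f (X ^+ m))); first by [].
  by rewrite -fM EX fM.
have [u' [d' [b [wd' fXE]]]] :=
  conj_powers_elliptic (pi1_word_images _) (pi1_word_images _) mn EfX.
case: u' b wd' fXE => b wd' fXE.
have [Dd DE] := pi1_of_word wd'.
case: (f_bij) => g gK fK.
exists ((g Dd)^-1 * X * g Dd), ((pi1_val (g Dd))^-1 * P), b; split.
- exact: word_images_mul (word_images_inv (pi1_word_images _)) wP.
- transitivity ((pi1_val (g Dd))^-1 * pi1_val X * pi1_val (g Dd)); first by [].
  by rewrite XE invMg invgK !mulgA.
rewrite !fM (morphV fM) fK.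
transitivity ((pi1_val Dd)^-1 * pi1_val (f X) * pi1_val Dd); first by [].
by rewrite fXE DE !mulgA mulVg mul1g mulgVK.
Qed.

(** The vertex group of the loop is abelian, so everything mapped into it commutes with the
    conjugated generator of G_u; [vert_centralizer] then places it in the same conjugate of G_u. *)
Lemma loop_preimage u : exists2 D, word_images w u D & forall x z,
  pi1_val (f x) = loop_a p0 q0 z ->
  exists b, pi1_val x = D * pg_vert (@mkvelt GG u b) * D^-1.
Proof.
have [x [D [z [wD xE fxE]]]] := vgen_to_loop u; exists D => // x' z' fx'E.
have E : x' * x = x * x'.
  case: (f_bij) => g gK _; apply: (can_inj gK); rewrite !fM; apply: val_inj.
  transitivity (pi1_val (f x') * pi1_val (f x)); first by [].
  transitivity (pi1_val (f x) * pi1_val (f x')); last by [].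
  by rewrite fxE fx'E -!(loop_aM p0 q0) addrC.
have {}E : pi1_val x' * pi1_val x = pi1_val x * pi1_val x'.
  exact: (congr1 (@pi1_val _ _) E).
have wy : word_images u u (D^-1 * pi1_val x' * D).
  exact: word_images_mul (word_images_mul (word_images_inv wD) (pi1_word_images _)) wD.
have [|_ [b bE]] := vert_centralizer phi_bij psi_bij emono_phi big wy (h := phi u 1%R).
  rewrite -/(vgen phi u 1%R); apply: (mulgI D); apply: (mulIg D^-1).
  move: E; rewrite xE !mulgA => E.
  by rewrite !mulgV !mul1g mulgK E.
by exists b; rewrite -bE !mulgA mulgV mul1g mulgK.
Qed.

(** The conjugated generator of G_{u2} also lies in a conjugate of G_{u1}, so D1^-1 D2 carries it
    into G_{u1}, and [vert_centralizer] identifies the vertices. *)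
Lemma loop_one_vertex u1 u2 : u1 = u2.
Proof.
have [x [D2 [z [wD2 xE fxE]]]] := vgen_to_loop u2.
have [D1 wD1 H] := loop_preimage u1.
have [b bE] := H _ _ fxE.
have wY : word_images u1 u2 (D1^-1 * D2).
  exact: word_images_mul (word_images_inv wD1) wD2.
have [|-> //] := vert_centralizer phi_bij psi_bij emono_phi big wY (h := b).
apply: (mulgI D1); apply: (mulIg D2^-1).
by rewrite !mulgA mulgV mul1g -xE bE mulgK.
Qed.

End NotBS.

Lemma not_BS_two_vertices (GG : graph_of_groups) (k : edge GG -> int)
    (w u1 u2 : vert GG) : gbs_coeffs k -> (forall e, (2 <= `|k e|)%R) ->
  ~ unimodular k -> u1 <> u2 ->
  forall p q : int, (2 <= (`|p| - 1) * (`|q| - 1))%R -> ~ group_iso (pi1 w) (BS p q).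
Proof.
move=> [phi [psi [phiP psiP k0 kE]]] big nu u12 p q /nondegenerate_bounds[p2 q2] [f bf fM].
have p0 : p != 0%R by rewrite -normr_eq0; apply/eqP => E; rewrite E in p2.
have q0 : q != 0%R by rewrite -normr_eq0; apply/eqP => E; rewrite E in q2.
have [F [bF FM _]] := bs_iso p0 q0.
apply: u12; apply: (@loop_one_vertex GG k phi psi phiP psiP k0 kE _ nu p q p0 q0 w (F \o f)).
- by move=> e; have := big e; lia.
- exact: bij_comp.
- by move=> x y; rewrite /= fM FM.
Qed.

Lemma not_BS_two_loops (GG : graph_of_groups) (k : edge GG -> int)
    (w : vert GG) (h1 h2 : path_group GG -> intgrp) c1 c2 :
  gbs_coeffs k -> (forall e, (2 <= `|k e|)%R) -> ~ unimodular k ->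
  {morph h1 : x y / x * y} -> {morph h2 : x y / x * y} ->
  (forall g, h1 (pg_vert g) = 1) -> (forall g, h2 (pg_vert g) = 1) ->
  word_images w w c1 -> word_images w w c2 ->
  h1 c1 = 1%R -> h2 c1 = 0%R -> h1 c2 = 0%R -> h2 c2 = 1%R ->
  forall p q : int, (2 <= (`|p| - 1) * (`|q| - 1))%R -> ~ group_iso (pi1 w) (BS p q).
Proof.
move=> [phi [psi [phiP psiP k0 kE]]] big nu h1M h2M h1v h2v wc1 wc2 h11 h21 h12 h22.
move=> p q /nondegenerate_bounds[p2 q2] [f bf fM].
have p0 : p != 0%R by rewrite -normr_eq0; apply/eqP => E; rewrite E in p2.
have q0 : q != 0%R by rewrite -normr_eq0; apply/eqP => E; rewrite E in q2.
have [F [bF FM Fa]] := bs_iso p0 q0.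
have FfM : {morph F \o f : x y / x * y} by move=> x y; rewrite /= fM FM.
have big' e : (1 < `|k e|)%N by have := big e; lia.
have [D wD HD] := loop_preimage phiP psiP k0 kE big' nu (bij_comp bF bf) FfM w.
case: (bf) => g gK fK.
have gM : {morph g : x y / x * y} by move=> x y; rewrite -{1}[x]fK -{1}[y]fK -fM gK.
pose t := pi1_val (g (pres_class _ (fgen false))).
have vM (x y : pi1 w) : pi1_val (x * y) = pi1_val x * pi1_val y by [].
have ha (h : path_group GG -> intgrp) : {morph h : x y / x * y} ->
    (forall g, h (pg_vert g) = 1) ->
    h (pi1_val (g (pres_class _ (fgen true)))) = 1.
  move=> hM hv; have [|b ->] := HD (g (pres_class _ (fgen true))) 1%R.
    by rewrite /= fK.
  by rewrite !hM hv mulg1 -hM mulgV (morph1 hM).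
(* Both counts vanish on a, so they depend only on the exponent sum T of t. *)
have key (x : BS p q) : exists T : int,
    h1 (pi1_val (g x)) = (T * (h1 t : int))%R /\ h2 (pi1_val (g x)) = (T * (h2 t : int))%R.
  move: x; apply: pres_ind.
  - exists 0%R; rewrite !mul0r (morph1 gM).
    by split; [exact: (morph1 h1M) | exact: (morph1 h2M)].
  - move=> x y [T [E1 E2]] [T' [E1' E2']]; exists (T + T')%R.
    by rewrite gM vM h1M h2M E1 E2 E1' E2' !mulrDl.
  - move=> x [T [E1 E2]]; exists (- T)%R; rewrite (morphV gM).
    have -> : pi1_val (g x)^-1 = (pi1_val (g x))^-1 by [].
    by rewrite (morphV h1M) (morphV h2M) E1 E2 !mulNr.
  case; last by exists 1%R; rewrite !mul1r.
  by exists 0%R; rewrite !mul0r !ha.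
have [x1 x1E] := pi1_of_word wc1; have [x2 x2E] := pi1_of_word wc2.
have [T1 []] := key (f x1); rewrite gK x1E h11 h21 => A1 A2.
have [T2 []] := key (f x2); rewrite gK x2E h12 h22 => B1 B2.
(* The vectors (1,0) and (0,1) would be integer multiples T1 and T2 of the same vector; multiplying
   1 = T1 h1(t) by T2 gives T2 = 0, against T2 h2(t) = 1. *)
have := congr1 (fun z : int => z * T2)%R A1.
rewrite mul1r -mulrA [(_ * T2)%R]mulrC -B1 mulr0 => T20.
by move: B2; rewrite T20 mul0r.
Qed.

(** * Circles and wedges of circles *)

Section Circles.
Variables (GG : graph_of_groups) (k : edge GG -> int).
Hypothesis k0 : forall e, k e <> 0%R.
Implicit Types (u : vert GG) (s : seq (edge GG)).

Definition walk_modulus_rat s : rat :=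
  (\prod_(e <- s) ((k (ebar e))%:~R / (k e)%:~R))%R.

Lemma edge_walk_rev u s w : edge_walk (@rng GG) u s w ->
  edge_walk (@rng GG) w (rev [seq ebar e | e <- s]) u.
Proof.
elim: s u => [|e s IH] u /=; first by [].
move=> [<- /IH H]; rewrite rev_cons -cats1; apply/edge_walk_cat.
by exists (src e) => //=; rewrite ebarK.
Qed.

Lemma walk_modulus_rev s :
  walk_modulus_rat (rev [seq ebar e | e <- s]) = ((walk_modulus_rat s)^-1)%R.
Proof.
rewrite /walk_modulus_rat big_rev big_map -prodfV; apply: eq_bigr => e _.
by rewrite ebarK invf_div.
Qed.

Lemma walk_modulus_cat s t :
  walk_modulus_rat (s ++ t) = (walk_modulus_rat s * walk_modulus_rat t)%R.
Proof. exact: big_cat. Qed.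

Lemma edge_walk_iota (f : nat -> edge GG) a m :
  (forall i, src (f i) = rng (f i.+1)) ->
  edge_walk (@rng GG) (rng (f a)) [seq f i | i <- iota a m] (rng (f (a + m))).
Proof.
move=> H; elim: m a => [|m IH] a /=; first by rewrite addn0.
by split=> //; rewrite -/(src (f a)) H addnS -addSn; exact: IH.
Qed.

Section OneCircle.
Variables (n : nat) (c : 'I_n -> edge GG).
Hypotheses (n0 : (0 < n)%N) (cc : circle_in c).

Definition cidx i : 'I_n := Ordinal (ltn_pmod i n0).
Definition circle_walk : seq (edge GG) := [seq c (cidx i) | i <- iota 0 n].

Lemma circle_walk_closed :
  edge_walk (@rng GG) (rng (c (cidx 0))) circle_walk (rng (c (cidx 0))).
Proof.
have := @edge_walk_iota (c \o cidx) 0 n; rewrite add0n.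
have -> : (c \o cidx) n = (c \o cidx) 0%N.
  by congr c; apply: val_inj; rewrite /= modnn mod0n.
apply=> i; case: cc => /(_ (cidx i)) E _ _; rewrite /= E; congr (rng (c _)).
by apply: val_inj; rewrite /= -addn1 modnDml addn1.
Qed.

Lemma circle_walk_big (R : Type) (idx : R) (op : R -> R -> R) (F : edge GG -> R) :
  \big[op/idx]_(e <- circle_walk) F e = \big[op/idx]_(j < n) F (c j).
Proof.
rewrite /circle_walk big_map -{1}[n]subn0 -/(index_iota 0 n) big_mkord.
apply: eq_bigr => i _; congr (F (c _)); apply: val_inj.
by rewrite /= modn_small.
Qed.

(** The inverse appears because q divides k_e by k_{ebar e}, while the modulus of a word divides the
    other way. *)
Lemma circle_walk_modulus : walk_modulus_rat circle_walk = ((circle_ratio k c)^-1)%R.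
Proof.
rewrite /walk_modulus_rat circle_walk_big /circle_ratio -prodfV.
by apply: eq_bigr => j _; rewrite invf_div.
Qed.

(** Each vertex of a circle is the range of the next edge and of the reversal of the previous one;
    these differ even for n = 1. *)
Lemma circle_branch (j : 'I_n) : exists e f : edge GG, rng e = rng f /\ e <> f.
Proof.
case: cc => cs _ ci; exists (c (ordS j)), (ebar (c j)); split.
  by rewrite -cs.
move=> E; have := ci (ordS j, true) (j, false) E; by [].
Qed.

End OneCircle.

Lemma finite_graph_covered (I : finType) (d : I -> edge GG) :
  (forall w : vert GG, exists i, w = rng (d i)) ->
  (forall f : edge GG, exists i, f = d i \/ f = ebar (d i)) -> finite_graph GG.
Proof.
move=> Hw Hf; split.
  apply: (@sub_finite_set _ _ ((fun i => rng (d i)) @` [set: I])).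
    by move=> w _; have [i ->] := Hw w; exists i.
  exact/finite_image/finite_finset.
apply: (@sub_finite_set _ _ ((fun i => (d i).1) @` [set: I])).
  move=> a _; have [i [] E] := Hf (a, true).
    by exists i => //; rewrite -E.
  by exists i => //; have := congr1 fst E.
exact/finite_image/finite_finset.
Qed.

End Circles.

Lemma abs_neq1 (x : rat) : x <> 1%R -> x <> (-1)%R -> (`|x^-1| != 1)%R.
Proof.
move=> x1 xN1; rewrite normfV -[1%R in X in _ != X]invr1 (inj_eq invr_inj).
by rewrite eqr_norml ler01 andbT negb_or; apply/andP; split; apply/eqP.
Qed.

Theorem circle_class_C (GG : graph_of_groups) (w : vert GG) (k : edge GG -> int)
    (n : nat) (c : 'I_n -> edge GG) :
  (1 <= n)%N -> circle_graph c -> gbs_coeffs k ->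
  (forall j, (2 <= `|k (c j)| /\ 2 <= `|k (ebar (c j))|)%R) ->
  circle_ratio k c <> 1%R -> circle_ratio k c <> (-1)%R ->
  class_C_gbs (pi1 w) /\
  ((2 <= n)%N -> forall p q : int,
     (2 <= (`|p| - 1) * (`|q| - 1))%R -> ~ group_iso (pi1 w) (BS p q)).
Proof.
move=> n0 [cc cw cf] gbs bigc q1 qN1.
have big e : (2 <= `|k e|)%R by have [j [->|->]] := cf e; case: (bigc j).
have fin : finite_graph GG by exact: finite_graph_covered cw cf.
have nu : ~ unimodular k.
  apply: (not_unimodular_walk (circle_walk_closed n0 cc)).
  rewrite -/(walk_modulus_rat k _) circle_walk_modulus.
  exact: abs_neq1.
split.
  have [e [f [ef nef]]] := circle_branch cc (cidx n0 0).
  apply: (gbs_class_C gbs big fin _ nu (group_iso_refl _)).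
  exact: three_letters_edges (gbs_thick gbs big) ef nef.
move=> n2; have [_ ci _] := cc.
apply: (not_BS_two_vertices (u1 := rng (c (Ordinal n0))) (u2 := rng (c (Ordinal n2))) gbs big nu).
by move/ci.
Qed.

Section EdgeCount.
Variables (GG : graph_of_groups) (e0 : edge GG).

Definition edge_sign (e : edge GG) : intgrp :=
  if e == e0 then 1%R else if e == ebar e0 then (-1)%R else 0%R.

Definition edge_count_gen (x : path_gen GG) : intgrp :=
  if x is inl e then edge_sign e else 1.

Lemma edge_sign_ebar e : edge_sign (ebar e) = (edge_sign e)^-1.
Proof.
rewrite /edge_sign -[e == ebar e0](inj_eq (can_inj (@ebarK GG))) ebarK.
rewrite -[ebar e == ebar e0](inj_eq (can_inj (@ebarK GG))) !ebarK.
have [->|] := eqVneq e e0; last by case: ifP.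
by case: eqP => // /esym/ebar_neq.
Qed.

Lemma edge_count_rels w1 w2 : @path_rel GG w1 w2 ->
  weval edge_count_gen w1 = weval edge_count_gen w2.
Proof.
case=> [w g h|e|e g]; rewrite /= ?mulg1 ?mul1g //.
  by rewrite edge_sign_ebar mulVg.
by rewrite edge_sign_ebar mulgV.
Qed.

Definition edge_count : path_group GG -> intgrp :=
  pres_lift (rels := @path_rel GG) edge_count_gen.

Lemma edge_countM : {morph edge_count : x y / x * y}.
Proof. exact: pres_liftM edge_count_rels. Qed.

Lemma edge_count_vert g : edge_count (pg_vert g) = 1.
Proof. by rewrite /edge_count (pres_lift_class edge_count_rels) /= mulg1. Qed.

Lemma edge_count_edge e : edge_count (pg_edge e) = edge_sign e.
Proof. by rewrite /edge_count (pres_lift_class edge_count_rels) /= mulg1. Qed.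

Lemma edge_count_walk s :
  edge_count (path_image (ones s)) = (\sum_(e <- s) (edge_sign e : int))%R.
Proof.
elim: s => [|e s IH]; first by rewrite big_nil (morph1 edge_countM).
by rewrite big_cons /= !edge_countM edge_count_vert edge_count_edge IH mul1g.
Qed.

Lemma edge_count_conj d x : edge_count (d * x * d^-1) = edge_count x.
Proof.
rewrite !edge_countM (morphV edge_countM).
have H (a b : int) : (a + b - a = b)%R by rewrite addrAC subrr add0r.
exact: H.
Qed.

End EdgeCount.

Theorem wedge_class_C (GG : graph_of_groups) (v w : vert GG) (k : edge GG -> int)
    (m n : nat) (c : 'I_m -> 'I_n -> edge GG) (F : {set 'I_m}) (s : 'I_m -> bool) :
  (1 <= m)%N -> (1 <= n)%N -> wedge_graph v c -> gbs_coeffs k ->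
  (forall e, (2 <= `|k e|)%R) ->
  let P := (\prod_(i in F)
    (if s i then circle_ratio k (c i) else (circle_ratio k (c i))^-1))%R in
  P <> 1%R -> P <> (-1)%R ->
  class_C_gbs (pi1 w) /\
  ((2 <= n)%N \/ (2 <= m)%N -> forall p q : int,
     (2 <= (`|p| - 1) * (`|q| - 1))%R -> ~ group_iso (pi1 w) (BS p q)).
Proof.
move=> m0 n0 [cc cv cd cw cf] gbs big P P1 PN1.
have fin : finite_graph GG.
  apply: (@finite_graph_covered GG ('I_m * 'I_n)%type (fun ij => c ij.1 ij.2)).
    by move=> u; have [i [j ->]] := cw u; exists (i, j).
  by move=> f; have [i [j H]] := cf f; exists (i, j).
have Wv i : edge_walk (@rng GG) v (circle_walk (c i) n0) v.
  have := circle_walk_closed n0 (cc i); rewrite cv //=; exact: mod0n.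
(* The sign of the exponent selects the direction in which the circle is traversed. All these walks
   are closed at v, so those over F concatenate. *)
pose W i := if s i then circle_walk (c i) n0
  else rev [seq ebar e | e <- circle_walk (c i) n0].
have WW i : edge_walk (@rng GG) v (W i) v.
  by rewrite /W; case: ifP => _ //; exact: edge_walk_rev.
have Wm i : walk_modulus_rat k (W i) =
    ((if s i then circle_ratio k (c i) else (circle_ratio k (c i))^-1)^-1)%R.
  rewrite /W; case: ifP => _; first exact: circle_walk_modulus.
  by rewrite walk_modulus_rev circle_walk_modulus.
have nu : ~ unimodular k.
  pose S := flatten [seq W i | i <- enum F].
  have SW : edge_walk (@rng GG) v S v.
    rewrite /S; elim: (enum F) => //= i t IH; apply/edge_walk_cat.
    by exists v.
  apply: (not_unimodular_walk SW); rewrite -/(walk_modulus_rat k _).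
  have -> : walk_modulus_rat k S = (P^-1)%R.
    rewrite /P -prodfV -big_enum /S; elim: (enum F) => [|i t IH] /=.
      by rewrite /walk_modulus_rat !big_nil.
    by rewrite walk_modulus_cat big_cons IH Wm.
  exact: abs_neq1.
pose i0 := Ordinal m0.
split.
  have [e [f [ef nef]]] := circle_branch (cc i0) (cidx n0 0).
  apply: (gbs_class_C gbs big fin _ nu (group_iso_refl _)).
  exact: three_letters_edges (gbs_thick gbs big) ef nef.
move=> nm; have [n2|n1] := ltnP 1 n.
  have [_ ci _] := cc i0.
  apply: (not_BS_two_vertices (u1 := rng (c i0 (Ordinal n0)))
    (u2 := rng (c i0 (Ordinal n2))) gbs big nu).
  by move/ci.
have m2 : (1 < m)%N by case: nm => //; lia.
pose i1 := Ordinal m2; pose j0 := cidx n0 0.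
(* Signed passages through the first edge of a circle: the circles are disjoint in edges, so the
   counts form an identity matrix. *)
have cnt i i' : edge_count (c i j0) (path_image (ones (circle_walk (c i') n0))) =
    (if i' == i then 1%R else 0%R : int).
  rewrite edge_count_walk circle_walk_big /edge_sign.
  have [->|ni] := eqVneq i' i.
    have [_ _ ci] := cc i; rewrite (bigD1 j0) //= eqxx big1 ?addr0 // => j nj.
    case: eqP => [/(ci (j, true) (j0, true)) [E]|_]; first by rewrite E eqxx in nj.
    by case: eqP => // /(ci (j, true) (j0, false)).
  rewrite big1 // => j _; have [_ /eqP/negbTE -> /eqP/negbTE ->] //:= cd i' i j j0 (elimN eqP ni).
have [r wr] := graph_connected w v; have wR := walk_word_images wr.
set R := path_image _ in wR.
pose x i := R * path_image (ones (circle_walk (c i) n0)) * R^-1.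
have wx i : word_images w w (x i).
  apply: word_images_mul (word_images_inv wR).
  exact: word_images_mul wR (walk_word_images (Wv i)).
apply: (@not_BS_two_loops GG k w (edge_count (c i0 j0)) (edge_count (c i1 j0)) (x i0) (x i1)) => //.
- exact: edge_countM.
- exact: edge_countM.
- exact: edge_count_vert.
- exact: edge_count_vert.
- by rewrite edge_count_conj cnt eqxx.
- by rewrite edge_count_conj cnt.
- by rewrite edge_count_conj cnt.
- by rewrite edge_count_conj cnt eqxx.
Qed.

Local Close Scope group_scope.
Local Close Scope quotient_scope.
Local Close Scope card_scope.
Local Close Scope classical_set_scope.
Local Open Scope ring_scope.

Theorem theoremE (R : realType) :
  (forall (GG : graph_of_groups) (v : vert GG),
     locally_finite GG -> nonsingular GG -> conditions_i_iii v ->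
     (forall a : gedge GG, amenable R (egrp a)) ->
     Cstar_simple R (pi1 v) ->
     class_C R (pi1 v)) /\
  (forall (GG : graph_of_groups) (v : vert GG) (e : edge GG),
     single_edge_graph e -> locally_finite GG -> amenable R (egrp e.1) ->
     (2 <= (eindex e - 1) * (eindex (ebar e) - 1))%N ->
     Cstar_simple R (pi1 v) ->
     class_C_amenable R (pi1 v)) /\
  (forall G F : finGroupType,
     (2 <= (#|{: G}| - 1) * (#|{: F}| - 1))%N ->
     class_C_amenable R (free_product G F)) /\
  (forall (GG : graph_of_groups) (v : vert GG) (k : edge GG -> int),
     locally_finite GG -> nonsingular GG -> gbs_coeffs k -> finite_graph GG ->
     conditions_i_iii v -> ~ unimodular k ->
     class_C R (pi1 v) /\ Cstar_simple R (pi1 v)) /\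
  (forall k l : int,
     2 <= (`|k| - 1) * (`|l| - 1) -> `|k| <> `|l| ->
     class_C_gbs (BS k l)) /\
  (forall (GG : graph_of_groups) (w : vert GG) (k : edge GG -> int) (n : nat)
     (c : 'I_n -> edge GG),
     (1 <= n)%N -> circle_graph c -> gbs_coeffs k ->
     (forall j, 2 <= `|k (c j)| /\ 2 <= `|k (ebar (c j))|) ->
     circle_ratio k c <> 1 -> circle_ratio k c <> -1 ->
     class_C_gbs (pi1 w) /\
     ((2 <= n)%N -> forall p q : int,
        2 <= (`|p| - 1) * (`|q| - 1) -> ~ group_iso (pi1 w) (BS p q))) /\
  (forall (GG : graph_of_groups) (v w : vert GG) (k : edge GG -> int)
     (m n : nat) (c : 'I_m -> 'I_n -> edge GG)
     (F : {set 'I_m}) (s : 'I_m -> bool),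
     (1 <= m)%N -> (1 <= n)%N -> wedge_graph v c -> gbs_coeffs k ->
     (forall e, 2 <= `|k e|) ->
     let P := \prod_(i in F)
       (if s i then circle_ratio k (c i) else (circle_ratio k (c i))^-1) in
     P <> 1 -> P <> -1 ->
     class_C_gbs (pi1 w) /\
     ((2 <= n)%N \/ (2 <= m)%N -> forall p q : int,
        2 <= (`|p| - 1) * (`|q| - 1) -> ~ group_iso (pi1 w) (BS p q))).
Proof.
split.
  move=> GG v lf ns cond am cs; left; exists GG, v; split=> //.
  exact: group_iso_refl.
split; first exact: single_edge_class_C.
split; first by move=> G F big; exact: free_product_class_C.
split.
  move=> GG v k lf ns gbs fin cond nu; split; last first.
    by case: cond => _ flow _; exact: gbs_Cstar_simple gbs flow nu.
  right; exists GG, v, k; split=> //.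
  exact: group_iso_refl.
split; first exact: BS_class_C.
split; first by move=> GG w k n c; exact: circle_class_C.
by move=> GG v w k m n c F s; exact: wedge_class_C.
Qed.
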